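(* Let $n\ge1$. For every multisimplicial set $Y:(\Delta^{\times n})^{\mathrm{op}}\to\mathbf{Set}$, the morphism $\rho_Y: N^n(\Delta^{\boxtimes n}/Y)\to Y$ is a weak equivalence of multisimplicial sets.
   Context: $n$-fold categories: a $1$-fold category is a small category; for $n\ge2$ a (small, strict) $n$-fold category is a category object internal to the category of $(n-1)$-fold categories; $n$-fold functors are the internal functors, forming $\mathbf{nFoldCat}$. Equivalently, an $n$-fold category $\mathbb D$ consists of sets $\mathbb D_\epsilon$, $\epsilon\in\{0,1\}^n$ ($\mathbb D_{(0,\dots,0)}$ the objects, $\mathbb D_{(1,\dots,1)}$ the $n$-cubes), such that whenever $\epsilon,\epsilon'$ agree except $\epsilon_i=0,\epsilon'_i=1$, the pair $(\mathbb D_\epsilon,\mathbb D_{\epsilon'})$ is a category, and the structures in different directions commute (including the interchange law). For small categories $\mathbf C_i$, $\mathbf C_1\boxtimes\cdots\boxtimes\mathbf C_n$ is the $n$-fold category whose $\epsilon$-cubes are tuples $(x_1,\dots,x_n)$ with $x_i$ a morphism of $\mathbf C_i$ if $\epsilon_i=1$ and an object if $\epsilon_i=0$, with the structure in direction $i$ that of $\mathbf C_i$. The $n$-fold nerve is $(N^n\mathbb D)_{p_1,\dots,p_n}=\mathbf{nFoldCat}([p_1]\boxtimes\cdots\boxtimes[p_n],\mathbb D)$, a multisimplicial set. A morphism $f$ of multisimplicial sets is a weak equivalence iff $\delta^*f$ is a weak equivalence of simplicial sets, where $(\delta^*Y)_p=Y_{p,\dots,p}$. $n$-fold Grothendieck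 construction $\Delta^{\boxtimes n}/Y$: objects are pairs $(y,\overline k)$ with $\overline k=([k_1],\dots,[k_n])\in\Delta^{\times n}$ and $y\in Y_{\overline k}$. An $n$-cube with $(0,\dots,0)$-vertex $(y,\overline k)$ and $(1,\dots,1)$-vertex $(z,\overline\ell)$ is a morphism $\overline f=(f_1,\dots,f_n):\overline k\to\overline\ell$ in $\Delta^{\times n}$ with $\overline f^*(z)=y$; for $\epsilon\in\{0,1\}^n$ its $\epsilon$-vertex is $(f_1^{1-\epsilon_1},\dots,f_n^{1-\epsilon_n})^*(z)$, where $f^1=f$ and $f^0=\mathrm{id}$. A morphism in direction $i$ is an $n$-cube with $f_j$ the identity for $j\ne i$; a square in direction $ii'$ is an $n$-cube with $f_j$ the identity for $j\neq i,i'$; etc. Composition is induced by composition in $\Delta$ in each coordinate. A $\overline p$-multisimplex of $N^n(\Delta^{\boxtimes n}/Y)$, $\overline p=([p_1],\dots,[p_n])$, thus amounts to $n$ composable paths $[k^j_0]\xrightarrow{f^j_1}[k^j_1]\to\cdots\xrightarrow{f^j_{p_j}}[k^j_{p_j}]$ in $\Delta$ ($1\le j\le n$) together with a multisimplex $z\in Y_{k^1_{p_1},\dots,k^n_{p_n}}$ (the last vertex). Each path induces a map $g_j:[p_j]\to[k^j_{p_j}]$ sending $i$ to the image of the last element $k^j_i\in[k^j_i]$ under the composite of the last $p_j-i$ maps. The morphism $\rho_Y$ sends this multisimplex to $(g_1,\dots,g_n)^*(z)\in Y_{\overline p}$. *)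

(* Defs.v *)
From mathcomp Require Import all_boot.
From mathcomp Require Import boolp.
From Stdlib Require Import Relation_Operators.

Set Implicit Arguments.
Unset Strict Implicit.
Unset Printing Implicit Defensive.

Lemma funext_dep (A : Type) (B : A -> Type) (f g : forall x, B x) :
  (forall x, f x = g x) -> f = g.
Proof. exact: functional_extensionality_dep. Qed.

Lemma existT_inj (A : Type) (P : A -> Type) (x : A) (p q : P x) :
  existT P x p = existT P x q -> p = q.
Proof.
move=> H; rewrite -[RHS](projT2_eq H) /=.
by rewrite (Prop_irrelevance (projT1_eq H) erefl).
Qed.

(** * Categories *)

Record cat_on (O M : Type) := CatOn {
  src : M -> O;
  tgt : M -> O;
  idm : O -> M;
  comp : forall g f : M, src g = tgt f -> M;
  src_idm : forall x, src (idm x) = x;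
  tgt_idm : forall x, tgt (idm x) = x;
  src_comp : forall g f h, src (@comp g f h) = src f;
  tgt_comp : forall g f h, tgt (@comp g f h) = tgt g;
  comp_idl : forall f h, @comp (idm (tgt f)) f h = f;
  comp_idr : forall f h, @comp f (idm (src f)) h = f;
  comp_assoc : forall a b c hab hbc hab_c ha_bc,
    @comp (@comp a b hab) c hab_c = @comp a (@comp b c hbc) ha_bc
}.

Arguments comp {O M} _ g f _.

Record is_functor (O M O' M' : Type) (C : cat_on O M) (C' : cat_on O' M')
    (F0 : O -> O') (F1 : M -> M') : Prop := IsFunctor {
  functor_src : forall f, src C' (F1 f) = F0 (src C f);
  functor_tgt : forall f, tgt C' (F1 f) = F0 (tgt C f);
  functor_idm : forall x, F1 (idm C x) = idm C' (F0 x);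
  functor_comp : forall g f h h', F1 (comp C g f h) = comp C' (F1 g) (F1 f) h'
}.

Record category := Category {
  Ob : Type;
  Mor : Type;
  category_on :> cat_on Ob Mor
}.

Record functor (C D : category) := Functor {
  fob : Ob C -> Ob D;
  fmor : Mor C -> Mor D;
  functorP : is_functor C D fob fmor
}.

Program Definition discrete_cat (X : Type) : cat_on X X :=
  @CatOn X X id id id (fun g _ _ => g) _ _ _ _ _ _ _.

Program Definition prod_cat (I : Type) (O M : I -> Type)
    (C : forall i, cat_on (O i) (M i)) :
    cat_on (forall i, O i) (forall i, M i) :=
  @CatOn _ _ (fun f i => src (C i) (f i)) (fun f i => tgt (C i) (f i))
    (fun x i => idm (C i) (x i))
    (fun g f h i => comp (C i) (g i) (f i) (congr1 (@^~ i) h)) _ _ _ _ _ _ _.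
Next Obligation. by move=> *; apply: funext_dep => i; exact: src_idm. Qed.
Next Obligation. by move=> *; apply: funext_dep => i; exact: tgt_idm. Qed.
Next Obligation. by move=> *; apply: funext_dep => i; exact: src_comp. Qed.
Next Obligation. by move=> *; apply: funext_dep => i; exact: tgt_comp. Qed.
Next Obligation. by move=> *; apply: funext_dep => i; exact: comp_idl. Qed.
Next Obligation. by move=> *; apply: funext_dep => i; exact: comp_idr. Qed.
Next Obligation. by move=> *; apply: funext_dep => i; exact: comp_assoc. Qed.

(** * n-fold categories *)

(* Shapes [e : 'I_n -> bool] stand for elements of {0,1}^n; [edge i e e'] says that
   [e] and [e'] agree except that e_i = 0 and e'_i = 1. *)
Definition edge n (i : 'I_n) (e e' : 'I_n -> bool) : bool :=
  [&& ~~ e i, e' i & [forall j, (j != i) ==> (e j == e' j)]].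

Lemma edge_out n (i : 'I_n) e e' j : edge i e e' -> j != i -> e j = e' j.
Proof. by case/and3P=> _ _ /forallP /(_ j) /implyP H /H /eqP. Qed.

Lemma edge_le n (i : 'I_n) e e' : edge i e e' -> forall j, e j ==> e' j.
Proof.
move=> h j; case: (eqVneq j i) => [->|ji].
  by case/and3P: h => /negbTE->.
by rewrite (edge_out h ji) implybb.
Qed.

Record nfoldcat (n : nat) := NFoldCat {
  cube : ('I_n -> bool) -> Type;
  dir : forall i e e', edge i e e' -> cat_on (cube e) (cube e');
  (* In the axioms below, [h0], [h1] are the edges in direction [i] and [v0],
     [v1] those in direction [j] of a square
         e00 -h0-> e10
          |v0       |v1
         e01 -h1-> e11                                                    *)
  dir_src : forall (i j : 'I_n) e00 e10 e01 e11 (h0 : edge i e00 e10)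
    (h1 : edge i e01 e11) (v0 : edge j e00 e01) (v1 : edge j e10 e11), i != j ->
    is_functor (dir h1) (dir h0) (src (dir v0)) (src (dir v1));
  dir_tgt : forall (i j : 'I_n) e00 e10 e01 e11 (h0 : edge i e00 e10)
    (h1 : edge i e01 e11) (v0 : edge j e00 e01) (v1 : edge j e10 e11), i != j ->
    is_functor (dir h1) (dir h0) (tgt (dir v0)) (tgt (dir v1));
  dir_idm : forall (i j : 'I_n) e00 e10 e01 e11 (h0 : edge i e00 e10)
    (h1 : edge i e01 e11) (v0 : edge j e00 e01) (v1 : edge j e10 e11), i != j ->
    is_functor (dir h0) (dir h1) (idm (dir v0)) (idm (dir v1));
  interchange : forall (i j : 'I_n) e00 e10 e01 e11 (h0 : edge i e00 e10)
    (h1 : edge i e01 e11) (v0 : edge j e00 e01) (v1 : edge j e10 e11), i != j ->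
    forall a b c d hab hcd hac hbd p q,
    comp (dir v1) (comp (dir h1) a b hab) (comp (dir h1) c d hcd) p =
    comp (dir h1) (comp (dir v1) a c hac) (comp (dir v1) b d hbd) q
}.

Record nfunctor n (C D : nfoldcat n) := NFunctor {
  ncube :> forall e, cube C e -> cube D e;
  nfunctorP : forall i e e' (h : edge i e e'),
    is_functor (dir C h) (dir D h) (@ncube e) (@ncube e')
}.

Lemma nfunctor_ext n (C D : nfoldcat n) (F G : nfunctor C D) :
  (forall e x, F e x = G e x) -> F = G.
Proof.
case: F G => [F HF] [G HG] /= H.
have E : F = G by apply: funext_dep => e; apply: funext_dep => x.
by subst G; rewrite (Prop_irrelevance HF HG).
Qed.

Lemma nfunctor_compP n (C D E : nfoldcat n) (G : nfunctor D E)
    (F : nfunctor C D) i e e' (h : edge i e e') :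
  is_functor (dir C h) (dir E h) (fun x => G e (F e x)) (fun x => G e' (F e' x)).
Proof.
have HF := nfunctorP F h; have HG := nfunctorP G h.
split=> [f|f|x|g f h0 h1].
- by rewrite (functor_src HG) (functor_src HF).
- by rewrite (functor_tgt HG) (functor_tgt HF).
- by rewrite (functor_idm HF) (functor_idm HG).
- have h2 : src (dir D h) (F e' g) = tgt (dir D h) (F e' f).
    by rewrite (functor_src HF) (functor_tgt HF) h0.
  by rewrite (functor_comp HF h0 h2) (functor_comp HG h2 h1).
Qed.

Definition nfunctor_comp n (C D E : nfoldcat n)
    (G : nfunctor D E) (F : nfunctor C D) : nfunctor C E :=
  NFunctor (nfunctor_compP G F).

(** * The box product *)

Definition cell (C : category) (b : bool) : Type := if b then Mor C else Ob C.

(* In direction [i] the box product has the structure of [C_i] in the [i]-th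
   coordinate and no structure (a discrete category) in the others. *)
Definition cell_cat (C : category) (b b' : bool) :
    b ==> b' -> cat_on (cell C b) (cell C b') :=
  match b, b' return b ==> b' -> cat_on (cell C b) (cell C b') with
  | false, true => fun=> C
  | false, false => fun=> discrete_cat (Ob C)
  | true, true => fun=> discrete_cat (Mor C)
  | true, false => fun h => False_rect _ (notF h)
  end.

Lemma prod_functor (I : Type) (O M O' M' : I -> Type)
    (C : forall i, cat_on (O i) (M i)) (C' : forall i, cat_on (O' i) (M' i))
    (F0 : forall i, O i -> O' i) (F1 : forall i, M i -> M' i) :
  (forall i, is_functor (C i) (C' i) (@F0 i) (@F1 i)) ->
  is_functor (prod_cat C) (prod_cat C')
    (fun x i => F0 i (x i)) (fun x i => F1 i (x i)).
Proof.
move=> H; split=> [f|f|x|g f h h']; apply: funext_dep => i /=.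
- exact: functor_src (H i) _.
- exact: functor_tgt (H i) _.
- exact: functor_idm (H i) _.
- exact: functor_comp (H i) _ _ _ _.
Qed.

Lemma cell_src_functor (C : category) (a b c d : bool) (h0 : a ==> b)
    (h1 : c ==> d) (v0 : a ==> c) (v1 : b ==> d) :
  (a = b /\ c = d) \/ (a = c /\ b = d) ->
  is_functor (cell_cat C h1) (cell_cat C h0)
    (src (cell_cat C v0)) (src (cell_cat C v1)).
Proof.
move: a b c d h0 h1 v0 v1 => [] [] [] [] h0 h1 v0 v1 //.
all: try by case=> [[]|[]].
all: by move=> _; split=> //= g f h h'; rewrite (Prop_irrelevance h h').
Qed.

Lemma cell_tgt_functor (C : category) (a b c d : bool) (h0 : a ==> b)
    (h1 : c ==> d) (v0 : a ==> c) (v1 : b ==> d) :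
  (a = b /\ c = d) \/ (a = c /\ b = d) ->
  is_functor (cell_cat C h1) (cell_cat C h0)
    (tgt (cell_cat C v0)) (tgt (cell_cat C v1)).
Proof.
move: a b c d h0 h1 v0 v1 => [] [] [] [] h0 h1 v0 v1 //.
all: try by case=> [[]|[]].
all: by move=> _; split=> //= g f h h'; rewrite (Prop_irrelevance h h').
Qed.

Lemma cell_idm_functor (C : category) (a b c d : bool) (h0 : a ==> b)
    (h1 : c ==> d) (v0 : a ==> c) (v1 : b ==> d) :
  (a = b /\ c = d) \/ (a = c /\ b = d) ->
  is_functor (cell_cat C h0) (cell_cat C h1)
    (idm (cell_cat C v0)) (idm (cell_cat C v1)).
Proof.
move: a b c d h0 h1 v0 v1 => [] [] [] [] h0 h1 v0 v1 //.
all: try by case=> [[]|[]].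
all: by move=> _; split=> //= g f h h'; rewrite (Prop_irrelevance h h').
Qed.

Lemma cell_interchange (C : category) (a b c d : bool) (h0 : a ==> b)
    (h1 : c ==> d) (v0 : a ==> c) (v1 : b ==> d) :
  (a = b /\ c = d) \/ (a = c /\ b = d) ->
  forall x y z t hxy hzt hxz hyt p q,
  comp (cell_cat C v1) (comp (cell_cat C h1) x y hxy)
    (comp (cell_cat C h1) z t hzt) p =
  comp (cell_cat C h1) (comp (cell_cat C v1) x z hxz)
    (comp (cell_cat C v1) y t hyt) q.
Proof.
move: a b c d h0 h1 v0 v1 => [] [] [] [] h0 h1 v0 v1 //.
all: try by case=> [[]|[]].
all: move=> _ /= x y z t hxy hzt hxz hyt p q //.
all: congr comp; exact: Prop_irrelevance.
Qed.

Lemma square_cell n (i j : 'I_n) e00 e10 e01 e11 (h0 : edge i e00 e10)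
    (h1 : edge i e01 e11) (v0 : edge j e00 e01) (v1 : edge j e10 e11) k :
  i != j ->
  (e00 k = e10 k /\ e01 k = e11 k) \/ (e00 k = e01 k /\ e10 k = e11 k).
Proof.
move=> ij; case: (eqVneq k i) => [->|ki].
  by right; rewrite (edge_out v0) ?(edge_out v1).
by left; rewrite (edge_out h0) ?(edge_out h1).
Qed.

Definition box_dir n (C : 'I_n -> category) (i : 'I_n) e e' (h : edge i e e') :
    cat_on (forall j, cell (C j) (e j)) (forall j, cell (C j) (e' j)) :=
  prod_cat (fun j => cell_cat (C j) (edge_le h j)).

Lemma box_src n (C : 'I_n -> category) (i j : 'I_n) e00 e10 e01 e11
    (h0 : edge i e00 e10) (h1 : edge i e01 e11) (v0 : edge j e00 e01)
    (v1 : edge j e10 e11) (ij : i != j) :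
  is_functor (box_dir C h1) (box_dir C h0)
    (src (box_dir C v0)) (src (box_dir C v1)).
Proof.
exact: (prod_functor (fun k =>
  @cell_src_functor (C k) _ _ _ _ (edge_le h0 k) (edge_le h1 k) (edge_le v0 k)
    (edge_le v1 k) (square_cell h0 h1 v0 v1 k ij))).
Qed.

Lemma box_tgt n (C : 'I_n -> category) (i j : 'I_n) e00 e10 e01 e11
    (h0 : edge i e00 e10) (h1 : edge i e01 e11) (v0 : edge j e00 e01)
    (v1 : edge j e10 e11) (ij : i != j) :
  is_functor (box_dir C h1) (box_dir C h0)
    (tgt (box_dir C v0)) (tgt (box_dir C v1)).
Proof.
exact: (prod_functor (fun k =>
  @cell_tgt_functor (C k) _ _ _ _ (edge_le h0 k) (edge_le h1 k) (edge_le v0 k)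
    (edge_le v1 k) (square_cell h0 h1 v0 v1 k ij))).
Qed.

Lemma box_idm n (C : 'I_n -> category) (i j : 'I_n) e00 e10 e01 e11
    (h0 : edge i e00 e10) (h1 : edge i e01 e11) (v0 : edge j e00 e01)
    (v1 : edge j e10 e11) (ij : i != j) :
  is_functor (box_dir C h0) (box_dir C h1)
    (idm (box_dir C v0)) (idm (box_dir C v1)).
Proof.
exact: (prod_functor (fun k =>
  @cell_idm_functor (C k) _ _ _ _ (edge_le h0 k) (edge_le h1 k) (edge_le v0 k)
    (edge_le v1 k) (square_cell h0 h1 v0 v1 k ij))).
Qed.

Lemma box_interchange n (C : 'I_n -> category) (i j : 'I_n) e00 e10 e01 e11
    (h0 : edge i e00 e10) (h1 : edge i e01 e11) (v0 : edge j e00 e01)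
    (v1 : edge j e10 e11) (ij : i != j)
    x y z t hxy hzt hxz hyt p q :
  comp (box_dir C v1) (comp (box_dir C h1) x y hxy)
    (comp (box_dir C h1) z t hzt) p =
  comp (box_dir C h1) (comp (box_dir C v1) x z hxz)
    (comp (box_dir C v1) y t hyt) q.
Proof.
apply: funext_dep => k.
exact: (@cell_interchange (C k) _ _ _ _ (edge_le h0 k) (edge_le h1 k)
  (edge_le v0 k) (edge_le v1 k) (square_cell h0 h1 v0 v1 k ij)).
Qed.

Definition box n (C : 'I_n -> category) : nfoldcat n :=
  NFoldCat (@box_src n C) (@box_tgt n C) (@box_idm n C) (@box_interchange n C).

Definition cell_functor (C D : category) (F : functor C D) (b : bool) :
    cell C b -> cell D b :=
  match b return cell C b -> cell D b with true => fmor F | false => fob F end.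

Lemma cell_functorP (C D : category) (F : functor C D) b b' (h : b ==> b') :
  is_functor (cell_cat C h) (cell_cat D h)
    (@cell_functor C D F b) (@cell_functor C D F b').
Proof.
by move: b b' h => [] [] //= h; exact: functorP.
Qed.

Lemma box_functorP n (C D : 'I_n -> category) (F : forall j, functor (C j) (D j))
    i e e' (h : edge i e e') :
  is_functor (dir (box C) h) (dir (box D) h)
    (fun x j => cell_functor (F j) (x j)) (fun x j => cell_functor (F j) (x j)).
Proof.
exact: (prod_functor (fun j => cell_functorP (F j) (edge_le h j))).
Qed.

Definition box_functor n (C D : 'I_n -> category)
    (F : forall j, functor (C j) (D j)) : nfunctor (box C) (box D) :=
  NFunctor (box_functorP F).

(** * The simplex category, simplicial and multisimplicial sets *)

Record hom (k l : nat) := Hom {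
  hfun :> 'I_k.+1 -> 'I_l.+1;
  hom_mono : {homo hfun : x y / x <= y}
}.

Lemma hom_ext k l (f g : hom k l) : (forall x, f x = g x :> nat) -> f = g.
Proof.
case: f g => [f Hf] [g Hg] /= H.
have E : f = g by apply: funext_dep => x; apply/val_inj/H.
by subst g; rewrite (Prop_irrelevance Hf Hg).
Qed.

Definition hid k : hom k k := @Hom k k id (fun _ _ h => h).

Definition hcomp k l m (g : hom l m) (f : hom k l) : hom k m :=
  @Hom k m (fun x => g (f x)) (fun _ _ h => hom_mono g (hom_mono f h)).

Definition hcast k l (e : k = l) : hom k l :=
  @Hom k l (cast_ord (congr1 succn e)) (fun _ _ h => h).

Record sset := SSet {
  simplex :> nat -> Type;
  sact : forall k l, hom k l -> simplex l -> simplex k;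
  sact_id : forall k y, sact (hid k) y = y;
  sact_comp : forall k l m (g : hom l m) (f : hom k l) y,
    sact (hcomp g f) y = sact f (sact g y)
}.

Arguments sact {_ k l} f y.

Record smap (X Y : sset) := SMap {
  sfun :> forall k, X k -> Y k;
  sfun_nat : forall k l (f : hom k l) x, sfun (sact f x) = sact f (sfun x)
}.

Record mset (n : nat) := MSet {
  msimplex :> ('I_n -> nat) -> Type;
  mact : forall k l, (forall j, hom (k j) (l j)) -> msimplex l -> msimplex k;
  mact_id : forall k y, mact (fun j => hid (k j)) y = y;
  mact_comp : forall k l m (g : forall j, hom (l j) (m j))
    (f : forall j, hom (k j) (l j)) y,
    mact (fun j => hcomp (g j) (f j)) y = mact f (mact g y)
}.

Arguments mact {n _ k l} f y.

Record mmap n (X Y : mset n) := MMap {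
  mfun :> forall k, X k -> Y k;
  mfun_nat : forall k l (f : forall j, hom (k j) (l j)) (x : X l),
    mfun (mact f x) = mact f (mfun x)
}.

Definition diag n (Y : mset n) : sset :=
  @SSet (fun p => Y (fun=> p)) (fun k l f => mact (fun=> f))
    (fun k => @mact_id n Y (fun=> k))
    (fun k l m g f => @mact_comp n Y _ _ _ (fun=> g) (fun=> f)).

Definition diag_map n (X Y : mset n) (f : mmap X Y) : smap (diag X) (diag Y) :=
  @SMap (diag X) (diag Y) (fun p => f (fun=> p))
    (fun k l a => mfun_nat f (fun=> a)).

(** * Weak equivalences *)

Definition scomp (X Y Z : sset) (g : smap Y Z) (f : smap X Y) : smap X Z.
Proof.
exists (fun k x => g k (f k x)) => k l a x.
by rewrite !sfun_nat.
Defined.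

Definition sprod (X Y : sset) : sset.
Proof.
exists (fun k => (X k * Y k)%type)
  (fun k l f xy => (sact f xy.1, sact f xy.2)).
- by move=> k [x y]; rewrite !sact_id.
- by move=> k l m g f [x y]; rewrite !sact_comp.
Defined.

Definition std_simplex (m : nat) : sset.
Proof.
exists (fun k => hom k m) (fun k l f a => hcomp a f).
- by move=> k a; apply: hom_ext.
- by move=> k l p g f a; apply: hom_ext.
Defined.

(* [a] misses some vertex other than [i] *)
Definition in_horn m (i : 'I_m.+1) k (a : hom k m) : Prop :=
  exists j : 'I_m.+1, j <> i /\ forall x, a x <> j.

Definition horn m (i : 'I_m.+1) : sset.
Proof.
exists (fun k => {a : hom k m | in_horn i a})
  (fun k l f a => exist _ (hcomp (proj1_sig a) f)
    (let: ex_intro j (conj ji aj) := proj2_sig a in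
     ex_intro _ j (conj ji (fun x => aj (f x))))).
- by move=> k [a ha]; apply: eq_exist; exact: hom_ext.
- by move=> k l p g f [a ha]; apply: eq_exist; exact: hom_ext.
Defined.

Definition is_kan (K : sset) : Prop :=
  forall m (i : 'I_m.+2) (u : smap (horn i) K),
  exists v : smap (std_simplex m.+1) K,
  forall k (a : horn i k), v k (proj1_sig a) = u k a.

Definition hconst k m (x : 'I_m.+1) : hom k m :=
  @Hom k m (fun=> x) (fun _ _ _ => leqnn x).

Definition elem_homotopy (X K : sset) (f g : smap X K) : Prop :=
  exists H : smap (sprod X (std_simplex 1)) K,
    (forall k x, H k (x, hconst k ord0) = f k x) /\
    (forall k x, H k (x, hconst k ord_max) = g k x).

(* Two maps are homotopic when they lie in the same connected component of the
   simplicial mapping space. *)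
Definition homotopic (X K : sset) : smap X K -> smap X K -> Prop :=
  clos_refl_sym_trans _ (@elem_homotopy X K).

(* A map X -> Y is a weak (homotopy) equivalence when, for every Kan complex K,
   precomposition is a bijection from homotopy classes of maps Y -> K to
   homotopy classes of maps X -> K; equivalently, when its geometric realization
   is a (weak) homotopy equivalence of spaces. *)
Definition weak_equiv (X Y : sset) (f : smap X Y) : Prop :=
  forall K : sset, is_kan K ->
    (forall u v : smap Y K,
       homotopic (scomp u f) (scomp v f) -> homotopic u v) /\
    (forall w : smap X K, exists u : smap Y K, homotopic (scomp u f) w).

Definition mset_weak_equiv n (X Y : mset n) (f : mmap X Y) : Prop :=
  weak_equiv (diag_map f).

(** * The n-fold nerve *)

Record ordmor (p : nat) := OrdMor {
  osrc : 'I_p.+1;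
  otgt : 'I_p.+1;
  ordmor_le : osrc <= otgt
}.

Lemma ordmor_ext p (f g : ordmor p) :
  osrc f = osrc g -> otgt f = otgt g -> f = g.
Proof.
case: f g => [a b ab] [c d cd] /= ac bd; subst c d.
by rewrite (Prop_irrelevance ab cd).
Qed.

Lemma ord_comp_le p (g f : ordmor p) : osrc g = otgt f -> osrc f <= otgt g.
Proof.
move=> h; apply: leq_trans (ordmor_le f) _.
by rewrite -h; exact: ordmor_le.
Qed.

Definition ord_cat_on (p : nat) : cat_on 'I_p.+1 (ordmor p).
Proof.
apply: (@CatOn _ _ (@osrc p) (@otgt p) (fun x => OrdMor (leqnn x))
  (fun g f h => OrdMor (ord_comp_le h))) => //=.
- by move=> f h; apply: ordmor_ext.
- by move=> f h; apply: ordmor_ext.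
- by move=> a b c hab hbc h h'; apply: ordmor_ext.
Defined.

Definition ord_cat (p : nat) : category := Category (ord_cat_on p).

Definition ord_functor_mor p q (a : hom p q) (f : ordmor p) : ordmor q :=
  OrdMor (hom_mono a (ordmor_le f)).

Lemma ord_functorP p q (a : hom p q) :
  is_functor (ord_cat p) (ord_cat q) a (ord_functor_mor a).
Proof. by split=> // *; apply: ordmor_ext. Qed.

Definition ord_functor p q (a : hom p q) : functor (ord_cat p) (ord_cat q) :=
  Functor (ord_functorP a).

Definition ord_box n (p : 'I_n -> nat) : nfoldcat n :=
  box (fun j => ord_cat (p j)).

Definition ord_box_functor n (p q : 'I_n -> nat) (a : forall j, hom (p j) (q j)) :
    nfunctor (ord_box p) (ord_box q) :=
  box_functor (fun j => ord_functor (a j)).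

Lemma cell_functor_id p b (x : cell (ord_cat p) b) :
  cell_functor (ord_functor (hid p)) x = x.
Proof. by case: b x => //= x; apply: ordmor_ext. Qed.

Lemma cell_functor_comp p q r (g : hom q r) (f : hom p q) b
    (x : cell (ord_cat p) b) :
  cell_functor (ord_functor (hcomp g f)) x =
  cell_functor (ord_functor g) (cell_functor (ord_functor f) x).
Proof. by case: b x => //= x; apply: ordmor_ext. Qed.

Definition nerve n (D : nfoldcat n) : mset n.
Proof.
apply: (@MSet n (fun p => nfunctor (ord_box p) D)
  (fun p q a F => nfunctor_comp F (ord_box_functor a))).
- move=> p F; apply: nfunctor_ext => e x /=; congr (F e _).
  by apply: funext_dep => j; exact: cell_functor_id.
- move=> p q r g f F; apply: nfunctor_ext => e x /=; congr (F e _).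
  by apply: funext_dep => j; exact: cell_functor_comp.
Defined.

(** * The n-fold Grothendieck construction *)

Record arrow := Arrow { adom : nat; acod : nat; amap : hom adom acod }.

Lemma arrow_ext (f g : arrow) :
  adom f = adom g -> acod f = acod g ->
  (forall (x : 'I_(adom f).+1) (y : 'I_(adom g).+1),
    x = y :> nat -> amap f x = amap g y :> nat) -> f = g.
Proof.
case: f g => [a b f] [c d g] /= ac bd; subst c d => H; congr Arrow.
by apply: hom_ext => x; exact: H.
Qed.

Definition delta_comp (g f : arrow) (h : adom g = acod f) : arrow :=
  Arrow (hcomp (amap g) (hcomp (hcast (esym h)) (amap f))).

Lemma amap_ext (f : arrow) (x y : 'I_(adom f).+1) : 
  x = y :> nat -> amap f x = amap f y :> nat.
Proof. by move=> /val_inj ->. Qed.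

Definition delta_cat_on : cat_on nat arrow.
Proof.
apply: (@CatOn nat arrow adom acod (fun k => Arrow (hid k)) delta_comp) => //=.
- by move=> f h; apply: arrow_ext => //= x y /(@amap_ext f).
- by move=> f h; apply: arrow_ext => //= x y xy; apply: amap_ext.
- move=> a b c hab hbc h h'; apply: arrow_ext => //= x y xy.
  by do 2!apply: amap_ext => /=; apply: amap_ext.
Defined.

Definition delta : category := Category delta_cat_on.

(* A cell of [delta] as a morphism of the simplex category, the identity in the
   case of an object. *)
Definition cell_dom (b : bool) : cell delta b -> nat :=
  match b return cell delta b -> nat with true => adom | false => id end.

Definition cell_cod (b : bool) : cell delta b -> nat :=
  match b return cell delta b -> nat with true => acod | false => id end.

Definition cell_map (b : bool) :
    forall x : cell delta b, hom (cell_dom x) (cell_cod x) :=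
  match b with true => amap | false => hid end.

(* The direction-[j] component of the map of Delta^n along which an element is
   restricted to obtain the source: [x] itself in the direction in which the
   source is taken, an identity in the other ones. *)
Definition src_map (b b' : bool) :
    forall (h : b ==> b') (x : cell delta b'),
    hom (cell_cod (src (cell_cat delta h) x)) (cell_cod x) :=
  match b, b' return forall (h : b ==> b') (x : cell delta b'),
      hom (cell_cod (src (cell_cat delta h) x)) (cell_cod x) with
  | false, true => fun _ x => amap x
  | false, false => fun _ x => hid x
  | true, true => fun _ x => hid (acod x)
  | true, false => fun h => False_rect _ (notF h)
  end.

Lemma cell_cod_tgt b b' (h : b ==> b') (x : cell delta b') :
  cell_cod (tgt (cell_cat delta h) x) = cell_cod x.
Proof. by move: b b' h x => [] []. Qed.

Lemma cell_cod_idm b b' (h : b ==> b') (x : cell delta b) :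
  cell_cod (idm (cell_cat delta h) x) = cell_cod x.
Proof. by move: b b' h x => [] []. Qed.

Lemma cell_cod_comp b b' (h : b ==> b') (g f : cell delta b') p :
  cell_cod (comp (cell_cat delta h) g f p) = cell_cod g.
Proof. by move: b b' h g f p => [] []. Qed.

Definition delta_box n : nfoldcat n := box (fun=> delta).

Definition box_cod n (e : 'I_n -> bool) (x : cube (delta_box n) e) : 'I_n -> nat :=
  fun j => cell_cod (x j).

(* Restriction along identities, used to move between provably equal degrees. *)
Definition mcast n (Y : mset n) (k l : 'I_n -> nat) (h : forall j, k j = l j) :
    Y l -> Y k :=
  mact (fun j => hcast (h j)).

(* A cube consists of maps f_j in the directions of its shape, of objects in the
   other directions (standing for identities f_j), and of the multisimplex [z] at
   its last vertex; its other vertices are restrictions of [z] along some f_j. *)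
Definition gcube n (Y : mset n) (e : 'I_n -> bool) : Type :=
  {x : cube (delta_box n) e & Y (box_cod x)}.

Definition gsrc n (Y : mset n) i e e' (h : @edge n i e e') (c : gcube Y e') :
    gcube Y e :=
  existT _ (src (dir (delta_box n) h) (projT1 c))
    (mact (fun j => src_map (edge_le h j) (projT1 c j)) (projT2 c)).

Definition gtgt n (Y : mset n) i e e' (h : @edge n i e e') (c : gcube Y e') :
    gcube Y e :=
  existT _ (tgt (dir (delta_box n) h) (projT1 c))
    (mcast (fun j => cell_cod_tgt (edge_le h j) (projT1 c j)) (projT2 c)).

Definition gidm n (Y : mset n) i e e' (h : @edge n i e e') (c : gcube Y e) :
    gcube Y e' :=
  existT _ (idm (dir (delta_box n) h) (projT1 c))
    (mcast (fun j => cell_cod_idm (edge_le h j) (projT1 c j)) (projT2 c)).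

Definition gcomp n (Y : mset n) i e e' (h : @edge n i e e') (g f : gcube Y e')
    (p : gsrc h g = gtgt h f) : gcube Y e' :=
  existT _ (comp (dir (delta_box n) h) (projT1 g) (projT1 f) (projT1_eq p))
    (mcast (fun j => cell_cod_comp (congr1 (@^~ j) (projT1_eq p)))
       (projT2 g)).

Definition tot n (Y : mset n) k (y : Y k) : {k & Y k} := existT _ k y.

Lemma gcube_ext n (Y : mset n) e (c d : gcube Y e) :
  projT1 c = projT1 d -> tot (projT2 c) = tot (projT2 d) -> c = d.
Proof.
case: c d => [x y] [x' y'] /= xx; subst x' => yy.
by rewrite (existT_inj yy).
Qed.

Lemma gcube_tot n (Y : mset n) e (c d : gcube Y e) :
  c = d -> tot (projT2 c) = tot (projT2 d).
Proof. by move=> ->. Qed.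

Lemma mact_tot n (Y : mset n) k k' l l' (f : forall j, hom (k j) (l j))
    (f' : forall j, hom (k' j) (l' j)) (z : Y l) (z' : Y l') :
  (forall j, k j = k' j) ->
  (forall j (x : 'I_(k j).+1) (x' : 'I_(k' j).+1), x = x' :> nat ->
     f j x = f' j x' :> nat) ->
  tot z = tot z' -> tot (mact f z) = tot (mact f' z').
Proof.
move=> kk ff zz; have kE : k = k' by apply: funext_dep.
have lE : l = l' := projT1_eq zz.
subst k' l'; rewrite (existT_inj zz).
congr (tot (mact _ _)); apply: funext_dep => j; apply: hom_ext => x; exact: ff.
Qed.

Lemma tot_mcast n (Y : mset n) k l (h : forall j, k j = l j) (z : Y l) :
  tot (mcast h z) = tot z.
Proof.
by rewrite -[in RHS](mact_id z); apply: mact_tot.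
Qed.

Lemma tot_isid n (Y : mset n) k l (f : forall j, hom (k j) (l j)) (z : Y l) :
  (forall j, k j = l j) ->
  (forall j (x : 'I_(k j).+1), f j x = x :> nat) -> tot (mact f z) = tot z.
Proof.
move=> kl Hf; rewrite -[in RHS](mact_id z); apply: mact_tot => // j x x' xx.
by rewrite Hf.
Qed.

Lemma src_map_idm b b' (h : b ==> b') (x : cell delta b) (y : ordinal _) :
  src_map h (idm (cell_cat delta h) x) y = y :> nat.
Proof. by move: b b' h x y => [] []. Qed.

Lemma src_map_comp b b' (h : b ==> b') (g f : cell delta b') p
    (e' : cell_cod f = cell_cod (src (cell_cat delta h) g)) (y : ordinal _) (y' : ordinal _) :
  y = y' :> nat ->
  src_map h (comp (cell_cat delta h) g f p) y =
  src_map h g (hcast e' (src_map h f y')) :> nat.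
Proof.
move: b b' h g f p e' y y' => [] [] //= h g f p e' y y' yy.
by apply: amap_ext => /=; apply: amap_ext.
Qed.

Lemma src_map_src (a b c d : bool) (h0 : a ==> b) (h1 : c ==> d) (v0 : a ==> c)
    (v1 : b ==> d) (x : cell delta d) (y : ordinal _) (y' : ordinal _) :
  (a = b /\ c = d) \/ (a = c /\ b = d) ->
  y = y' :> nat ->
  src_map v1 x (src_map h0 (src (cell_cat delta v1) x) y) =
  src_map h1 x (src_map v0 (src (cell_cat delta h1) x) y') :> nat.
Proof.
move: a b c d h0 h1 v0 v1 x y y' => [] [] [] [] //= h0 h1 v0 v1 x y y'.
all: try by case=> [[]|[]].
all: by move=> _ yy; apply: amap_ext.
Qed.

Lemma src_map_tgt (a b c d : bool) (h0 : a ==> b) (h1 : c ==> d) (v0 : a ==> c)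
    (v1 : b ==> d) (x : cell delta d) (y : ordinal _) (y' : ordinal _) :
  (a = b /\ c = d) \/ (a = c /\ b = d) ->
  y = y' :> nat ->
  src_map v1 x y = src_map v0 (tgt (cell_cat delta h1) x) y' :> nat.
Proof.
move: a b c d h0 h1 v0 v1 x y y' => [] [] [] [] //= h0 h1 v0 v1 x y y'.
all: try by case=> [[]|[]].
all: by move=> _ yy; apply: amap_ext.
Qed.

Lemma src_map_idm2 (a b c d : bool) (h0 : a ==> b) (h1 : c ==> d) (v0 : a ==> c)
    (v1 : b ==> d) (x : cell delta c) (y : ordinal _) (y' : ordinal _) :
  (a = b /\ c = d) \/ (a = c /\ b = d) ->
  y = y' :> nat ->
  src_map v1 (idm (cell_cat delta h1) x) y = src_map v0 x y' :> nat.
Proof.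
move: a b c d h0 h1 v0 v1 x y y' => [] [] [] [] //= h0 h1 v0 v1 x y y'.
all: try by case=> [[]|[]].
all: by move=> _ yy; apply: amap_ext.
Qed.

Lemma src_map_comp2 (a b c d : bool) (h0 : a ==> b) (h1 : c ==> d) (v0 : a ==> c)
    (v1 : b ==> d) (g f : cell delta d) p (y : ordinal _) (y' : ordinal _) :
  (a = b /\ c = d) \/ (a = c /\ b = d) ->
  y = y' :> nat ->
  src_map v1 (comp (cell_cat delta h1) g f p) y = src_map v1 g y' :> nat.
Proof.
move: a b c d h0 h1 v0 v1 g f p y y' => [] [] [] [] //= h0 h1 v0 v1 g f p y y'.
all: try by case=> [[]|[]].
all: by move=> _ yy; apply: amap_ext.
Qed.

Lemma gsrc_comp n (Y : mset n) i e e' (h : @edge n i e e')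
    (g f : gcube Y e')
    (p : gsrc h g = gtgt h f) : gsrc h (gcomp p) = gsrc h f.
Proof.
apply: gcube_ext; first exact: (@src_comp _ _ (dir (delta_box n) h) _ _ (projT1_eq p)).
have pj j := congr1 (@^~ j) (projT1_eq p).
have E j : cell_cod (projT1 f j) =
    cell_cod (src (cell_cat delta (edge_le h j)) (projT1 g j)).
  exact: etrans (esym (cell_cod_tgt (edge_le h j) _))
    (congr1 (@cell_cod _) (esym (pj j))).
have T : tot (mact (fun j => src_map (edge_le h j) (projT1 f j)) (projT2 f)) =
    tot (mact (fun j => hcomp (hcast (E j))
      (src_map (edge_le h j) (projT1 f j))) (projT2 (gsrc h g))).
  apply: mact_tot => //.
    by move=> j x x' /val_inj ->.
  by rewrite (gcube_tot p) /= tot_mcast.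
rewrite T /= -mact_comp.
apply: mact_tot => [j|j x x' xx|].
- by rewrite /box_cod src_comp.
- exact: src_map_comp.
- exact: tot_mcast.
Qed.

Definition groth_dir n (Y : mset n) (i : 'I_n) e e' (h : edge i e e') :
  cat_on (gcube Y e) (gcube Y e').
Proof.
apply: (@CatOn _ _ (@gsrc n Y i e e' h) (@gtgt n Y i e e' h)
  (@gidm n Y i e e' h) (@gcomp n Y i e e' h)).
- move=> c; apply: gcube_ext;
    first exact: (src_idm (dir (delta_box n) h)).
  rewrite -[in RHS](tot_mcast
    (fun j => cell_cod_idm (edge_le h j) (projT1 c j)) (projT2 c)).
  apply: tot_isid => j; last by move=> x; exact: src_map_idm.
  by rewrite /box_cod /= src_idm cell_cod_idm.
- move=> c; apply: gcube_ext;
    first exact: (tgt_idm (dir (delta_box n) h)).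
  by rewrite /= !tot_mcast.
- exact: gsrc_comp.
- move=> g f p; apply: gcube_ext;
    first exact: (@tgt_comp _ _ (dir (delta_box n) h) _ _ (projT1_eq p)).
  by rewrite /= !tot_mcast.
- move=> f p; apply: gcube_ext;
    first exact: (@comp_idl _ _ (dir (delta_box n) h) _ (projT1_eq p)).
  by rewrite /= !tot_mcast.
- move=> f p; apply: gcube_ext;
    first exact: (@comp_idr _ _ (dir (delta_box n) h) _ (projT1_eq p)).
  by rewrite /= !tot_mcast.
- move=> a b c hab hbc h1 h2; apply: gcube_ext;
    first exact: (@comp_assoc _ _ (dir (delta_box n) h) _ _ _ (projT1_eq hab)
      (projT1_eq hbc) (projT1_eq h1) (projT1_eq h2)).
  by rewrite /= !tot_mcast.
Defined.

Lemma box_codE n (e : 'I_n -> bool) (x y : cube (delta_box n) e) :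
  x = y -> forall k, cell_cod (x k) = cell_cod (y k).
Proof. by move=> ->. Qed.

Lemma groth_src n (Y : mset n) (i j : 'I_n) e00 e10 e01 e11
    (h0 : edge i e00 e10) (h1 : edge i e01 e11) (v0 : edge j e00 e01)
    (v1 : edge j e10 e11) (ij : i != j) :
  is_functor (groth_dir Y h1) (groth_dir Y h0)
    (src (groth_dir Y v0)) (src (groth_dir Y v1)).
Proof.
have B := @box_src n (fun=> delta) i j e00 e10 e01 e11 h0 h1 v0 v1 ij.
have S := square_cell h0 h1 v0 v1 ^~ ij.
split=> [c|c|c|g f p q].
- have E := functor_src B (projT1 c).
  apply: gcube_ext; first exact: E.
  rewrite /= -!mact_comp; apply: mact_tot => // [k|k x x' xx].
    exact: box_codE E k.
  exact: src_map_src (S k) xx.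
- have E := functor_tgt B (projT1 c).
  apply: gcube_ext; first exact: E.
  rewrite /= tot_mcast; apply: mact_tot => [k|k x x' xx|].
  + rewrite -[LHS](cell_cod_tgt (edge_le h0 k)); exact: box_codE E k.
  + exact: (src_map_tgt (edge_le h0 k) (S k) xx).
  + by rewrite /= tot_mcast.
- have E := functor_idm B (projT1 c).
  apply: gcube_ext; first exact: E.
  rewrite /= tot_mcast; apply: mact_tot => [k|k x x' xx|].
  + rewrite -[RHS](cell_cod_idm (edge_le h0 k)); exact: box_codE E k.
  + exact: (src_map_idm2 (edge_le h0 k) (S k) xx).
  + by rewrite /= tot_mcast.
- have E := @functor_comp _ _ _ _ _ _ _ _ B _ _ (projT1_eq p) (projT1_eq q).
  apply: gcube_ext; first exact: E.
  rewrite /= tot_mcast; apply: mact_tot => [k|k x x' xx|].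
  + etransitivity.
      exact: box_codE E k.
    exact: cell_cod_comp.
  + exact: (src_map_comp2 (edge_le h0 k) (edge_le v0 k) (S k) xx).
  + by rewrite /= tot_mcast.
Qed.

Lemma groth_tgt n (Y : mset n) (i j : 'I_n) e00 e10 e01 e11
    (h0 : edge i e00 e10) (h1 : edge i e01 e11) (v0 : edge j e00 e01)
    (v1 : edge j e10 e11) (ij : i != j) :
  is_functor (groth_dir Y h1) (groth_dir Y h0)
    (tgt (groth_dir Y v0)) (tgt (groth_dir Y v1)).
Proof.
have B := @box_tgt n (fun=> delta) i j e00 e10 e01 e11 h0 h1 v0 v1 ij.
have S k : (e00 k = e01 k /\ e10 k = e11 k) \/ (e00 k = e10 k /\ e01 k = e11 k).
  by case: (square_cell h0 h1 v0 v1 k ij); [right|left].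
split=> [c|c|c|g f p q].
- have E := functor_src B (projT1 c).
  apply: gcube_ext; first exact: E.
  rewrite /= tot_mcast; apply: mact_tot => [k|k x x' xx|].
  + etransitivity.
      exact: box_codE E k.
    exact: cell_cod_tgt.
  + symmetry; exact: (src_map_tgt (edge_le v0 k) (S k) (esym xx)).
  + by rewrite /= tot_mcast.
- apply: gcube_ext; first exact: functor_tgt B (projT1 c).
  by rewrite /= !tot_mcast.
- apply: gcube_ext; first exact: functor_idm B (projT1 c).
  by rewrite /= !tot_mcast.
- apply: gcube_ext.
    exact: (@functor_comp _ _ _ _ _ _ _ _ B _ _ (projT1_eq p) (projT1_eq q)).
  by rewrite /= !tot_mcast.
Qed.

Lemma groth_idm n (Y : mset n) (i j : 'I_n) e00 e10 e01 e11
    (h0 : edge i e00 e10) (h1 : edge i e01 e11) (v0 : edge j e00 e01)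
    (v1 : edge j e10 e11) (ij : i != j) :
  is_functor (groth_dir Y h0) (groth_dir Y h1)
    (idm (groth_dir Y v0)) (idm (groth_dir Y v1)).
Proof.
have B := @box_idm n (fun=> delta) i j e00 e10 e01 e11 h0 h1 v0 v1 ij.
have S k : (e00 k = e01 k /\ e10 k = e11 k) \/ (e00 k = e10 k /\ e01 k = e11 k).
  by case: (square_cell h0 h1 v0 v1 k ij); [right|left].
split=> [c|c|c|g f p q].
- have E := functor_src B (projT1 c).
  apply: gcube_ext; first exact: E.
  rewrite /= tot_mcast; apply: mact_tot => [k|k x x' xx|].
  + etransitivity.
      exact: box_codE E k.
    exact: cell_cod_idm.
  + exact: (src_map_idm2 (edge_le v0 k) (S k) xx).
  + by rewrite /= tot_mcast.
- apply: gcube_ext; first exact: functor_tgt B (projT1 c).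
  by rewrite /= !tot_mcast.
- apply: gcube_ext; first exact: functor_idm B (projT1 c).
  by rewrite /= !tot_mcast.
- apply: gcube_ext.
    exact: (@functor_comp _ _ _ _ _ _ _ _ B _ _ (projT1_eq p) (projT1_eq q)).
  by rewrite /= !tot_mcast.
Qed.

Lemma groth_interchange n (Y : mset n) (i j : 'I_n) e00 e10 e01 e11
    (h0 : edge i e00 e10) (h1 : edge i e01 e11) (v0 : edge j e00 e01)
    (v1 : edge j e10 e11) (ij : i != j) x y z t hxy hzt hxz hyt p q :
  comp (groth_dir Y v1) (comp (groth_dir Y h1) x y hxy)
    (comp (groth_dir Y h1) z t hzt) p =
  comp (groth_dir Y h1) (comp (groth_dir Y v1) x z hxz)
    (comp (groth_dir Y v1) y t hyt) q.
Proof.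
apply: gcube_ext.
  exact: (@box_interchange n (fun=> delta) i j e00 e10 e01 e11 h0 h1 v0 v1 ij
    _ _ _ _ (projT1_eq hxy) (projT1_eq hzt) (projT1_eq hxz) (projT1_eq hyt)
    (projT1_eq p) (projT1_eq q)).
by rewrite /= !tot_mcast.
Qed.

Definition grothendieck n (Y : mset n) : nfoldcat n :=
  NFoldCat (@groth_src n Y) (@groth_tgt n Y) (@groth_idm n Y)
    (@groth_interchange n Y).

(** * The comparison map *)

(* The cube of shape [e] with last vertex [b] which is the morphism a_k -> b_k
   in each direction [k] belonging to [e]. *)
Definition segment n (p : 'I_n -> nat) (e : 'I_n -> bool)
    (a b : forall k, 'I_(p k).+1) (ab : forall k, a k <= b k) :
    cube (ord_box p) e :=
  fun k => match e k as s return cell (ord_cat (p k)) s with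
           | true => OrdMor (ab k)
           | false => b k
           end.

Definition last_vertex n (p : 'I_n -> nat) : cube (ord_box p) (fun=> false) :=
  fun k => ord_max.

(* The morphism (p_1, ..., i, ..., p_n) -> (p_1, ..., p_n) in direction [j]. *)
Definition to_last n (p : 'I_n -> nat) (j : 'I_n) (i : 'I_(p j).+1) :
    cube (ord_box p) (fun k => k == j) :=
  @segment n p (fun k => k == j) (dfwith (fun k => @ord_max (p k)) i)
    (fun k => ord_max) (fun k => leq_ord _).

Lemma edge1 n (j : 'I_n) : edge j (fun=> false) (fun k => k == j).
Proof.
by apply/and3P; split=> //; apply/forallP => k; apply/implyP => /negbTE ->.
Qed.

Lemma tgt_segment n (p : 'I_n -> nat) i e e' (h : @edge n i e e') a b ab :
  tgt (dir (ord_box p) h) (@segment n p e' a b ab) = @segment n p e a b ab.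
Proof.
apply: funext_dep => k; rewrite /= /segment; move: (edge_le h k).
by case: (e k) (e' k) => [] [].
Qed.

Lemma tgt_to_last n (p : 'I_n -> nat) j (i : 'I_(p j).+1) :
  tgt (dir (ord_box p) (edge1 j)) (to_last i) = @last_vertex n p.
Proof. exact: tgt_segment. Qed.

Lemma last_cod n (Y : mset n) p (F : nerve (grothendieck Y) p) j (i : 'I_(p j).+1) :
  cell_cod (projT1 (F _ (to_last i)) j) =
  cell_cod (projT1 (F _ (@last_vertex n p)) j).
Proof.
rewrite -(tgt_to_last i) -(functor_tgt (nfunctorP F (edge1 j))).
exact: esym (cell_cod_tgt _ _).
Qed.

(* [F (to_last i)] is a morphism in direction [j] whose underlying map of the
   simplex category, [cell_map _], is by functoriality of [F] the composite of the
   last p_j - i maps of the j-th path; g_j(i) is the image of the last element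
   under it. The cast identifies its codomain with that at the last vertex. *)
Definition rho_fun n (Y : mset n) p (F : nerve (grothendieck Y) p) (j : 'I_n)
    (i : 'I_(p j).+1) :
    'I_(cell_cod (projT1 (F _ (@last_vertex n p)) j)).+1 :=
  hcast (last_cod F i) (cell_map (projT1 (F _ (to_last i)) j) ord_max).

Definition cell_arrow b (x : cell delta b) : arrow := Arrow (cell_map x).

Definition acell n (Y : mset n) p (F : nerve (grothendieck Y) p) j e
    (c : cube (ord_box p) e) : arrow :=
  cell_arrow (projT1 (F e c) j).

Lemma rho_funE n (Y : mset n) p (F : nerve (grothendieck Y) p) (j : 'I_n)
    (i : 'I_(p j).+1) :
  rho_fun F i = amap (acell F j (to_last i)) ord_max :> nat.
Proof. by []. Qed.

Lemma cell_arrow_comp b b' (h : b ==> b') (g f : cell delta b') p :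
  ~~ b -> b' -> exists q,
  cell_arrow (comp (cell_cat delta h) g f p) =
    @delta_comp (cell_arrow g) (cell_arrow f) q.
Proof. by move: b b' h g f p => [] [] //= h g f p _ _; exists p. Qed.

Lemma acell_comp n (Y : mset n) p (F : nerve (grothendieck Y) p) j e e'
    (h : edge j e e') g f u : exists q,
  acell F j (comp (dir (ord_box p) h) g f u) =
    @delta_comp (acell F j g) (acell F j f) q.
Proof.
have H := nfunctorP F h.
have v : src (dir (grothendieck Y) h) (F e' g) =
    tgt (dir (grothendieck Y) h) (F e' f).
  by rewrite (functor_src H) (functor_tgt H) u.
rewrite /acell (functor_comp H u v).
by case/and3P: (h) => ? ? _; exact: cell_arrow_comp.
Qed.

Lemma dfwith_le n (p : 'I_n -> nat) j (x y : 'I_(p j).+1) k :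
  x <= y ->
  dfwith (fun k => @ord_max (p k)) x k <= dfwith (fun k => @ord_max (p k)) y k.
Proof.
move=> xy; case: (eqVneq j k) => [jk|jk]; last by rewrite !dfwith_out.
by subst k; rewrite !dfwith_in.
Qed.

Lemma amap_last (g f : arrow) q :
  amap (@delta_comp g f q) ord_max <= amap g ord_max.
Proof. by apply: (hom_mono (amap g)); rewrite leq_ord. Qed.

Lemma rho_mono n (Y : mset n) p (F : nerve (grothendieck Y) p) (j : 'I_n) :
  {homo @rho_fun n Y p F j : x y / x <= y}.
Proof.
move=> x y xy; rewrite !rho_funE.
pose s := @segment n p (fun k => k == j) _ _ (fun k => dfwith_le k xy).
have u : src (dir (ord_box p) (edge1 j)) (to_last y) =
    tgt (dir (ord_box p) (edge1 j)) s.
  apply: funext_dep => k; rewrite /= /s /to_last /segment.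
  move: (edge_le (edge1 j) k); case: eqVneq => //= jk _.
  by rewrite dfwith_out // eq_sym.
have E : to_last x = comp (dir (ord_box p) (edge1 j)) (to_last y) s u.
  apply: funext_dep => k /=; move: (congr1 _ u) => /=; rewrite /s /to_last /segment.
  move: (edge_le (edge1 j) k); case: (k == j) => //= *.
  exact: ordmor_ext.
have [q Eq] := acell_comp F u.
by rewrite E Eq; exact: amap_last.
Qed.

Definition rho_dir n (Y : mset n) p (F : nerve (grothendieck Y) p) (j : 'I_n) :
    hom (p j) (cell_cod (projT1 (F _ (@last_vertex n p)) j)) :=
  Hom (@rho_mono n Y p F j).

Definition rho_simplex n (Y : mset n) p (F : nerve (grothendieck Y) p) : Y p :=
  mact (rho_dir F) (projT2 (F _ (@last_vertex n p))).

Lemma shape_ind n (P : ('I_n -> bool) -> Prop) :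
  P (fun=> true) ->
  (forall i e e', @edge n i e e' -> P e' -> P e) -> forall e, P e.
Proof.
move=> P1 PS e; have [m] := ubnP #|[pred k | ~~ e k]|.
elim: m => // m IH in e *.
case: (pickP [pred k | ~~ e k]) => [i /= ei|e1 _]; last first.
  by rewrite (_ : e = fun=> true) //; apply: funext => k; move/negbFE: (e1 k).
rewrite (cardD1 i) inE ei add1n ltnS => lt_m.
have h : edge i e (fun k => (k == i) || e k).
  apply/and3P; split; rewrite ?eqxx //.
  by apply/forallP => k; apply/implyP => /negbTE ->.
apply: PS h _; apply: IH; apply: leq_ltn_trans lt_m; apply: subset_leq_card.
by apply/subsetP => k; rewrite !inE negb_or.
Qed.

(* As [segment], but with first vertex [a]. *)
Definition cosegment n (p : 'I_n -> nat) (e : 'I_n -> bool)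
    (a b : forall k, 'I_(p k).+1) (ab : forall k, a k <= b k) :
    cube (ord_box p) e :=
  fun k => match e k as s return cell (ord_cat (p k)) s with
           | true => OrdMor (ab k)
           | false => a k
           end.

Lemma src_cosegment n (p : 'I_n -> nat) i e e' (h : @edge n i e e') a b ab :
  src (dir (ord_box p) h) (@cosegment n p e' a b ab) = @cosegment n p e a b ab.
Proof.
apply: funext_dep => k; rewrite /= /cosegment; move: (edge_le h k).
by case: (e k) (e' k) => [] [].
Qed.

Lemma cell_arrow_src b b' (h : b ==> b') (x : cell delta b') :
  b = b' -> cell_arrow (src (cell_cat delta h) x) = cell_arrow x.
Proof. by move: b b' h x => [] []. Qed.

Lemma cell_arrow_tgt b b' (h : b ==> b') (x : cell delta b') :
  b = b' -> cell_arrow (tgt (cell_cat delta h) x) = cell_arrow x.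
Proof. by move: b b' h x => [] []. Qed.

Lemma acell_src n (Y : mset n) p (F : nerve (grothendieck Y) p) j i e e'
    (h : edge i e e') c : j != i ->
  acell F j (src (dir (ord_box p) h) c) = acell F j c.
Proof.
move=> ji; rewrite /acell -(functor_src (nfunctorP F h)).
by apply: cell_arrow_src; exact: edge_out ji.
Qed.

Lemma acell_tgt n (Y : mset n) p (F : nerve (grothendieck Y) p) j i e e'
    (h : edge i e e') c : j != i ->
  acell F j (tgt (dir (ord_box p) h) c) = acell F j c.
Proof.
move=> ji; rewrite /acell -(functor_tgt (nfunctorP F h)).
by apply: cell_arrow_tgt; exact: edge_out ji.
Qed.

Lemma edge_neq n (i j : 'I_n) e e' : edge i e e' -> e j -> j != i /\ e' j.
Proof.
move=> h ej; have ji : j != i.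
  by apply: contraTneq ej => ->; case/and3P: h.
by rewrite -(edge_out h ji).
Qed.

Lemma acell_segment n (Y : mset n) p (F : nerve (grothendieck Y) p) j a b ab
    (e : 'I_n -> bool) :
  e j -> acell F j (@segment n p e a b ab) =
         acell F j (@segment n p (fun=> true) a b ab).
Proof.
elim/shape_ind: e => // i e e' h IH ej; have [ji e'j] := edge_neq h ej.
by rewrite -(tgt_segment h) acell_tgt // IH.
Qed.

Lemma acell_cosegment n (Y : mset n) p (F : nerve (grothendieck Y) p) j a b ab
    (e : 'I_n -> bool) :
  e j -> acell F j (@cosegment n p e a b ab) =
         acell F j (@segment n p (fun=> true) a b ab).
Proof.
elim/shape_ind: e => // i e e' h IH ej; have [ji e'j] := edge_neq h ej.
by rewrite -(src_cosegment h) acell_src // IH.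
Qed.

Definition zcell n (Y : mset n) p (F : nerve (grothendieck Y) p) e
    (c : cube (ord_box p) e) : {k & Y k} := tot (projT2 (F e c)).

Lemma zcell_segment n (Y : mset n) p (F : nerve (grothendieck Y) p) a b ab
    (e : 'I_n -> bool) :
  zcell F (@segment n p e a b ab) = zcell F (@segment n p (fun=> true) a b ab).
Proof.
elim/shape_ind: e => // i e e' h <-.
rewrite -(tgt_segment h) /zcell -(functor_tgt (nfunctorP F h)).
exact: tot_mcast.
Qed.

(* [f] in the directions outside [e], the identity in the directions of [e] *)
Definition mask_dom (s : bool) (f : arrow) : nat := if s then acod f else adom f.

Definition mask_map (s : bool) (f : arrow) : hom (mask_dom s f) (acod f) :=
  match s return hom (mask_dom s f) (acod f) with
  | true => hid (acod f)
  | false => amap f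
  end.

Lemma amap_eq (f g : arrow) (x : 'I_(adom f).+1) (y : 'I_(adom g).+1) :
  f = g -> x = y :> nat -> amap f x = amap g y :> nat.
Proof. by move=> fg xy; subst g; exact: amap_ext. Qed.

Lemma src_map_false (b b' : bool) (h : b ==> b') (x : cell delta b')
    (y : ordinal _) (z : 'I_(adom (cell_arrow x)).+1) :
  ~~ b -> b' -> y = z :> nat -> src_map h x y = amap (cell_arrow x) z :> nat.
Proof. by move: b b' h x y z => [] [] //= h x y z _ _ yz; exact: amap_ext. Qed.

Lemma src_map_same (b b' : bool) (h : b ==> b') (x : cell delta b')
    (y : ordinal _) : b = b' -> src_map h x y = y :> nat.
Proof. by move: b b' h x y => [] []. Qed.

Lemma cod_src_false (b b' : bool) (h : b ==> b') (x : cell delta b') :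
  ~~ b -> b' -> cell_cod (src (cell_cat delta h) x) = adom (cell_arrow x).
Proof. by move: b b' h x => [] []. Qed.

Lemma cod_src_same (b b' : bool) (h : b ==> b') (x : cell delta b') :
  b = b' -> cell_cod (src (cell_cat delta h) x) = cell_cod x.
Proof. by move: b b' h x => [] []. Qed.

Lemma mask_map_true s (f : arrow) (x : 'I_(mask_dom s f).+1) :
  s -> mask_map s f x = x :> nat.
Proof. by case: s x. Qed.

Lemma mask_map_false s (f : arrow) (x : 'I_(mask_dom s f).+1)
    (y : 'I_(adom f).+1) :
  ~~ s -> x = y :> nat -> mask_map s f x = amap f y :> nat.
Proof. by case: s x => //= x _; exact: amap_ext. Qed.

Lemma mask_map_same s s' (f : arrow) (x : 'I_(mask_dom s f).+1)
    (y : 'I_(mask_dom s' f).+1) :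
  s = s' -> x = y :> nat -> mask_map s f x = mask_map s' f y :> nat.
Proof. by move=> ss; subst s' => /val_inj ->. Qed.

Lemma arrow_cell (f : cell delta true) : cell_arrow f = f.
Proof. by case: f. Qed.

Lemma zcell_cosegment n (Y : mset n) p (F : nerve (grothendieck Y) p) a b ab
    (e : 'I_n -> bool) (C := F _ (@segment n p (fun=> true) a b ab)) :
  zcell F (@cosegment n p e a b ab) =
  tot (mact (fun j => mask_map (e j) (projT1 C j : arrow)) (projT2 C)).
Proof.
elim/shape_ind: e => [|i e e' h IH]; first by rewrite /= mact_id.
have EF := functor_src (nfunctorP F h) (@cosegment n p e' a b ab).
rewrite src_cosegment in EF; rewrite /zcell -EF /=.
set x := projT1 (F e' _); set z := projT2 (F e' _).
have ei : ~~ e i by case/and3P: (h).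
have e'i : e' i by case/and3P: (h).
have A j : e' j -> cell_arrow (x j) = projT1 C j.
  move=> e'j; rewrite -[RHS]arrow_cell.
  exact: acell_cosegment.
have E1 j : cell_cod (x j) = mask_dom (e' j) (projT1 C j : arrow).
  have := congr1 (fun k : 'I_n -> nat => k j) (projT1_eq IH).
  exact.
have -> : tot (mact (fun j => src_map (edge_le h j) (x j)) z) =
    tot (mact (fun j => hcomp (hcast (E1 j)) (src_map (edge_le h j) (x j)))
      (mact (fun j => mask_map (e' j) (projT1 C j : arrow)) (projT2 C))).
  apply: mact_tot => [//|j y y' /val_inj -> //|]; exact: IH.
rewrite -mact_comp; apply: mact_tot => // [j|j y y' yy].
- case: (eqVneq j i) => [->|ji].
    rewrite cod_src_false // A // /mask_dom.
    by rewrite (negbTE ei).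
  by rewrite cod_src_same ?(edge_out h ji).
- rewrite [LHS]/=; case: (eqVneq j i) => [ji|ji].
    subst j; rewrite mask_map_true //=.
    have K : mask_dom (e i) (projT1 C i) = adom (cell_arrow (x i)).
      by rewrite A // /mask_dom (negbTE ei).
    rewrite (@src_map_false _ _ _ _ _ (hcast K y')) //.
    have K' : mask_dom (e i) (projT1 C i) = adom (projT1 C i).
      by rewrite /mask_dom (negbTE ei).
    rewrite (@mask_map_false _ _ _ (hcast K' y')) //.
    by apply: amap_eq => //; exact: A.
  apply: mask_map_same; first by rewrite (edge_out h ji).
  by rewrite /= src_map_same // (edge_out h ji).
Qed.

Lemma comp_cosegment n (p : 'I_n -> nat) j (h := @edge1 n j) a b c ab bc ac
    (g := @cosegment n p (fun k => k == j) b c bc)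
    (f := @segment n p (fun k => k == j) a b ab) u :
  (forall k, k != j -> a k = b k) ->
  comp (dir (ord_box p) h) g f u = @cosegment n p (fun k => k == j) a c ac.
Proof.
move=> akb; apply: funext_dep => k /=; move: (congr1 _ u) => /=.
rewrite /g /f /cosegment /segment; move: (edge_le h k) (akb k).
case: (k == j) => //= *; first exact: ordmor_ext.
by symmetry; auto.
Qed.

Lemma rho_fun_nat n (Y : mset n) q p (a : forall j, hom (q j) (p j))
    (F : nerve (grothendieck Y) p) j (x : 'I_(q j).+1)
    (va : forall k, a k ord_max <= @ord_max (p k))
    (c := acell F j (@segment n p (fun=> true) (fun k => a k ord_max) _ va)) :
  forall y : 'I_(adom c).+1, y = rho_fun (mact a F) x :> nat ->
  amap c y = rho_fun F (a j x) :> nat.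
Proof.
move=> y; rewrite !rho_funE => yE.
pose a2 k := a k (dfwith (fun k => @ord_max (q k)) x k).
pose v k := a k ord_max.
have a2v k : a2 k <= v k by apply: hom_mono; exact: leq_ord.
have a2m k : a2 k <= @ord_max (p k) by exact: leq_ord.
pose f := @segment n p (fun k => k == j) a2 v a2v.
pose g := @cosegment n p (fun k => k == j) v (fun k => ord_max) va.
have u : src (dir (ord_box p) (edge1 j)) g = tgt (dir (ord_box p) (edge1 j)) f.
  apply: funext_dep => k; rewrite /= /g /f /cosegment /segment.
  by move: (edge_le (edge1 j) k); case: (k == j).
have D : comp (dir (ord_box p) (edge1 j)) g f u =
    @cosegment n p (fun k => k == j) a2 (fun k => ord_max) a2m.
  apply: comp_cosegment => k kj; rewrite /a2 dfwith_out // eq_sym; exact: kj.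
have fE : ord_box_functor a _ (to_last x) = f.
  apply: funext_dep => k; rewrite /= /f /to_last /segment.
  by case: (k == j) => //=; exact: ordmor_ext.
have lE : to_last (a j x) = @segment n p (fun k => k == j) a2 (fun k => ord_max) a2m.
  apply: funext_dep => k; rewrite /= /to_last /segment.
  case: eqVneq => // kj; subst k; apply: ordmor_ext => //=.
  by rewrite /a2 !dfwith_in.
have [r Er] := acell_comp F u.
have cg : acell F j g = c by rewrite acell_cosegment.
have fG : acell (mact a F) j (to_last x) = acell F j f by rewrite -fE.
rewrite lE acell_segment // -(@acell_cosegment _ _ _ _ j _ _ _ (fun k => k == j)) //.
rewrite -D.
have -> : amap (acell F j (comp (dir (ord_box p) (edge1 j)) g f u)) ord_max =
   amap (delta_comp r) ord_max :> nat by apply: amap_eq => //; rewrite Er.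
transitivity (amap (acell F j g) (hcast (esym r) (amap (acell F j f) ord_max))
  : nat); last by [].
apply: amap_eq; first exact: esym cg.
rewrite yE; transitivity (amap (acell F j f) ord_max : nat); last by [].
have := congr1 (fun f : arrow => nat_of_ord (amap f ord_max)) fG; exact.
Qed.

Lemma rho_nat n (Y : mset n) q p (a : forall j, hom (q j) (p j))
    (F : nerve (grothendieck Y) p) :
  rho_simplex (mact a F) = mact a (rho_simplex F).
Proof.
pose v k := a k ord_max.
have va k : v k <= @ord_max (p k) by exact: leq_ord.
pose C := F _ (@segment n p (fun=> true) v (fun=> ord_max) va).
have EG := @zcell_cosegment _ _ _ F v _ va (fun=> false).
have EF := @zcell_segment _ _ _ F v _ va (fun=> false).
apply: existT_inj; rewrite /rho_simplex -[in RHS]mact_comp -!/(tot _).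
have E j : cell_cod (projT1 (mact a F _ (@last_vertex n q)) j) =
    adom (projT1 C j : arrow).
  have := congr1 (fun k : 'I_n -> nat => k j) (projT1_eq EG).
  exact.
have -> : tot (mact (rho_dir (mact a F))
      (projT2 (mact a F _ (@last_vertex n q)))) =
    tot (mact (fun j => hcomp (hcast (E j)) (rho_dir (mact a F) j))
      (mact (fun j => amap (projT1 C j : arrow)) (projT2 C))).
  by apply: mact_tot => [//|j y y' /val_inj -> //|]; exact: EG.
rewrite -mact_comp; apply: mact_tot => [//|j x x' /val_inj ->|].
  have K : adom (projT1 C j) = adom (cell_arrow (projT1 C j)).
    by rewrite arrow_cell.
  rewrite -(@rho_fun_nat _ _ _ _ a F j x' va
    (hcast K (hcast (E j) (rho_dir (mact a F) j x')))) //.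
  by symmetry; apply: amap_eq => //; exact: arrow_cell.
exact: esym EF.
Qed.

Definition rho n (Y : mset n) : mmap (nerve (grothendieck Y)) Y :=
  @MMap n (nerve (grothendieck Y)) Y (@rho_simplex n Y) (@rho_nat n Y).

(* Main.v *)
Require Import Defs.
From mathcomp Require Import all_boot.
From mathcomp Require Import boolp classical_sets.
From mathcomp Require Import zify.
From Stdlib Require Import Relation_Operators.

(* Compare Y with the nerve through a collage: a simplicial set whose simplices
   begin with vertices of the diagonal of Y and end with objects of Delta^n. Taking
   last vertices retracts the collage onto the diagonal of Y; the composite of this
   retraction with the inclusion of the nerve is rho, and the inclusion of the nerve
   is homotopic to rho. It remains to extend maps into a Kan complex from the nerve
   to the collage, and also, for the cylinder Y x Delta^1, from its nerve and the two
   ends of its collage. This is done by filling horns along a matching of the new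
   simplices: given the vertices 0..q in Y, an initial run of the next objects
   consists of quotients [q] -> [r] of the part in Y, and one inserts or deletes the
   image of [q] in the object following that run (or, at the end, the
   Eilenberg-Zilber quotient of the simplex of Y itself). *)

Set Implicit Arguments.
Unset Strict Implicit.
Unset Printing Implicit Defensive.

(** * Degeneracies in simplicial sets *)

(** No map from Y back to the nerve offers itself: a simplex of Y does not choose a chain of objects
    of Delta^n. Since weak equivalences are tested by maps into Kan complexes, such chains need only
    be available as horn fillers, and this is what the collage provides. The obstacle for n > 1 is
    that a vertex of the diagonal has the same [q] in all directions, whereas the maps from [q] to
    the components k_i^j of an object depend on j. The remedy is one kernel common to all
    directions: the image of [q] in the product of the k_i^j is again a finite chain [r], so ([r],
    ..., [r]) is an object through which all these maps factor. Kernels grow along a chain of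
    objects, strictly so along quotients in a nondegenerate simplex, and all the combinatorics of
    the matching compares consecutive kernels. The cylinder enters because extensions to the collage
    are not unique: two extensions of homotopic maps have to become homotopic on Y, so a homotopy
    must itself be extended with both ends prescribed. *)

Definition hnat k l (f : hom k l) (i : nat) : nat := f (inord i).

Lemma hnatE k l (f : hom k l) (x : 'I_k.+1) : hnat f x = f x.
Proof. by rewrite /hnat inord_val. Qed.

Lemma hnat_le k l (f : hom k l) i : hnat f i <= l.
Proof. exact: leq_ord. Qed.

Lemma hnat_mono k l (f : hom k l) i i' : i <= i' -> i' <= k ->
  hnat f i <= hnat f i'.
Proof. by move=> ii' i'k; apply: hom_mono; rewrite !inordK; lia. Qed.

Lemma hnat_comp k l m (g : hom l m) (f : hom k l) i :
  hnat (hcomp g f) i = hnat g (hnat f i).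
Proof. by rewrite [in RHS]/hnat /= inord_val. Qed.

Lemma hnat_id k i : i <= k -> hnat (hid k) i = i.
Proof. by move=> ik; rewrite /hnat /= inordK. Qed.

Lemma hnat_ext k l (f g : hom k l) :
  (forall i, i <= k -> hnat f i = hnat g i) -> f = g.
Proof. by move=> H; apply: hom_ext => x; rewrite -!hnatE H // leq_ord. Qed.

Lemma coll_subproof m i :
  {homo (fun x : 'I_m.+1 => inord (if x == i.+1 :> nat then i else x) : 'I_m.+1)
    : x y / x <= y}.
Proof.
move=> x y; have xm := ltn_ord x; have ym := ltn_ord y.
by rewrite !inordK; repeat case: eqP; lia.
Qed.

Definition coll m i : hom m m := Hom (@coll_subproof m i).

Lemma hnat_coll m i x : x <= m -> hnat (coll m i) x = if x == i.+1 then i else x.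
Proof. by move=> xm; rewrite /hnat /= !inordK //; case: eqP; lia. Qed.

Lemma face_subproof m e :
  {homo (fun x : 'I_m.+1 => inord (bump e x) : 'I_m.+2) : x y / x <= y}.
Proof. have lt (x : 'I_m.+1) : bump e x < m.+2 by have := ltn_ord x; rewrite /bump; lia.
by move=> x y xy; rewrite !inordK // /bump; lia. Qed.

Definition face m e : hom m m.+1 := Hom (@face_subproof m e).

Lemma hnat_face m e x : x <= m -> hnat (face m e) x = bump e x.
Proof. by move=> xm; rewrite /hnat /= !inordK // ?inordK // /bump; lia. Qed.

Lemma degen_subproof m i :
  {homo (fun x : 'I_m.+2 => inord (unbump (minn i m) x) : 'I_m.+1) : x y / x <= y}.
Proof.
have lt (x : 'I_m.+2) : unbump (minn i m) x < m.+1.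
  by have := ltn_ord x; rewrite /unbump; lia.
by move=> x y xy; rewrite !inordK // /unbump; lia.
Qed.

(** The truncation makes [degen m j] undo [face m j] for every j up to m+1, the last face
    included. *)
Definition degen m i : hom m.+1 m := Hom (@degen_subproof m i).

Lemma hnat_degen m i x : x <= m.+1 -> hnat (degen m i) x = unbump (minn i m) x.
Proof. by move=> xm; rewrite /hnat /= !inordK // ?inordK // /unbump; lia. Qed.

Lemma coll_factor m i : i < m.+1 ->
  coll m.+1 i = hcomp (face m i.+1) (degen m i).
Proof.
move=> im; apply: hnat_ext => x xm; rewrite hnat_comp hnat_coll // hnat_degen //.
rewrite hnat_face /unbump /bump; last by lia.
by case: eqP; lia.
Qed.

Lemma hom_coll k l (f : hom k l) i : i < k -> hnat f i = hnat f i.+1 ->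
  f = hcomp f (coll k i).
Proof.
move=> ik fi; apply: hnat_ext => x xk; rewrite hnat_comp hnat_coll //.
by case: eqP => [->|].
Qed.

Lemma hom_incr a b (f : hom a b) :
  (forall i, i < a -> hnat f i <> hnat f i.+1) ->
  forall i j, i + j <= a -> hnat f i + j <= hnat f (i + j).
Proof.
move=> H i; elim=> [|j IH] ij; first by rewrite !addn0.
have ija : i + j < a by lia.
have := hnat_mono f (leqnSn (i + j)) ija; have := H _ ija; have := IH (ltnW ija).
by rewrite !addnS; lia.
Qed.

Lemma hom_repeat a b (f : hom a b) :
  b < a -> exists2 i, i < a & hnat f i = hnat f i.+1.
Proof.
move=> ba; apply: contrapT => H.
have := @hom_incr _ _ f _ 0 a; rewrite add0n => K.
have := K (fun i ia e => H (ex_intro2 _ _ i ia e)) (leqnn _).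
by have := hnat_le f a; lia.
Qed.

Lemma hom_endo a (f : hom a a) :
  f = hid a \/ exists2 i, i < a & hnat f i = hnat f i.+1.
Proof.
have [|H] := pselect (exists2 i, i < a & hnat f i = hnat f i.+1); first by right.
left; have I := @hom_incr _ _ f (fun i ia e => H (ex_intro2 _ _ i ia e)).
apply: hnat_ext => i ia; rewrite hnat_id //.
have := I 0 i; have := I i (a - i); rewrite add0n subnKC //.
by have := hnat_le f a; lia.
Qed.

Definition surj k l (f : hom k l) := forall y, exists x, f x = y.

Lemma surj_section k l (f : hom k l) (x0 : 'I_k.+1) : surj f ->
  exists u : hom l k, (forall y, f (u y) = y) /\ u (f x0) = x0.
Proof.
move=> sf; have [v vP] := choice sf.
pose w y := if y == f x0 then x0 else v y.
have wP y : f (w y) = y by rewrite /w; case: eqP => // ->.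
have wm : {homo w : x y / x <= y}.
  move=> x y xy; rewrite leqNgt; apply/negP => yx.
  have := hom_mono f (ltnW yx); rewrite !wP => yx'.
  have E : x = y by apply/val_inj/anti_leq/andP.
  by move: yx; rewrite E ltnn.
by exists (Hom wm); split=> //=; rewrite /w eqxx.
Qed.

Lemma sact_idE (T : sset) k (f : hom k k) (x : T k) :
  (forall i, i <= k -> hnat f i = i) -> sact f x = x.
Proof.
move=> H; rewrite -[RHS]sact_id; congr sact; apply: hnat_ext => i ik.
by rewrite H // hnat_id.
Qed.

(** Since [coll] is a face map after a degeneracy map, a simplex is fixed by it exactly when it is
    the corresponding degeneracy of a face. This form stays within one dimension. *)
Definition nondeg (T : sset) m (x : T m) :=
  forall i, i < m -> x <> sact (coll m i) x.

(** Restriction along a section of [s] presents [x] as a restriction of [y]. If b were smaller than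
    a, the map in question would repeat a value and [x] would be degenerate. *)
Lemma nondeg_dim (T : sset) p a b (s : hom p a) (t : hom p b) (x : T a) (y : T b) :
  surj s -> nondeg x -> sact s x = sact t y -> a <= b.
Proof.
move=> ss nx st; have [u [us _]] := surj_section ord0 ss.
have xE : x = sact (hcomp t u) y.
  rewrite sact_comp -st -sact_comp -[LHS]sact_id; congr sact.
  by apply: hom_ext => z /=; rewrite us.
rewrite leqNgt; apply/negP => /(hom_repeat (hcomp t u)) [i ia ti].
by apply: (nx i ia); rewrite [in RHS]xE -sact_comp -hom_coll.
Qed.

(** Uniqueness half of the Eilenberg-Zilber lemma. With a section u of [s] through a given vertex z,
    [x] is fixed by t u; nondegeneracy forces t u to be the identity, and evaluation at s z gives t
    z = s z. *)
Lemma nondeg_inj (T : sset) p a (s t : hom p a) (x : T a) :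
  surj s -> nondeg x -> sact s x = sact t x -> s = t.
Proof.
move=> ss nx st; apply: hom_ext => z.
have [u [us uz]] := surj_section z ss.
have xE : x = sact (hcomp t u) x.
  rewrite sact_comp -st -sact_comp -[LHS]sact_id; congr sact.
  by apply: hom_ext => w /=; rewrite us.
case: (hom_endo (hcomp t u)) => [E|[i ia ti]].
  by have := congr1 (fun f : hom a a => f (s z)) E; rewrite /= uz => ->.
by case: (nx i ia); rewrite [in RHS]xE -sact_comp -hom_coll.
Qed.

Lemma nondeg_ind (T : sset) (P : forall m, T m -> Prop) :
  (forall k l (f : hom k l) x, P l x -> P k (sact f x)) ->
  (forall m (x : T m), nondeg x -> P m x) -> forall m (x : T m), P m x.
Proof.
move=> Pact Pnd; elim=> [|m IH] x; first by apply: Pnd => i.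
have [/Pnd //|] := pselect (nondeg x).
move=> /existsNP [i /not_implyP [im /contrapT xE]].
by rewrite xE coll_factor // sact_comp; apply: Pact.
Qed.

(** * Extending maps into a Kan complex along a matching *)

Section Matching.

Variables (T K : sset).
Hypothesis kanK : is_kan K.
Variable R0 : forall m, T m -> K m -> Prop.
Hypothesis R0_fun : forall m (x : T m) y y', R0 x y -> R0 x y' -> y = y'.
Hypothesis R0_act : forall k l (f : hom k l) x y,
  R0 x y -> R0 (sact f x) (sact f y).
(* [pr t e]: the simplex [t] is matched with its [e]-th face. *)
Variable pr : forall m, T m -> nat -> Prop.
Variables r1 r2 : forall m, T m -> nat -> nat.
Hypothesis pr0 : forall (t : T 0) e, ~ pr t e.
Hypothesis pr_le : forall m (t : T m) e, pr t e -> e <= m.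
Hypothesis pr_nd : forall m (t : T m) e, pr t e -> nondeg t.
Hypothesis pr_face_nd : forall m (t : T m.+1) e, pr t e -> nondeg (sact (face m e) t).
Hypothesis pr_face_new : forall m (t : T m.+1) e y,
  pr t e -> ~ R0 (sact (face m e) t) y.
Hypothesis pr_face_inj : forall m (t t' : T m.+1) e e', pr t e -> pr t' e' ->
  sact (face m e) t = sact (face m e') t' -> t = t'.
Hypothesis pr_face_pr : forall m (t : T m.+1) e e',
  pr t e -> ~ pr (sact (face m e) t) e'.
Hypothesis pr_cover : forall m (x : T m), nondeg x -> (forall y, ~ R0 x y) ->
  (exists e, pr x e) \/ exists t e, pr t e /\ sact (face m e) t = x.
(** As [E] ranges over all subcomplexes, the other faces of [t] are asserted to lie in the
    subcomplex generated by the domain of [R0] and the pairs of smaller lexicographic rank. This is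
    the acyclicity of the matching. *)
Hypothesis pr_rank : forall m (t : T m.+1) e j (E : forall p, T p -> Prop),
  pr t e -> j <= m.+1 -> j <> e ->
  (forall k l (f : hom k l) x, E l x -> E k (sact f x)) ->
  (forall p (x : T p) y, R0 x y -> E p x) ->
  (forall p (t' : T p) e', pr t' e' ->
     (r1 t' e' < r1 t e \/ r1 t' e' = r1 t e /\ r2 t' e' < r2 t e) -> E p t') ->
  E m (sact (face m j) t).

Definition partial_map := set {m & (T m * K m)%type}.

(** Joining [R0] here, instead of asking that [A] contain it, makes the union of the empty chain
    good in Zorn's lemma. *)
Definition prel (A : partial_map) m (x : T m) (y : K m) :=
  A (existT _ m (x, y)) \/ R0 x y.

Record good (A : partial_map) : Prop := Good {
  good_fun : forall m (x : T m) y y', prel A x y -> prel A x y' -> y = y';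
  good_act : forall k l (f : hom k l) x y, prel A x y -> prel A (sact f x) (sact f y);
  good_pr : forall m (t : T m.+1) e, pr t e ->
    (exists y, prel A (sact (face m e) t) y) -> exists y, prel A t y
}.

Lemma good_max : exists A, good A /\
  forall B, good B -> (forall m x y, @prel A m x y -> @prel B m x y) ->
    forall m x y, @prel B m x y -> @prel A m x y.
Proof.
have [F FP Ftot|A [gA Amax]] := @Zorn_bigcup _ good.
  pose U := (\bigcup_(X in F) X)%classic.
  have up X m x y : F X -> @prel X m x y -> @prel U m x y.
    by move=> FX [Xx|]; [left; exists X | right].
  have dn m x y : @prel U m x y -> (exists2 X, F X & @prel X m x y) \/ R0 x y.
    by case=> [[X FX Xx]|]; [left; exists X => //; left | right].
  split.
  - move=> m x y y' /dn [[X FX xy]|xy] /dn [[X' FX' xy']|xy'].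
    + case: (Ftot _ _ FX FX') => XX.
        by apply: good_fun (FP _ FX') _ _ _ _ _ xy'; case: xy => [/XX|]; [left|right].
      by apply: good_fun (FP _ FX) _ _ _ _ xy _; case: xy' => [/XX|]; [left|right].
    + by apply: good_fun (FP _ FX) _ _ _ _ xy _; right.
    + by apply: good_fun (FP _ FX') _ _ _ _ _ xy'; right.
    + exact: R0_fun xy xy'.
  - move=> k l f x y /dn [[X FX xy]|xy]; last by right; exact: R0_act.
    by apply: (up _ _ _ _ FX); apply: good_act (FP _ FX) _ _ _ _ _ xy.
  - move=> m t e pt [y /dn [[X FX xy]|xy]]; last by case: (pr_face_new pt xy).
    have [|y' ty] := good_pr (FP _ FX) pt; first by exists y.
    by exists y'; exact: (up _ _ _ _ FX).
exists A; split=> // B gB AB m x y Bxy.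
(* Zorn's lemma gives maximality for inclusion of sets; absorbing [R0] into [B] turns an inclusion
   of relations into one of sets. *)
pose B' : partial_map := fun s => prel B (projT2 s).1 (projT2 s).2.
have B'E p x' y' : @prel B' p x' y' <-> @prel B p x' y'.
  by split=> [[]//|h]; [right|left].
apply: contrapT => nA; apply: (Amax B').
  split=> [|/(_ (existT _ m (x, y)) Bxy) Axy]; last by apply: nA; left.
  by move=> [p [x' y']] Ap; apply: AB; left.
split.
- by move=> p x' y1 y2 /B'E h1 /B'E h2; exact: good_fun gB _ _ _ _ h1 h2.
- by move=> k l f x' y' /B'E h; apply/B'E; exact: good_act gB _ _ _ _ _ h.
- move=> p t e pt [y' /B'E h].
  have [|y'' h'] := good_pr gB pt; first by exists y'.
  by exists y''; apply/B'E.
Qed.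

Definition pdom (A : partial_map) m (x : T m) := exists y, prel A x y.

Section Step.

Variable A : partial_map.
Hypothesis gA : good A.
Variables (m : nat) (t : T m.+1) (e : nat).
Hypothesis pt : pr t e.
Hypothesis new_face : ~ pdom A (sact (face m e) t).
Hypothesis old_face : forall j, j <= m.+1 -> j <> e -> pdom A (sact (face m j) t).

Let io : 'I_m.+2 := Ordinal (pr_le pt : e < m.+2).

Lemma face_factor k (a : hom k m.+1) (j : 'I_m.+2) : (forall x, a x <> j) ->
  a = hcomp (face m j) (hcomp (degen m j) a).
Proof.
move=> aj; apply: hnat_ext => x xk; rewrite !hnat_comp.
have ax := hnat_le a x; rewrite hnat_degen // hnat_face /unbump; last by lia.
have : hnat a x <> j by move=> axj; apply: (aj (inord x)); apply: val_inj.
by rewrite /bump; have := ltn_ord j; lia.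
Qed.

Lemma pdom_act k l (f : hom k l) x : pdom A x -> pdom A (sact f x).
Proof. by move=> [y xy]; exists (sact f y); exact: good_act gA _ _ _ _ _ xy. Qed.

Lemma pdom_horn k (a : hom k m.+1) : in_horn io a -> pdom A (sact a t).
Proof.
move=> [j [ji aj]]; rewrite (face_factor aj) sact_comp; apply: pdom_act.
by apply: old_face; [exact: leq_ord | move=> je; apply: ji; exact: val_inj].
Qed.

Lemma not_horn k (a : hom k m.+1) : ~ in_horn io a ->
  surj a \/ exists2 b : hom k m, surj b & a = hcomp (face m e) b.
Proof.
move=> nh; have H j : j <> io -> exists x, a x = j.
  move=> ji; apply: contrapT => nx; apply: nh; exists j; split=> // x ax.
  by apply: nx; exists x.
have [[x ax]|nx] := pselect (exists x, a x = io).
  by left=> j; have [->|/H//] := pselect (j = io); exists x.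
right; have ae x : a x <> io by move=> ax; apply: nx; exists x.
exists (hcomp (degen m e) a); last exact: face_factor ae.
move=> y; have em := pr_le pt; have ym := ltn_ord y.
have fy : face m e y = bump e y :> nat by rewrite -hnatE hnat_face // -ltnS.
have [|x ax] := H (face m e y).
  by move=> /(congr1 val); rewrite /= -[X in X = _]/(nat_of_ord (face m e y)) fy /bump; lia.
exists x; apply: val_inj; rewrite /= ax -[LHS]/(nat_of_ord (degen m e (face m e y))).
by rewrite -!hnatE hnat_degen ?hnat_face /unbump /bump; lia.
Qed.

Lemma face_in_dom k (a : hom k m.+1) : pdom A (sact a t) -> in_horn io a.
Proof.
move=> da; apply: contrapT => /not_horn [sa|[b sb aE]].
  have [u [ua _]] := surj_section ord0 sa.
  apply: new_face; apply: pdom_act; have := pdom_act u da; rewrite -sact_comp.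
  by rewrite sact_idE // => i im; rewrite /hnat /= ua inordK.
have [u [ub _]] := surj_section ord0 sb.
apply: new_face; have := pdom_act u da; rewrite aE -!sact_comp.
congr pdom; congr sact; apply: hom_ext => x /=; by rewrite ub.
Qed.

(** Outside the horn lie only surjections onto the whole simplex or onto its [e]-th face. Dimension
    separates the two kinds and Eilenberg-Zilber uniqueness the members of each, so adding [t] is a
    true pushout along the horn inclusion. *)
Lemma not_horn_inj k (a b : hom k m.+1) : ~ in_horn io a -> ~ in_horn io b ->
  sact a t = sact b t -> a = b.
Proof.
move=> /not_horn [sa|[a' sa' ->]] /not_horn [sb|[b' sb' ->]].
- by move=> E; apply: nondeg_inj E => //; exact: pr_nd pt.
- rewrite sact_comp => E.
  by have := nondeg_dim sa (pr_nd pt) E; rewrite ltnn.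
- rewrite sact_comp => E.
  by have := nondeg_dim sb (pr_nd pt) (esym E); rewrite ltnn.
- rewrite !sact_comp => E; congr hcomp.
  by apply: nondeg_inj E => //; exact: pr_face_nd pt.
Qed.

(** The filler becomes the value at [t], and its [e]-th face the value at the missing face. By
    [face_in_dom] the old domain meets the simplex only in the horn, where both definitions
    agree. *)
Lemma step : exists2 B, good B &
  (forall p x y, @prel A p x y -> @prel B p x y) /\ pdom B t.
Proof.
have uP k (a : horn io k) : exists y, prel A (sact (proj1_sig a) t) y.
  by apply: pdom_horn; case: a.
pose u (s : {k & horn io k}) := sval (cid (uP _ (projT2 s))).
have uE s : prel A (sact (proj1_sig (projT2 s)) t) (u s) by rewrite /u; case: cid.
have u_nat k l (f : hom k l) a :
    u (existT _ k (sact f a : horn io k)) = sact f (u (existT _ l a)).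
  apply: (good_fun gA) _ _ _ _ (uE (existT _ k _)) _.
  by rewrite /= sact_comp; apply: (good_act gA) _ _ _ _ _ (uE (existT _ l a)).
have [v vP] := kanK (@SMap (horn io) K (fun k a => u (existT _ k a)) u_nat).
pose w := v _ (hid m.+1).
have vE k (a : hom k m.+1) : v k a = sact a w.
  rewrite /w -sfun_nat; congr (v k _); exact: hom_ext.
pose B : partial_map := fun s => prel A (projT2 s).1 (projT2 s).2 \/
  exists a : hom (projT1 s) m.+1,
    (projT2 s).1 = sact a t /\ (projT2 s).2 = sact a w.
have BE p x y : @prel B p x y <-> @prel A p x y \/
    exists a : hom p m.+1, x = sact a t /\ y = sact a w.
  by split=> [[|]|]; [|left; right|left].
have wA k (a : hom k m.+1) y : prel A (sact a t) y -> y = sact a w.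
  move=> Ay; have ha : in_horn io a by apply: face_in_dom; exists y.
  have := vP k (exist _ a ha); rewrite /= vE => ->.
  exact: good_fun gA _ _ _ _ Ay (uE (existT _ k (exist _ a ha))).
exists B; last split.
- split.
  + move=> p x y y' /BE [xy|[a [-> ->]]] /BE [xy'|[b [xE ->]]].
    * exact: good_fun gA _ _ _ _ xy xy'.
    * by move: xy; rewrite xE => /wA.
    * by rewrite (wA _ _ _ xy').
    * have [ha|na] := pselect (in_horn io a).
        have [z Az] := pdom_horn ha.
        by rewrite -(wA _ _ _ Az); rewrite xE in Az; rewrite -(wA _ _ _ Az).
      have nb : ~ in_horn io b.
        by move=> /pdom_horn; rewrite -xE => /face_in_dom.
      by rewrite (not_horn_inj na nb xE).
  + move=> k l f x y /BE [xy|[a [-> ->]]]; apply/BE.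
      by left; exact: good_act gA _ _ _ _ _ xy.
    by right; exists (hcomp a f); rewrite !sact_comp.
  + move=> p t' e' pt' [y /BE [xy|[a [xE _]]]].
      have [|y' ty'] := good_pr gA pt'; first by exists y.
      by exists y'; apply/BE; left.
    have [ha|na] := pselect (in_horn io a).
      have [|y' ty'] := good_pr gA pt'; first by rewrite xE; exact: pdom_horn.
      by exists y'; apply/BE; left.
    (* A nondegenerate simplex among those just added is [t] or its missing face. The lower member
       of a pair is never the upper member of another, which excludes [t]; the missing face has [t]
       as its only partner. *)
    have nd := pr_face_nd pt'.
    have inja i : i < p -> hnat a i <> hnat a i.+1.
      by move=> ip ai; apply: (nd i ip); rewrite [in RHS]xE -sact_comp -hom_coll.
    case/not_horn: na => [sa|[b sb aE]].
      have pm : p <= m.+1.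
        rewrite leqNgt; apply/negP => /(hom_repeat a) [i ip].
        exact: inja.
      have mp : m.+1 <= p.
        apply: (@nondeg_dim T p _ _ a (hid p) t (sact (face p e') t')) => //.
          exact: pr_nd pt.
        by rewrite sact_id -xE.
      have pE : p = m.+1 by apply/anti_leq/andP.
      subst p; have aid : a = hid _.
        by case: (hom_endo a) => // -[i ip /inja]; case.
      have := pr_face_pr pt'; rewrite xE aid sact_id => /(_ _ pt); case.
    have pm : p <= m.
      rewrite leqNgt; apply/negP => /(hom_repeat b) [i ip bi].
      by apply: (inja i ip); rewrite aE !hnat_comp bi.
    have mp : m <= p.
      apply: (@nondeg_dim T p _ _ b (hid p) _ (sact (face p e') t')) => //.
        exact: pr_face_nd pt.
      by rewrite sact_id xE aE sact_comp.
    have pE : p = m by apply/anti_leq/andP.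
    subst p; have bid : b = hid _.
      case: (hom_endo b) => // -[i ip bi].
      by case: (inja i ip); rewrite aE !hnat_comp bi.
    have -> : t' = t.
      by apply: pr_face_inj pt' pt _; rewrite xE aE bid sact_comp sact_id.
    by exists w; apply/BE; right; exists (hid _); rewrite !sact_id.
- by move=> p x y Axy; apply/BE; left.
- by exists w; apply/BE; right; exists (hid _); rewrite !sact_id.
Qed.

End Step.

Theorem matching_extension :
  exists v : smap T K, forall m (x : T m) y, R0 x y -> v m x = y.
Proof.
have [A [gA Amax]] := good_max.
(* Lexicographic induction on the rank: were the missing face outside the domain, the other faces
   would lie in it by induction, and [step] would contradict maximality. *)
have face_dom a b m (t : T m.+1) e : pr t e -> r1 t e = a -> r2 t e = b ->
    pdom A (sact (face m e) t).
  elim/ltn_ind: a b m t e => a IHa; elim/ltn_ind => b IHb m t e pt ta tb.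
  apply: contrapT => nd.
  have old j : j <= m.+1 -> j <> e -> pdom A (sact (face m j) t).
    move=> jm je; apply: (pr_rank pt jm je (@pdom_act A gA)).
      by move=> p x y xy; exists y; right.
    move=> [t' e' pt'|p t' e' pt' r]; first by case: (pr0 pt').
    apply: (good_pr gA pt'); case: r => [r|[r r']].
      by rewrite ta in r; exact: IHa r _ _ _ _ pt' erefl erefl.
    by rewrite tb in r'; rewrite ta in r; exact: IHb r' _ _ _ pt' r erefl.
  have [B gB [AB [y ty]]] := step gA pt nd old.
  have [z tz] : pdom A t by exists y; exact: Amax gB AB _ _ _ ty.
  by apply: nd; exists (sact (face m e) z); exact: good_act gA _ _ _ _ _ tz.
have tot m (x : T m) : pdom A x.
  apply: (nondeg_ind (@pdom_act A gA)) => {}m {}x ndx.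
  have [[y xy]|nR] := pselect (exists y, R0 x y); first by exists y; right.
  have {}nR y : ~ R0 x y by move=> xy; apply: nR; exists y.
  case: (pr_cover ndx nR) => [[e px]|[t [e [pt <-]]]].
    case: m => [|m] in x px {ndx nR} *; first by case: (pr0 px).
    apply: (good_pr gA px); exact: face_dom px erefl erefl.
  exact: face_dom pt erefl erefl.
pose v (s : {m & T m}) := sval (cid (tot _ (projT2 s))).
have vE s : prel A (projT2 s) (v s) by rewrite /v; case: cid.
have v_nat k l (f : hom k l) x :
    v (existT _ k (sact f x)) = sact f (v (existT _ l x)).
  apply: (good_fun gA) _ _ _ _ (vE (existT _ k _)) _.
  by apply: (good_act gA) _ _ _ _ _ (vE (existT _ l x)).
exists (@SMap T K (fun k x => v (existT _ k x)) v_nat) => m x y xy.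
apply: (good_fun gA) _ _ _ _ (vE (existT _ m x)) _; by right.
Qed.

End Matching.

(** * Restriction along untyped maps *)

Definition valid (a b : nat) (f : nat -> nat) : Prop :=
  (forall v, v <= a -> f v <= b) /\ (forall u v, u <= v -> v <= a -> f u <= f v).

Lemma valid_ext a b f g : (forall v, v <= a -> f v = g v) -> valid a b f -> valid a b g.
Proof.
move=> fg [fb fm]; split=> [v va|u v uv va]; rewrite -!fg //; auto; lia.
Qed.

Lemma valid_comp a b c f g : valid a b f -> valid b c g -> valid a c (fun v => g (f v)).
Proof.
by move=> [fb fm] [gb gm]; split=> [v va|u v uv va]; auto.
Qed.

Lemma valid_id a : valid a a (fun v => v).
Proof. by []. Qed.

Lemma valid_hnat a b (f : hom a b) : valid a b (hnat f).
Proof. by split=> *; [exact: hnat_le | exact: hnat_mono]. Qed.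

Lemma uhom_subproof (a b : nat) (f : nat -> nat) :
  {homo (fun x : 'I_a.+1 => inord (minn b (\max_(u < x.+1) f u)) : 'I_b.+1)
    : x y / x <= y}.
Proof.
move=> x y xy; rewrite !inordK; try lia.
suff: \max_(u < x.+1) f u <= \max_(u < y.+1) f u by lia.
apply/bigmax_leqP => u _; have uy : u < y.+1 by have := ltn_ord u; lia.
exact: (@leq_bigmax _ (fun v : 'I_y.+1 => f v) (Ordinal uy)).
Qed.

(* The maximum makes the map monotone for every [f]. *)
Definition uhom (a b : nat) (f : nat -> nat) : hom a b := Hom (@uhom_subproof a b f).

Lemma hnat_uhom a b f v : valid a b f -> v <= a -> hnat (uhom a b f) v = f v.
Proof.
move=> [fb fm] va; rewrite /hnat /= !inordK //; try lia.
suff -> : \max_(u < v.+1) f u = f v by have := fb v va; lia.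
apply/anti_leq/andP; split.
  by apply/bigmax_leqP => u _; have := ltn_ord u; move=> ?; apply: fm; lia.
exact: (@leq_bigmax _ (fun u : 'I_v.+1 => f u) ord_max).
Qed.

Section Collage.

Variables (n : nat) (Y : mset n).

Definition ytot := {k : 'I_n -> nat & Y k}.

(** Acting on the sum over all multidegrees, through functions on natural numbers, allows degrees to
    be rewritten without casts. *)
Definition uact (d : 'I_n -> nat) (f : 'I_n -> nat -> nat) (z : ytot) : ytot :=
  existT _ d (mact (fun j => uhom (d j) (projT1 z j) (f j)) (projT2 z)).

Definition validm (d d' : 'I_n -> nat) (f : 'I_n -> nat -> nat) :=
  forall j, valid (d j) (d' j) (f j).

Lemma uact_ext d d' f g z : (forall j, d j = d' j) ->
  (forall j v, v <= d j -> f j v = g j v) -> validm d (projT1 z) f ->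
  uact d f z = uact d' g z.
Proof.
move=> dd fg fv; have dE : d = d' by apply: funext_dep.
subst d'; congr existT; congr mact; apply: funext_dep => j.
apply: hnat_ext => v vd; rewrite !hnat_uhom //; first exact: fg.
by apply: valid_ext (fv j) => w; exact: fg.
Qed.

Lemma uact_id d f z : (forall j, projT1 z j = d j) ->
  (forall j v, v <= d j -> f j v = v) -> uact d f z = z.
Proof.
case: z => [k y] /= kd fid; have dE : k = d by apply: funext_dep.
subst d; congr existT; rewrite /= -[RHS]mact_id; congr mact.
apply: funext_dep => j; apply: hnat_ext => v vd; rewrite hnat_id // hnat_uhom ?fid //.
by apply: valid_ext (@valid_id _) => w wd; rewrite fid.
Qed.

Lemma uact_comp d d' f g z : validm d d' f -> validm d' (projT1 z) g ->
  uact d f (uact d' g z) = uact d (fun j v => g j (f j v)) z.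
Proof.
move=> fv gv; congr existT; rewrite /= -mact_comp; congr mact.
apply: funext_dep => j; apply: hnat_ext => v vd.
rewrite hnat_comp !hnat_uhom //; first exact: valid_comp (fv j) (gv j).
by case: (fv j) => + _; exact.
Qed.

Lemma tot_mact k l (f : forall j, hom (k j) (l j)) (y : Y l) :
  tot (mact f y) = uact k (fun j => hnat (f j)) (tot y).
Proof.
congr existT; congr mact; apply: funext_dep => j; apply: hnat_ext => v vk.
by rewrite hnat_uhom //; exact: valid_hnat.
Qed.

(** * The collage of the last vertex map *)

(* An m-simplex has vertices 0..m. Those satisfying [yp] form an initial segment
   and belong to the diagonal of Y; the others are objects of Delta^n. The data of
   such a simplex is a functor [k : [m] -> Delta^n] together with z in Y(k_m); the
   i-th vertex, if it is in the diagonal of Y, is encoded by k_i = ([i], ..., [i]),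
   with the inclusions as transition maps. *)
Record raw := Raw {
  yp : nat -> bool;
  ob : 'I_n -> nat -> nat;
  mp : 'I_n -> nat -> nat -> nat -> nat;
  top : ytot
}.

Record ok m (r : raw) : Prop := Ok {
  yp_down : forall i i', i <= i' -> i' <= m -> yp r i' -> yp r i;
  ob_yp : forall j i, i <= m -> yp r i -> ob r j i = i;
  mp_valid : forall j i i', i <= i' -> i' <= m ->
    valid (ob r j i) (ob r j i') (mp r j i i');
  mp_id : forall j i v, i <= m -> v <= ob r j i -> mp r j i i v = v;
  mp_comp : forall j i i' i'' v, i <= i' -> i' <= i'' -> i'' <= m -> v <= ob r j i ->
    mp r j i' i'' (mp r j i i' v) = mp r j i i'' v;
  mp_yp : forall j i i' v, i <= i' -> i' <= m -> yp r i' -> v <= i ->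
    mp r j i i' v = v;
  top_dim : forall j, projT1 (top r) j = ob r j m
}.

Record req m (r s : raw) : Prop := Req {
  yp_eq : forall i, i <= m -> yp r i = yp s i;
  ob_eq : forall j i, i <= m -> ob r j i = ob s j i;
  mp_eq : forall j i i' v, i <= i' -> i' <= m -> v <= ob r j i ->
    mp r j i i' v = mp s j i i' v;
  top_eq : top r = top s
}.

Lemma req_sym m r s : req m r s -> req m s r.
Proof.
move=> [h1 h2 h3 h4]; split=> // [i im|j i im|j i i' v ii' im vi].
- by rewrite h1.
- by rewrite h2.
- by rewrite h3 // h2 //; lia.
Qed.

Lemma req_trans m r s t : req m r s -> req m s t -> req m r t.
Proof.
move=> [h1 h2 h3 h4] [k1 k2 k3 k4]; split=> // [i im|j i im|j i i' v ii' im vi|].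
- by rewrite h1 ?k1.
- by rewrite h2 ?k2.
- by rewrite h3 // k3 // -h2 //; lia.
- by rewrite h4.
Qed.

(** Values out of the range of an m-simplex get a default, so that on fixed points of [norm] the
    agreement [req] becomes Leibniz equality. *)
Definition norm m (r : raw) : raw :=
  Raw (fun i => (i <= m) && yp r i) (fun j i => if i <= m then ob r j i else 0)
    (fun j i i' v => if [&& i <= i', i' <= m & v <= ob r j i] then mp r j i i' v else 0)
    (top r).

Lemma norm_req m r : req m (norm m r) r.
Proof.
split=> //= [i -> //|j i -> //|j i i' v ii' im].
by rewrite (leq_trans ii' im) ii' im /= => ->.
Qed.

Lemma norm_eq m r s : req m r s -> norm m r = norm m s.
Proof.
case: r s => [y1 o1 m1 t1] [y2 o2 m2 t2] [/= h1 h2 h3 ->]; congr Raw.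
- by apply: funext => i; case: leqP => //= im; rewrite h1.
- by apply: funext => j; apply: funext => i; case: leqP => //= im; rewrite h2.
- apply: funext => j; apply: funext => i; apply: funext => i'; apply: funext => v /=.
  case: (leqP i i') => //= ii'; case: (leqP i' m) => //= im.
  by rewrite h2 ?(leq_trans ii') //; case: leqP => //= vi; rewrite h3 // h2 //; lia.
Qed.

Lemma ok_req m r s : req m r s -> ok m r -> ok m s.
Proof.
move=> [h1 h2 h3 h4] [k1 k2 k3 k4 k5 k6 k7].
have b j i i' v : i <= i' -> i' <= m -> v <= ob r j i -> mp r j i i' v <= ob r j i'.
  by move=> ii' im; case: (k3 j i i' ii' im) => + _; exact.
split.
- by move=> i i' ii' im; rewrite -!h1 //; [exact: k1 | lia].
- by move=> j i im; rewrite -h1 // -h2 //; exact: k2.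
- move=> j i i' ii' im; rewrite -!h2 //; last by lia.
  by apply: valid_ext (k3 _ _ _ _ _) => // v vi; rewrite h3.
- by move=> j i v im; rewrite -h2 // => vi; rewrite -h3 // k4.
- move=> j i i' i'' v ii' i'i'' im; rewrite -h2; last by lia.
  by move=> vi; rewrite -!h3 ?k5 //; try lia; apply: b; lia.
- move=> j i i' v ii' im yi vi; have yr : yp r i' by rewrite h1.
  have vo : v <= ob r j i by rewrite k2 //; [lia | exact: k1 yr].
  by rewrite -h3 // k6.
- by move=> j; rewrite -h4 k7 h2.
Qed.

Definition col m := {r : raw | ok m r /\ norm m r = r}.

Definition raw_of m (x : col m) : raw := proj1_sig x.
Coercion raw_of : col >-> raw.

Lemma col_ok m (x : col m) : ok m x.
Proof. by case: x => r []. Qed.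

Lemma mk_subproof m r : ok m r -> ok m (norm m r) /\ norm m (norm m r) = norm m r.
Proof.
move=> h; split; last exact/norm_eq/norm_req.
by apply: ok_req h; apply: req_sym; exact: norm_req.
Qed.

Definition mk m r (h : ok m r) : col m := exist _ (norm m r) (mk_subproof h).

Lemma mkE m r (h : ok m r) : req m (mk h) r.
Proof. exact: norm_req. Qed.

Lemma col_ext m (x y : col m) : req m x y -> x = y.
Proof.
case: x y => [r hr] [s hs] /= /norm_eq; rewrite (proj2 hr) (proj2 hs).
exact: eq_exist.
Qed.

Lemma yp_dom m (x : col m) i : yp x i -> i <= m.
Proof. by case: x => r hr; rewrite -[raw_of _]/r -(proj2 hr) => /andP []. Qed.

(** * Reindexing of chains *)

Section Pull.

Variables (m m' : nat) (r : raw) (th : nat -> nat) (p : nat -> bool).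
Hypothesis rok : ok m r.
Hypothesis th_valid : valid m' m th.
Hypothesis p_down : forall i i', i <= i' -> i' <= m' -> p i' -> p i.

Definition pull_ob (j : 'I_n) i := if p i then i else ob r j (th i).

(* A vertex v of k_i = [i] stands for the v-th object and goes to its last vertex. *)
Definition pull_lam (j : 'I_n) i v :=
  if p i then mp r j (th v) (th i) (ob r j (th v)) else v.

(** Keeping [p] independent of [th] covers two operations: if [p] is the pullback of [yp], this is
    the simplicial action; if [th] is the identity and [p] is larger, objects of Delta^n are moved
    into Y by the last vertex map, which yields the homotopy. *)
Definition pull : raw :=
  Raw p pull_ob
    (fun j i i' v => if p i' then v else mp r j (th i) (th i') (pull_lam j i v))
    (uact (fun j => pull_ob j m')
      (fun j v => mp r j (th m') m (pull_lam j m' v)) (top r)).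

Let mp_le j i i' v : i <= i' -> i' <= m -> v <= ob r j i -> mp r j i i' v <= ob r j i'.
Proof. by move=> ii' im; case: (mp_valid rok j ii' im) => + _; exact. Qed.

Let mp_mono j i i' u v : i <= i' -> i' <= m -> u <= v -> v <= ob r j i ->
  mp r j i i' u <= mp r j i i' v.
Proof. by move=> ii' im; case: (mp_valid rok j ii' im) => _; exact. Qed.

Let thm i : i <= m' -> th i <= m. Proof. by case: th_valid => + _; exact. Qed.
Let th_mono i i' : i <= i' -> i' <= m' -> th i <= th i'.
Proof. by case: th_valid => _; exact. Qed.

Lemma pull_lam_valid j i : i <= m' -> valid (pull_ob j i) (ob r j (th i)) (pull_lam j i).
Proof.
move=> im; rewrite /pull_ob /pull_lam; case: ifP => pi; last exact: valid_id.
split=> [v vi|u v uv vi].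
  by apply: mp_le => //; [exact: th_mono | exact: thm].
have thi := thm im; have thv := th_mono vi im; have thu := th_mono uv (leq_trans vi im).
rewrite -(@mp_comp m r rok j (th u) (th v)) //.
by apply: mp_mono => //; apply: mp_le => //; lia.
Qed.

(** Naturality of [pull_lam], as a transformation from the reindexed chain to the original one along
    [th]. The composition laws of reindexing reduce to it. *)
Lemma pull_lam_mp j i i' v : i <= i' -> i' <= m' -> v <= pull_ob j i ->
  mp r j (th i) (th i') (pull_lam j i v) = pull_lam j i' (mp pull j i i' v).
Proof.
move=> ii' im; rewrite /pull_ob /pull_lam /=; case: (boolP (p i')) => // pi'.
rewrite (p_down ii' im pi') => vi.
by rewrite (mp_comp rok) //; [apply: th_mono | apply: th_mono | apply: thm]; lia.
Qed.

Lemma pull_mp_valid j i i' : i <= i' -> i' <= m' ->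
  valid (pull_ob j i) (pull_ob j i') (mp pull j i i').
Proof.
move=> ii' im; rewrite /= {2}/pull_ob; case: (boolP (p i')) => pi'.
  by rewrite /pull_ob (p_down ii' im pi'); split=> [v|]; lia.
have [la lm] := pull_lam_valid j (leq_trans ii' im).
have tt := th_mono ii' im; have ti := thm im.
split=> [v vi|u v uv vi]; first by apply: mp_le => //; exact: la.
by apply: mp_mono => //; [exact: lm | exact: la].
Qed.

Lemma pull_top_valid j :
  valid (pull_ob j m') (ob r j m) (fun v => mp r j (th m') m (pull_lam j m' v)).
Proof.
apply: valid_comp (pull_lam_valid j (leqnn _)) _.
by apply: (mp_valid rok) => //; exact: thm.
Qed.

Lemma pull_ok : ok m' pull.
Proof.
split=> //.
- by move=> j i im /=; rewrite /pull_ob => ->.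
- exact: pull_mp_valid.
- move=> j i v im /=; rewrite /pull_ob /pull_lam; case: ifP => // pi vi.
  by rewrite (mp_id rok) //; exact: thm.
- move=> j i i' i'' v ii' i'i'' im vi.
  have im' := leq_trans i'i'' im.
  have lv : pull_lam j i v <= ob r j (th i).
    by case: (pull_lam_valid j (leq_trans ii' im')) => + _; exact.
  case: (boolP (p i'')) => pi'' /=.
    by rewrite pi'' (p_down i'i'' im pi'').
  rewrite (negbTE pi'') -(pull_lam_mp ii' im') // (mp_comp rok) //.
  + exact: th_mono.
  + exact: th_mono.
  + exact: thm.
- by move=> j i i' v ii' im /= ->.
Qed.

End Pull.

Lemma pull_ext m m' r s th th' (p p' : nat -> bool) :
  ok m r -> valid m' m th ->
  (forall i i', i <= i' -> i' <= m' -> p i' -> p i) ->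
  req m r s -> (forall i, i <= m' -> th i = th' i) ->
  (forall i, i <= m' -> p i = p' i) ->
  req m' (pull m m' r th p) (pull m m' s th' p').
Proof.
move=> rok tv pd rs tt pp.
have thm i : i <= m' -> th i <= m by case: tv => + _; exact.
have thmono i i' : i <= i' -> i' <= m' -> th i <= th i' by case: tv => _; exact.
have obE j i : i <= m' -> pull_ob r th p j i = pull_ob s th' p' j i.
  by move=> im; rewrite /pull_ob -pp // -tt // (ob_eq rs) //; exact: thm.
have lamE j i v : i <= m' -> v <= pull_ob r th p j i ->
    pull_lam r th p j i v = pull_lam s th' p' j i v.
  move=> im; rewrite /pull_ob /pull_lam -pp //; case: ifP => // pi vi.
  rewrite -!tt //; try lia.
  by rewrite -(ob_eq rs) ?(mp_eq rs) //; [exact: thmono | exact: thm | apply: thm; lia].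
have lle j i v : i <= m' -> v <= pull_ob r th p j i ->
    pull_lam r th p j i v <= ob r j (th i).
  by move=> im; case: (pull_lam_valid p rok tv j im) => + _; exact.
split=> //= [j i i' v ii' im vi|].
  rewrite -pp //; case: ifP => // pi'; have im' := leq_trans ii' im.
  rewrite -lamE // -!tt // (mp_eq rs) //; [exact: thmono|exact: thm|exact: lle].
rewrite (top_eq rs); apply: uact_ext => [j|j v vm|j].
- exact: obE.
- by rewrite -lamE // -tt // (mp_eq rs) //; [exact: thm | exact: lle].
- rewrite -(top_eq rs) (top_dim rok); exact: pull_top_valid.
Qed.

(** The condition relating [p] and [q] says that a vertex moved into Y by the first reindexing stays
    there in the second. *)
Lemma pull_pull m m' m'' r th et (p q : nat -> bool) :
  ok m r -> valid m' m th -> valid m'' m' et ->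
  (forall i i', i <= i' -> i' <= m' -> p i' -> p i) ->
  (forall i i', i <= i' -> i' <= m'' -> q i' -> q i) ->
  (forall i, i <= m'' -> p (et i) -> q i) ->
  req m'' (pull m' m'' (pull m m' r th p) et q)
    (pull m m'' r (fun i => th (et i)) q).
Proof.
move=> rok tv ev pd qd pq.
have thm i : i <= m' -> th i <= m by case: tv => + _; exact.
have thmono i i' : i <= i' -> i' <= m' -> th i <= th i' by case: tv => _; exact.
have etm i : i <= m'' -> et i <= m' by case: ev => + _; exact.
have etmono i i' : i <= i' -> i' <= m'' -> et i <= et i' by case: ev => _; exact.
set s := pull m m' r th p.
have sok : ok m' s by exact: pull_ok.
have lmp := pull_lam_mp rok tv pd.
have obE j i : i <= m'' ->
    pull_ob s et q j i = pull_ob r (fun i => th (et i)) q j i.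
  move=> im; rewrite /pull_ob; case: (boolP (q i)) => // qi /=.
  rewrite /pull_ob; case: (boolP (p (et i))) => // /(pq i im).
  by rewrite (negbTE qi).
have lle j i v : i <= m'' -> v <= pull_ob s et q j i ->
    pull_lam s et q j i v <= ob s j (et i).
  by move=> im; case: (pull_lam_valid q sok ev j im) => + _; exact.
(* [pull_lam] preserves last vertices, so these may be taken before or after the first
   reindexing. *)
have lastE j i : i <= m' -> pull_lam r th p j i (pull_ob r th p j i) = ob r j (th i).
  move=> im; rewrite /pull_lam /pull_ob; case: (boolP (p i)) => // pi.
  by rewrite (mp_id rok) //; exact: thm.
have lamE j i v : i <= m'' -> v <= pull_ob s et q j i ->
    pull_lam r th p j (et i) (pull_lam s et q j i v) =
    pull_lam r (fun i => th (et i)) q j i v.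
  move=> im; rewrite /pull_ob {2 3}/pull_lam; case: (boolP (q i)) => // qi vi.
    rewrite -/s -lmp; [|exact: etmono|exact: etm|by []].
    by rewrite lastE //; apply: etm; lia.
  rewrite /pull_lam; case: ifP => // /(pq i im); by rewrite (negbTE qi).
split=> // [j i i' v ii' im vi|].
  rewrite [LHS]/= [RHS]/=; case: (boolP (q i')) => // qi'.
  have -> : p (et i') = false by apply: contraNF qi'; exact: pq.
  by rewrite lamE //; lia.
rewrite /= uact_comp; last first.
- by move=> j; rewrite (top_dim rok); exact: pull_top_valid.
- move=> j; exact: (pull_top_valid q sok ev j).
apply: uact_ext => [j|j v vm|j].
- exact: obE.
- have em := etm _ (leqnn m''); have lv := lle j m'' v (leqnn _) vm.
  rewrite -/(mp s j (et m'') m' (pull_lam s et q j m'' v)) -lmp //.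
  rewrite (mp_comp rok) //; first by rewrite -lamE.
  + exact: thmono.
  + exact: thm.
  + case: (pull_lam_valid p rok tv j em) => + _; apply; exact: lv.
- rewrite (top_dim rok); exact: valid_comp (pull_top_valid q sok ev j) (pull_top_valid p rok tv j).
Qed.

End Collage.

(** * The collage as a simplicial set *)

Section CollageSset.

Variables (n : nat) (Y : mset n).

Lemma pull_self m (r : raw Y) : ok m r -> req m (pull m m r (fun i => i) (yp r)) r.
Proof.
move=> rok.
have lamE j i v : i <= m -> v <= pull_ob r (fun i => i) (yp r) j i ->
    pull_lam r (fun i => i) (yp r) j i v = v.
  move=> im; rewrite /pull_ob /pull_lam; case: (boolP (yp r i)) => // yi vi.
  have yv := yp_down rok vi im yi.
  by rewrite (ob_yp rok) // ?(mp_yp rok) //; lia.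
have obE j i : i <= m -> pull_ob r (fun i => i) (yp r) j i = ob r j i.
  by move=> im; rewrite /pull_ob; case: ifP => // /(ob_yp rok) ->.
split=> //.
- move=> j i i' v ii' im vi /=; have im' := leq_trans ii' im.
  case: ifP => yi'; last by rewrite lamE.
  rewrite (mp_yp rok) //; move: vi; rewrite [ob _ _ _]obE // (ob_yp rok) //.
  exact: (yp_down rok ii' im yi').
- apply: uact_id => [j|j v]; first by rewrite obE // (top_dim rok).
  by move=> vm; rewrite lamE // (mp_id rok) // -obE.
Qed.

Lemma colact_subproof k l (f : hom k l) (x : col Y l) :
  ok k (pull l k x (hnat f) (fun i => yp x (hnat f i))).
Proof.
apply: pull_ok => //; [exact: col_ok | exact: valid_hnat |].
by move=> i i' ii' i'k; apply: (yp_down (col_ok x)); [exact: hnat_mono | exact: hnat_le].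
Qed.

Definition colact k l (f : hom k l) (x : col Y l) : col Y k := mk (colact_subproof f x).

Lemma yp_hnat_down k l (f : hom k l) (x : col Y l) i i' : i <= i' -> i' <= k ->
  yp x (hnat f i') -> yp x (hnat f i).
Proof.
by move=> ii' i'k; apply: (yp_down (col_ok x)); [exact: hnat_mono | exact: hnat_le].
Qed.

Lemma colactE k l (f : hom k l) (x : col Y l) (r : raw Y) (th : nat -> nat)
    (p : nat -> bool) :
  req l x r -> (forall i, i <= k -> hnat f i = th i) ->
  (forall i, i <= k -> yp r (th i) = p i) -> req k (colact f x) (pull l k r th p).
Proof.
move=> xr ft pE; apply: req_trans (mkE _) _.
apply: pull_ext => // [|||i ik]; [exact: col_ok|exact: valid_hnat|exact: yp_hnat_down|].
by rewrite -pE // -ft // (yp_eq xr) // hnat_le.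
Qed.

Lemma colact_id k (x : col Y k) : colact (hid k) x = x.
Proof.
apply: col_ext; apply: req_trans (pull_self (col_ok x)).
by apply: colactE => // i ik; rewrite hnat_id.
Qed.

Lemma colact_comp k l m (g : hom l m) (f : hom k l) (x : col Y m) :
  colact (hcomp g f) x = colact f (colact g x).
Proof.
apply: col_ext; apply: req_sym.
have gE : req l (colact g x) (pull m l x (hnat g) (fun i => yp x (hnat g i))).
  exact: colactE.
apply: req_trans (colactE gE (fun _ _ => erefl) (fun _ _ => erefl)) _.
apply: req_trans (pull_pull (col_ok x) (valid_hnat g) (valid_hnat f) _ _ _) _ => //.
- exact: yp_hnat_down.
- move=> i i' ii' i'k; apply: yp_hnat_down; [exact: hnat_mono | exact: hnat_le].
- by apply: req_sym; apply: colactE => // i ik; rewrite hnat_comp.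
Qed.

Definition collage : sset := SSet colact_id colact_comp.

(** ** The retraction onto the diagonal *)

Definition rtop m (r : raw Y) : ytot Y :=
  uact (fun=> m) (fun j i => mp r j i m (ob r j i)) (top r).

Lemma rtop_valid m (r : raw Y) j : ok m r ->
  valid m (ob r j m) (fun i => mp r j i m (ob r j i)).
Proof.
move=> rok; have mv i i' : i <= i' -> i' <= m -> mp r j i i' (ob r j i) <= ob r j i'.
  by move=> ii' im; case: (mp_valid rok j ii' im) => + _; exact.
split=> [v vm|u v uv vm]; first exact: mv.
rewrite -(mp_comp rok uv) //.
by case: (mp_valid rok j vm (leqnn m)) => _; apply=> //; exact: mv.
Qed.

Lemma rtop_req m (r s : raw Y) : ok m r -> req m r s -> rtop m r = rtop m s.
Proof.
move=> rok rs; rewrite /rtop (top_eq rs); apply: uact_ext => // [j v vm|j].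
  by rewrite (mp_eq rs) // (ob_eq rs).
by rewrite -(top_eq rs) (top_dim rok); exact: rtop_valid.
Qed.

(** As [pull_lam] preserves last vertices, the last vertex map cannot see which vertices [p] moves
    into Y. *)
Lemma rtop_pull m m' (r : raw Y) th (p : nat -> bool) :
  ok m r -> valid m' m th -> (forall i i', i <= i' -> i' <= m' -> p i' -> p i) ->
  rtop m' (pull m m' r th p) = uact (fun=> m') (fun=> th) (rtop m r).
Proof.
move=> rok tv pd; have pok := pull_ok rok tv pd.
rewrite /rtop uact_comp; last first.
- by move=> j; rewrite (top_dim rok); exact: rtop_valid.
- by move=> j.
rewrite [X in uact _ _ X]/= uact_comp; last first.
- by move=> j; rewrite (top_dim rok); exact: (pull_top_valid p rok tv j).
- by move=> j; exact: (rtop_valid j pok).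
apply: uact_ext => // [j i im|j]; last first.
  rewrite (top_dim rok).
  exact: valid_comp (rtop_valid j pok) (pull_top_valid p rok tv j).
rewrite -(pull_lam_mp rok tv pd) // (mp_comp rok).
- congr (mp r j _ _ _); rewrite /pull_lam /= /pull_ob; case: (boolP (p i)) => // pi.
  by rewrite (mp_id rok) //; case: tv => + _; apply.
- by case: tv => _; apply.
- by case: tv => + _; apply.
- by [].
- by case: (pull_lam_valid p rok tv j im) => + _; apply.
Qed.

Definition last_map_fun m (x : col Y m) : diag Y m := projT2 (rtop m x).

Lemma tot_last_map m (x : col Y m) : tot (last_map_fun x) = rtop m x.
Proof. by []. Qed.

Lemma last_map_nat k l (f : hom k l) (x : col Y l) :
  last_map_fun (colact f x) = sact f (last_map_fun x).
Proof.
apply: (@existT_inj _ (msimplex Y) (fun=> k)); rewrite -[RHS]/(tot (mact (fun=> f) _)) tot_mact.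
rewrite -[LHS]/(tot (last_map_fun (colact f x))) !tot_last_map.
rewrite -(rtop_pull (p := fun i => yp x (hnat f i))); last 3 first.
- exact: col_ok.
- exact: valid_hnat.
- exact: yp_hnat_down.
by apply: rtop_req; [exact: col_ok | exact: mkE].
Qed.

Definition collage_retr : smap collage (diag Y) :=
  @SMap collage (diag Y) last_map_fun last_map_nat.

Definition emb_raw m (y : diag Y m) : raw Y :=
  Raw (fun=> true) (fun _ i => i) (fun _ _ _ v => v) (tot y).

Lemma emb_ok m (y : diag Y m) : ok m (emb_raw y).
Proof. by split=> //= j i i' ii' im; split=> //= v; lia. Qed.

Definition emb m (y : diag Y m) : col Y m := mk (emb_ok y).

Lemma emb_nat k l (f : hom k l) (y : diag Y l) : emb (sact f y) = colact f (emb y).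
Proof.
apply: col_ext; apply: req_trans (mkE _) _; apply: req_sym.
apply: req_trans (colactE (th := hnat f) (p := fun=> true) (mkE _) _ _) _ => //.
by split=> //=; exact: esym (@tot_mact _ _ (fun=> k) (fun=> l) (fun=> f) y).
Qed.

Definition diag_emb : smap (diag Y) collage := @SMap (diag Y) collage emb emb_nat.

Lemma last_map_emb m (y : diag Y m) : last_map_fun (emb y) = y.
Proof.
apply: (@existT_inj _ (msimplex Y) (fun=> m)).
rewrite -!/(tot _) tot_last_map (rtop_req (s := emb_raw y)).
- exact: uact_id.
- exact: col_ok.
- exact: mkE.
Qed.

(** Serves to identify the end of the homotopy at which every vertex lies in Y. *)
Lemma pull_full m (x : col Y m) :
  req m (pull m m x (fun i => i) (fun=> true)) (emb (last_map_fun x)).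
Proof.
apply: req_sym; apply: req_trans (mkE _) _; split=> //=.
rewrite -/(tot _) tot_last_map; apply: uact_ext => // [j i im|j].
  rewrite /pull_lam (mp_id (col_ok x)) //.
  by case: (mp_valid (col_ok x) j im (leqnn m)) => + _; apply.
by rewrite (top_dim (col_ok x)); apply: rtop_valid; exact: col_ok.
Qed.

End CollageSset.

(** ** Functoriality *)

Section CollageMap.

Variables (n : nat) (Y Y' : mset n) (g : mmap Y Y').

Definition ytot_map (z : ytot Y) : ytot Y' := existT _ (projT1 z) (g _ (projT2 z)).

Lemma uact_map d f z : ytot_map (uact d f z) = uact d f (ytot_map z).
Proof. by rewrite /ytot_map /uact /= mfun_nat. Qed.

Definition raw_map (r : raw Y) : raw Y' := Raw (yp r) (ob r) (mp r) (ytot_map (top r)).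

Lemma raw_map_ok m r : ok m r -> ok m (raw_map r).
Proof. by case. Qed.

Definition col_map m (x : col Y m) : col Y' m := mk (raw_map_ok (col_ok x)).

Lemma raw_map_req m r s : req m r s -> req m (raw_map r) (raw_map s).
Proof. by case=> h1 h2 h3 h4; split=> //=; rewrite h4. Qed.

Lemma raw_map_pull m m' r th p :
  req m' (raw_map (pull m m' r th p)) (pull m m' (raw_map r) th p).
Proof. by split=> //=; rewrite uact_map. Qed.

Lemma col_map_nat k l (f : hom k l) (x : col Y l) :
  col_map (colact f x) = colact f (col_map x).
Proof.
apply: col_ext; apply: req_trans (mkE _) _; apply: req_sym.
apply: req_trans (colactE (mkE _) (fun _ _ => erefl) (fun _ _ => erefl)) _.
apply: req_trans (req_sym (raw_map_pull _ _ _ _ _)) _.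
by apply: raw_map_req; apply: req_sym; exact: mkE.
Qed.

End CollageMap.

(** * Surjections with prescribed identifications *)

(* [rk P] is the surjection out of [0..q] identifying u and u+1 when [P u];
   [sec P q] is a section of it. *)
Fixpoint rk (P : nat -> bool) v : nat :=
  if v is u.+1 then rk P u + ~~ P u else 0.

Fixpoint sec (P : nat -> bool) q w : nat :=
  if q is u.+1 then if w <= rk P u then sec P u w else u.+1 else 0.

Definition collf u v := if v == u.+1 then u else v.

Lemma rk_mono P u v : u <= v -> rk P u <= rk P v.
Proof.
elim: v => [|v IH] /=; first by case: u.
by rewrite leq_eqVlt => /orP [/eqP ->|/IH] //=; lia.
Qed.

Lemma sec_le P q w : sec P q w <= q.
Proof. by elim: q => //= q IH; case: ifP => _; lia. Qed.

Lemma rk_sec P q w : w <= rk P q -> rk P (sec P q w) = w.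
Proof.
elim: q => [|q IH] /=; first by lia.
by case: (leqP w (rk P q)) => [/IH -> //|qw] /=; case: (P q) => /=; lia.
Qed.

Lemma sec_mono P q w w' : w <= w' -> sec P q w <= sec P q w'.
Proof.
move=> ww; elim: q => //= q IH.
case: (leqP w') => [h|h]; first by rewrite (leq_trans ww h).
by have := sec_le P q w; case: ifP; lia.
Qed.

Lemma sec_valid P q : valid (rk P q) q (sec P q).
Proof. by split=> *; [exact: sec_le | exact: sec_mono]. Qed.

Lemma rk_valid P q : valid q (rk P q) (rk P).
Proof. by split=> *; exact: rk_mono. Qed.

Lemma collf_valid u q : u < q -> valid q q (collf u).
Proof.
by move=> uq; split=> [v vq|v w vw wq]; rewrite /collf; repeat case: eqP; lia.
Qed.

Lemma rk_fact (A : Type) (P : nat -> bool) q (f : nat -> A) u v :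
  (forall w, w < q -> P w -> f w = f w.+1) -> u <= q -> v <= q ->
  rk P u = rk P v -> f u = f v.
Proof.
move=> fP; wlog uv : u v / u <= v.
  by move=> W uq vq E; case: (leqP u v) => [|/ltnW] /W H; [|symmetry]; apply: H.
move=> uq; elim: v uv => [|v IH] uv vq; first by move: uv; case: u {uq}.
move: uv; rewrite leq_eqVlt => /orP [/eqP -> //|uv] /=.
have := rk_mono P (uv : u <= v); case: (boolP (P v)) => /= pv le E; last by lia.
by rewrite IH //; [exact: fP | lia | lia].
Qed.

Lemma rk_sec_rk P q u : u <= q -> rk P (sec P q (rk P u)) = rk P u.
Proof. by move=> uq; rewrite rk_sec // rk_mono. Qed.

Lemma rk_ext (P P' : nat -> bool) q u :
  (forall w, w < q -> P w = P' w) -> u <= q -> rk P u = rk P' u.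
Proof.
move=> PP; elim: u => //= u IH uq; by rewrite IH ?PP //; lia.
Qed.

Lemma sec_ext (P P' : nat -> bool) q w :
  (forall w, w < q -> P w = P' w) -> sec P q w = sec P' q w.
Proof.
elim: q => //= q IH PP; rewrite IH ?(@rk_ext P P' q) //.
all: by move=> v vq; apply: PP; lia.
Qed.

Lemma rk_coll (P : nat -> bool) u v : P u -> rk P (collf u v) = rk P v.
Proof. by move=> Pu; rewrite /collf; case: eqP => // -> /=; rewrite Pu addn0. Qed.

Lemma rk_lt (P P' : nat -> bool) q u : (forall w, w < q -> P w -> P' w) ->
  u < q -> P' u -> ~~ P u -> rk P' q < rk P q.
Proof.
move=> PP uq Pu nPu.
have le v : v <= q -> rk P' v <= rk P v.
  elim: v => //= v IH vq; have := IH (ltnW vq); have := PP v vq.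
  by case: (P v) (P' v) => [] [] /= H; try lia; have := H isT.
elim: q uq PP {le} (le) => //= q IH uq PP le.
have := PP q (leqnn _); have := le q (leqnSn _).
move: uq; rewrite ltnS leq_eqVlt => /orP [/eqP <-|uq].
  by rewrite Pu (negbTE nPu) /=; lia.
have := IH uq (fun w wq => PP w (ltnW wq)) (fun v vq => le v (leqW vq)).
by case: (P q) (P' q) => [] [] /= H K L; try lia; have := L isT.
Qed.

(** * Kernels of the maps out of the part in Y *)

Section Kernel.

Variables (n : nat) (Y : mset n).

(** The edges are collapsed one at a time: [h t] replaces only the vertices up to t by the
    representatives of their classes. The result is the Eilenberg-Zilber quotient relative to the
    edges in [P]. *)
Lemma uact_sec_rk (P : nat -> bool) q (y : ytot Y) :
  projT1 y = (fun=> q) ->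
  (forall u, u < q -> P u -> uact (fun=> q) (fun=> collf u) y = y) ->
  uact (fun=> q) (fun=> fun v => sec P q (rk P v)) y = y.
Proof.
move=> yd H; pose h t v := if v <= t then sec P q (rk P v) else v.
(* [sec] picks the smallest vertex of each class. *)
have sr v : v <= q -> sec P q (rk P v) <= v.
  elim: q {yd H h} => [|q IH] //= vq; move: vq; rewrite leq_eqVlt => /orP [/eqP ->|vq].
    exact: (sec_le P q.+1).
  by rewrite (rk_mono P (vq : v <= q)); exact: IH.
have hv t : valid q q (h t).
  split=> [v vq|u v uv vq]; rewrite /h; case: (leqP v t) => vt //.
  - exact: sec_le.
  - by rewrite (leq_trans uv vt); apply: sec_mono; exact: rk_mono.
  - case: ifP => // _; exact: leq_trans (sr u (leq_trans uv vq)) uv.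
suff K t : t <= q -> uact (fun=> q) (fun=> h t) y = y.
  rewrite -[RHS](K q) //; apply: uact_ext => // [j v vq|j].
    by rewrite /h vq.
  rewrite yd; apply: valid_ext (hv q) => v vq; by rewrite /h vq.
elim: t => [|t IH] tq.
  apply: uact_id => [j|j v vq]; first by rewrite yd.
  rewrite /h; case: leqP => //; rewrite leqn0 => /eqP ->.
  by apply/eqP; rewrite -leqn0; exact: sr.
have := IH (ltnW tq); case: (boolP (P t)) => Pt E.
  rewrite -[RHS](H t tq Pt) -{2}E uact_comp; last 2 first.
  - by move=> j; exact: collf_valid.
  - by move=> j; rewrite yd; exact: hv.
  apply: uact_ext => // [j v vq|j]; last by rewrite yd; exact: hv.
  rewrite /h /collf; case: eqP => [->|vt]; first by rewrite !leqnn /= Pt addn0.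
  by rewrite (_ : (v <= t.+1) = (v <= t)) //; lia.
(* Where [P t] fails, t+1 opens a new class and represents itself, so this stage changes nothing. *)
rewrite -[RHS]E; apply: uact_ext => // [j v vq|j]; last by rewrite yd; exact: hv.
rewrite /h; case: (eqVneq v t.+1) => [->|vt].
  rewrite leqnn ltnn /=.
  have lt : rk P t < rk P t.+1 by rewrite /= Pt addn1.
  have := rk_sec_rk P tq; set s := sec _ _ _ => sE.
  have : s <= t.+1 by exact: sr.
  rewrite leq_eqVlt => /orP [/eqP //|st].
  by have := rk_mono P (st : s <= t); lia.
by rewrite (_ : (v <= t.+1) = (v <= t)) //; lia.
Qed.

(** A cut requires vertex 0 to lie in Y; the simplices without one are those of the nerve. *)
Definition ycut m (r : raw Y) q := q <= m /\ forall i, i <= m -> yp r i = (i <= q).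

(* The restriction of the top simplex to the vertices 0..q. *)
Definition ypart m (r : raw Y) q : ytot Y :=
  uact (fun=> q) (fun j => mp r j q m) (top r).

(* [ker r q i u]: the vertices u and u+1 of the part of [r] in Y become equal in
   k_i; for i = m+1, the simplex [ypart] is degenerate at u. *)
Definition ker m (r : raw Y) q i u : bool :=
  [&& u < q, q < i & if i <= m then [forall j, mp r j q i u == mp r j q i u.+1]
   else `[< uact (fun=> q) (fun=> collf u) (ypart m r q) = ypart m r q >]].

(** One number and one quotient map for all directions j: a good object carries no information
    beyond its kernel. *)
Definition good_pos m (r : raw Y) q i := forall j,
  ob r j i = rk (ker m r q i) q /\
  forall u, u <= q -> mp r j q i u = rk (ker m r q i) u.

Lemma ker_lt m r q i u : ker m r q i u -> u < q.
Proof. by case/and3P. Qed.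

Lemma kerE m r q i u : u < q -> q < i -> i <= m ->
  reflect (forall j, mp r j q i u = mp r j q i u.+1) (ker m r q i u).
Proof.
move=> uq qi im; rewrite /ker uq qi im /=.
by apply: (iffP forallP) => H j; apply/eqP.
Qed.

Lemma ker_endE m r q u : u < q -> q <= m ->
  ker m r q m.+1 u <-> uact (fun=> q) (fun=> collf u) (ypart m r q) = ypart m r q.
Proof.
move=> uq qm; rewrite /ker uq ltnS qm ltnn /=.
by split=> /asboolP.
Qed.

Arguments kerE {m r q i u}.
Arguments ker_endE {m r q u}.

Section Positions.

Variables (m : nat) (r : raw Y) (q : nat).
Hypothesis rok : ok m r.
Hypothesis rq : ycut m r q.

Let qm : q <= m. Proof. by case: rq. Qed.
Let ypE i : i <= m -> yp r i = (i <= q). Proof. by case: rq => _; exact. Qed.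

Lemma ob_low j i : i <= q -> ob r j i = i.
Proof. by move=> iq; apply: (ob_yp rok); [|rewrite ypE]; lia. Qed.

Lemma mp_low j i i' v : i <= i' -> i' <= q -> v <= i -> mp r j i i' v = v.
Proof. by move=> ii' iq vi; apply: (mp_yp rok) => //; [|rewrite ypE]; lia. Qed.

Lemma mp_lowq j i i' v : i <= q -> q <= i' -> i' <= m -> v <= i ->
  mp r j i i' v = mp r j q i' v.
Proof.
move=> iq qi' im vi; have vo : v <= ob r j i by rewrite ob_low.
by rewrite -(@mp_comp _ _ _ _ rok j i q i') // (mp_low j iq (leqnn q) vi).
Qed.

Lemma mp_le j i i' v : i <= i' -> i' <= m -> v <= ob r j i -> mp r j i i' v <= ob r j i'.
Proof. by move=> ii' im; case: (mp_valid rok j ii' im) => + _; exact. Qed.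

Lemma mp_mono j i i' u v : i <= i' -> i' <= m -> u <= v -> v <= ob r j i ->
  mp r j i i' u <= mp r j i i' v.
Proof. by move=> ii' im; case: (mp_valid rok j ii' im) => _; exact. Qed.

Lemma ypart_valid j : valid q (projT1 (top r) j) (mp r j q m).
Proof. by rewrite (top_dim rok); have := mp_valid rok j qm (leqnn m); rewrite ob_low. Qed.

Lemma ker_mp i u v j : q < i -> i <= m -> u <= q -> v <= q ->
  rk (ker m r q i) u = rk (ker m r q i) v -> mp r j q i u = mp r j q i v.
Proof.
move=> qi im; apply: rk_fact => w wq; move/(kerE wq qi im); exact.
Qed.

(** Each map out of [q] factors through the earlier ones, and [ypart] is a restriction along each of
    them. This is why the degeneracies of [ypart] can act as a last kernel, at position m+1. *)
Lemma ker_incl i i' u : i <= i' -> i' <= m.+1 -> ker m r q i u -> ker m r q i' u.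
Proof.
move=> ii' im kiu; have uq := ker_lt kiu.
have qi : q < i by case/and3P: kiu.
have qi' : q < i' by lia.
case: (leqP i m) => im'; last by have -> : i' = i by lia.
move/(kerE uq qi im'): kiu => kiu.
have [i'm|i'm] : i' <= m \/ i' = m.+1 by lia.
  apply/(kerE uq qi' i'm) => j.
  have [q1 q2] : q <= i /\ u.+1 <= ob r j q by rewrite ob_low //; lia.
  by rewrite -!(@mp_comp _ _ _ _ rok j q i i') ?kiu // ltnW.
rewrite i'm; apply/ker_endE => //; rewrite /ypart uact_comp.
- apply: uact_ext => // [j v vq|j].
    rewrite /collf; case: eqP => // ->.
    have [q1 q2] : q <= i /\ u.+1 <= ob r j q by rewrite ob_low //; lia.
    by rewrite -!(@mp_comp _ _ _ _ rok j q i m) ?kiu // ltnW.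
  exact: valid_comp (collf_valid uq) (ypart_valid j).
- by move=> j; exact: collf_valid.
- exact: ypart_valid.
Qed.

Lemma ker_refine i i' u v : i <= i' -> i' <= m.+1 -> u <= q -> v <= q ->
  rk (ker m r q i) u = rk (ker m r q i) v -> rk (ker m r q i') u = rk (ker m r q i') v.
Proof.
move=> ii' im; apply: rk_fact => w wq /(ker_incl ii' im) kw /=.
by rewrite kw addn0.
Qed.

End Positions.

End Kernel.

Arguments kerE {n Y m r q i u}.
Arguments ker_endE {n Y m r q u}.

(** * Degenerate simplices of the collage *)

Section Degeneracy.

Variables (n : nat) (Y : mset n).

Lemma coll_req m i (x : col Y m) q : ycut m x q -> i < m -> (i < q) || (q < i) ->
  req m (colact (coll m i) x) (pull m m x (collf i) (fun k => k <= q)).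
Proof.
move=> [qm xq] im iq; apply: colactE => // k km; first by rewrite hnat_coll.
by rewrite /collf; case: eqP => [->|_]; rewrite xq; lia.
Qed.

Lemma lam_low m (x : col Y m) q th j i v : ycut m x q -> i <= q -> v <= i ->
  (forall u, u <= i -> th u <= th i) -> th i <= q ->
  pull_lam x th (fun k => k <= q) j i v = th v.
Proof.
move=> xq iq vi tm tq; rewrite /pull_lam iq.
have tv := tm v vi.
by rewrite (ob_low (col_ok x) xq) ?(mp_low (col_ok x) xq) //; lia.
Qed.

(** By [ker_incl] an edge collapsed at position q+1 is collapsed at every later position and in the
    top simplex, so nothing in [x] distinguishes u from u+1. *)
Lemma ker_degen m (x : col Y m) q u : ycut m x q -> ker m x q q.+1 u ->
  x = colact (coll m u) x.
Proof.
move=> xq ku; have uq := ker_lt ku; have xok := col_ok x; have qm := proj1 xq.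
apply: col_ext; apply: req_sym; apply: req_trans (coll_req xq _ _) _; try lia.
have th i : q < i -> collf u i = i by rewrite /collf; case: eqP; lia.
have tle i v : v <= i -> i <= m -> collf u v <= collf u i.
  by move=> vi im; rewrite /collf; repeat case: eqP; lia.
have thq i : i <= q -> collf u i <= q by rewrite /collf; case: eqP; lia.
have lam j i v : i <= q -> v <= i ->
    pull_lam x (collf u) (fun k => k <= q) j i v = collf u v.
  move=> iq vi; apply: lam_low => // [w wi|]; last exact: thq.
  by apply: tle; lia.
have lamr j i v : q < i -> pull_lam x (collf u) (fun k => k <= q) j i v = v.
  by move=> qi; rewrite /pull_lam /= leqNgt qi.
have fact j i v : q < i -> i <= m -> v <= q -> mp x j q i (collf u v) = mp x j q i v.
  move=> qi im vq; apply: (@ker_mp _ _ m x q) => //; first exact: thq.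
  by apply: rk_coll; exact: (ker_incl xok xq qi (leqW im) ku).
split=> //= [i im|j i im|j i i' v ii' im|].
- by case: xq => _ /(_ i im).
- rewrite /pull_ob; case: leqP => iq; first by rewrite (ob_low xok xq).
  by rewrite th.
- rewrite /pull_ob; case: (leqP i' q) => i'q; case: (leqP i q) => iq vi; try lia.
  + by rewrite (mp_low xok xq).
  + have b : collf u v <= collf u i by apply: tle => //; lia.
    rewrite lam // (th i') // (mp_lowq xok xq j (thq i iq) (ltnW i'q) im b).
    by rewrite fact ?(mp_lowq xok xq j iq (ltnW i'q) im vi) //; lia.
  + by rewrite lamr // !th // -(th i).
- case: (leqP m q) => mq.
    have mE : q = m by lia.
    subst q; have E1 : ypart m x m = top x.
      apply: uact_id => [j|j v vm]; first by rewrite (top_dim xok) (ob_low xok xq).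
      by rewrite (mp_low xok xq).
    move/(ker_endE uq (leqnn m)): ku; rewrite E1 => E; rewrite -[RHS]E.
    have tv : valid m m (collf u) by exact: collf_valid.
    apply: uact_ext => [j|j v|j].
    + by rewrite /pull_ob leqnn.
    + rewrite /pull_ob leqnn => vm; rewrite lam // (mp_low xok xq) //.
      * exact: thq.
      * exact: tle.
    + by rewrite (top_dim xok); exact: (pull_top_valid _ xok tv j).
  apply: uact_id => [j|j v].
    by rewrite /pull_ob /= leqNgt mq /= th // (top_dim xok).
  rewrite /pull_ob /= (leqNgt m) mq /= th // => vm; rewrite lamr //.
  by rewrite (mp_id xok).
Qed.

Definition id_step (r : raw Y) i := forall j,
  ob r j i = ob r j i.+1 /\ forall v, v <= ob r j i -> mp r j i i.+1 v = v.

Lemma id_degen m (x : col Y m) q i : ycut m x q -> q < i -> i < m -> id_step x i ->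
  x = colact (coll m i) x.
Proof.
move=> xq qi im st; have xok := col_ok x; have qm := proj1 xq.
apply: col_ext; apply: req_sym; apply: req_trans (coll_req xq _ _) _; try lia.
have th k : k <= q -> collf i k = k by rewrite /collf; case: eqP; lia.
have obE j k : ob x j (collf i k) = ob x j k.
  by rewrite /collf; case: eqP => // ->; case: (st j).
have lam j k v : k <= q -> v <= k ->
    pull_lam x (collf i) (fun k => k <= q) j k v = v.
  move=> kq vk; rewrite (@lam_low _ x q) // ?th //; try lia.
  by move=> u uk; rewrite !th //; lia.
have lamr j k v : q < k -> pull_lam x (collf i) (fun k => k <= q) j k v = v.
  by move=> qk; rewrite /pull_lam /= leqNgt qk.
have target j k k' v : k <= k' -> k <= i -> k' <= m -> v <= ob x j k ->
    mp x j k (collf i k') v = mp x j k k' v.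
  rewrite {1}/collf; case: eqP => // -> _ ki _ vk.
  rewrite -(@mp_comp _ _ _ _ xok j k i i.+1) //.
  by case: (st j) => _ -> //; apply: (mp_le xok) => //; lia.
split=> //= [k km|j k km|j k k' v kk' km|].
- by case: xq => _ /(_ k km).
- rewrite /pull_ob; case: leqP => kq; first by rewrite (ob_low xok xq).
  exact: obE.
- rewrite /pull_ob; case: (leqP k' q) => k'q; case: (leqP k q) => kq; rewrite ?obE => vk; try lia.
  + by rewrite (mp_low xok xq).
  + rewrite lam // (th k) // target //; try lia.
    by rewrite (ob_low xok xq).
  + rewrite lamr //; case: (eqVneq k i.+1) => [kE|ki].
      subst k; have -> : collf i i.+1 = i by rewrite /collf eqxx.
      have vi : v <= ob x j i by case: (st j) => ->.
      have sv : mp x j i i.+1 v = v by case: (st j) => _ ->.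
      have [k'E|k'E] : k' = i.+1 \/ i.+1 < k' by lia.
        by subst k'; rewrite /collf eqxx !(mp_id xok) //; lia.
      have -> : collf i k' = k' by rewrite /collf; case: eqP; lia.
      by rewrite -(@mp_comp _ _ _ _ xok j i i.+1 k') ?sv //; lia.
    have kE : collf i k = k by rewrite /collf (negbTE ki).
    rewrite kE; have [ki'|ki'] : k <= i \/ i.+1 < k by move/eqP: ki; lia.
      exact: target.
    by rewrite (_ : collf i k' = k') // /collf; case: eqP; lia.
- have lE j v : v <= pull_ob x (collf i) (fun k => k <= q) j m ->
      pull_lam x (collf i) (fun k => k <= q) j m v = v.
    by move=> vm; apply: lamr; lia.
  apply: uact_id => [j|j v vm].
    by rewrite /pull_ob /= leqNgt (leq_trans qi (ltnW im)) /= obE (top_dim xok).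
  have vo : v <= ob x j m.
    by move: vm; rewrite /pull_ob /= (leqNgt m) (leq_trans qi (ltnW im)) /= obE.
  rewrite lE //; rewrite /collf; case: eqP => [mE|_]; last by rewrite (mp_id xok).
  have H k : k = i.+1 -> v <= ob x j k -> mp x j i k v = v.
    by move=> ->; case: (st j) => <- H /H.
  exact: H mE vo.
Qed.

(** Converse to [ker_degen] and [id_degen]. The value i = q is impossible, since q lies in Y and q+1
    does not; on either side of the cut, the components of the equation give the two
    alternatives. *)
Lemma degenP m (x : col Y m) q i : ycut m x q -> i < m -> x = colact (coll m i) x ->
  (i < q /\ ker m x q q.+1 i) \/ (q < i /\ id_step x i).
Proof.
move=> xq im xE; have xok := col_ok x; have [qm ypE] := xq.
have req0 : req m x (pull m m x (collf i) (fun k => yp x (collf i k))).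
  by rewrite {1}xE; apply: colactE => // k km; rewrite hnat_coll.
have [iq|iq] : i = q \/ ((i < q) || (q < i)) by lia.
  have := yp_eq req0 im; rewrite /= /collf eqxx !ypE; lia.
have rE : req m x (pull m m x (collf i) (fun k => k <= q)).
  by rewrite {1}xE; exact: coll_req.
case/orP: iq => iq; [left|right]; split=> //; last first.
  move=> j; have io : i <= m by lia.
  have oE : ob x j i = ob x j i.+1.
    by rewrite (ob_eq rE j im) /= /pull_ob /= leqNgt ltnS (ltnW iq) /= /collf eqxx.
  split=> // v vi; rewrite (mp_eq rE) //= leqNgt ltnS (ltnW iq) /=.
  rewrite /pull_lam /= leqNgt iq /= /collf eqxx (_ : (i == i.+1) = false).
    by rewrite (mp_id xok).
  by apply/eqP; lia.
have tle k v : v <= k -> k <= m -> collf i v <= collf i k.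
  by move=> vk km; rewrite /collf; repeat case: eqP; lia.
have thq k : k <= q -> collf i k <= q by rewrite /collf; case: eqP; lia.
have lam j k v : k <= q -> v <= k ->
    pull_lam x (collf i) (fun k => k <= q) j k v = collf i v.
  move=> kq vk; apply: lam_low => // [w wk|]; last exact: thq.
  by apply: tle; lia.
have [qm'|qE] : q < m \/ q = m by lia.
  apply/(kerE iq (ltnSn q) qm') => j.
  have H v : v <= q -> mp x j q q.+1 v = mp x j q q.+1 (collf i v).
    move=> vq; rewrite {1}(mp_eq rE) //=; last by rewrite (ob_low xok xq).
    rewrite ltnn lam // (_ : collf i q.+1 = q.+1); last first.
      by rewrite /collf; case: eqP; lia.
    by rewrite (@mp_lowq _ _ _ _ _ xok xq) //; [exact: thq | exact: tle].
  by rewrite (H i.+1) // /collf eqxx.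
subst q; apply/ker_endE => //.
have E1 : ypart m x m = top x.
  apply: uact_id => [j|j v vm]; first by rewrite (top_dim xok) (ob_low xok xq).
  by rewrite (mp_low xok xq).
have tv : valid m m (collf i) by exact: collf_valid.
rewrite E1 [in RHS](top_eq rE) /=; symmetry; apply: uact_ext => [j|j v|j].
- by rewrite /pull_ob leqnn.
- by rewrite /pull_ob leqnn => vm; rewrite lam // (mp_low xok xq) //; [exact: thq | exact: tle].
- by rewrite (top_dim xok); exact: (pull_top_valid _ xok tv j).
Qed.

Lemma nondeg_ker m (x : col Y m) q u : @nondeg (collage Y) m x -> ycut m x q ->
  ~~ ker m x q q.+1 u.
Proof.
move=> nx xq; apply/negP => ku; have uq := ker_lt ku; have qm := proj1 xq.
by apply: (nx u _ (ker_degen xq ku)); lia.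
Qed.

Lemma nondeg_step m (x : col Y m) q i : @nondeg (collage Y) m x -> ycut m x q ->
  q < i -> i < m -> ~ id_step x i.
Proof. by move=> nx xq qi im st; exact: (nx i im (id_degen xq qi im st)). Qed.

(** The two kernels agree by [ker_incl], and [q] maps onto a good object; hence the transition map
    is known on all elements, through the section, and is the identity. *)
Lemma good_step m (x : col Y m) q i : ycut m x q -> q < i -> i < m ->
  good_pos m x q i -> good_pos m x q i.+1 ->
  (forall u, u < q -> ker m x q i.+1 u -> ker m x q i u) -> id_step x i.
Proof.
move=> xq qi im gi gi' kk j; have xok := col_ok x.
have kE u : u < q -> ker m x q i.+1 u = ker m x q i u.
  move=> uq; apply/idP/idP => [/(kk u uq)//|]; apply: (ker_incl xok xq); lia.
have [o1 m1] := gi j; have [o2 m2] := gi' j.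
have oE : ob x j i = ob x j i.+1 by rewrite o1 o2; apply: (@rk_ext _ _ q) => // w /kE.
split=> // v; rewrite o1 => vi.
set P := ker m x q i in m1 vi.
have sq := sec_le P q v.
have sv : mp x j q i (sec P q v) = v by rewrite m1 // rk_sec.
have so : sec P q v <= ob x j q by rewrite (ob_low xok xq).
rewrite -{1}sv (@mp_comp _ _ _ _ xok j q i i.+1) //; try lia.
by rewrite m2 // (@rk_ext _ P q) ?rk_sec // => w /kE.
Qed.

End Degeneracy.

(** * Faces that delete an object of Delta^n *)

Section Faces.

Variables (n : nat) (Y : mset n).

Section Face.

Variables (m : nat) (t : col Y m.+1) (q j0 : nat).
Hypothesis tq : ycut m.+1 t q.
Hypothesis qj : q < j0.
Hypothesis jm : j0 <= m.+1.

Let s := colact (face m j0) t.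
Let tok : ok m.+1 t := col_ok t.

Lemma face_cut : ycut m s q.
Proof.
have [qm ypE] := tq; split=> [|i im]; first by lia.
rewrite (yp_eq (mkE _)) //= hnat_face // ypE; rewrite /bump; lia.
Qed.

Let sq := face_cut.

Lemma face_pull : req m s (pull m.+1 m t (bump j0) (fun i => i <= q)).
Proof.
apply: colactE => // i im; first exact: hnat_face.
by rewrite (proj2 tq); rewrite /bump; lia.
Qed.

Let bump_low i : i <= q -> bump j0 i = i. Proof. by rewrite /bump; lia. Qed.

Let lamE j i v : i <= m -> v <= pull_ob t (bump j0) (fun i => i <= q) j i ->
  pull_lam t (bump j0) (fun i => i <= q) j i v = v.
Proof.
move=> im; rewrite /pull_ob; case: (leqP i q) => [iq vi|qi _].
  have tm u : u <= i -> bump j0 u <= bump j0 i by move=> ui; rewrite !bump_low; lia.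
  by rewrite (lam_low j tq iq vi tm) bump_low //; lia.
by rewrite /pull_lam /= leqNgt qi.
Qed.

Let obE j i : pull_ob t (bump j0) (fun i => i <= q) j i = ob t j (bump j0 i).
Proof.
by rewrite /pull_ob /=; case: leqP => // iq; rewrite bump_low // (ob_low tok tq).
Qed.

Lemma face_ob j i : i <= m -> ob s j i = ob t j (bump j0 i).
Proof. by move=> im; rewrite (ob_eq face_pull) // -obE. Qed.

Lemma face_mp j i i' v : i <= i' -> i' <= m -> v <= ob s j i ->
  mp s j i i' v = mp t j (bump j0 i) (bump j0 i') v.
Proof.
move=> ii' im vi; rewrite (mp_eq face_pull) //=; move: vi; rewrite face_ob; last by lia.
move=> vi; case: leqP => i'q; last by rewrite lamE // ?obE //; lia.
rewrite !bump_low ?(mp_low tok tq) //; try lia.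
by move: vi; rewrite bump_low ?(ob_low tok tq) //; lia.
Qed.

Lemma face_top : top s =
  uact (fun j => ob t j (bump j0 m)) (fun j => mp t j (bump j0 m) m.+1) (top t).
Proof.
rewrite (top_eq face_pull) /=; apply: uact_ext => [j|j v vm|j].
- exact: obE.
- by rewrite lamE.
- rewrite (top_dim tok); apply: pull_top_valid => //.
  by split=> [v vm|u v uv vm]; rewrite /bump; lia.
Qed.

Lemma face_top_lt : j0 <= m -> top s = top t.
Proof.
move=> jm'; have E : bump j0 m = m.+1 by rewrite /bump; lia.
rewrite face_top E; apply: uact_id => [j|j v vm]; first exact: top_dim.
by rewrite (mp_id tok).
Qed.

Lemma face_ypart : ypart m s q = ypart m.+1 t q.
Proof.
have qm := proj1 sq; have bq := bump_low (leqnn q).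
have bm : bump j0 m <= m.+1 by rewrite /bump; lia.
have qb : q <= bump j0 m by rewrite /bump; lia.
rewrite /ypart face_top uact_comp.
- apply: uact_ext => // [j v vq|j].
    have vo : v <= ob t j q by rewrite (ob_low tok tq).
    rewrite face_mp ?(face_ob j qm) ?bq // (mp_comp tok) //.
  apply: valid_ext (ypart_valid tok tq j) => v vq.
  have vo : v <= ob t j q by rewrite (ob_low tok tq).
  by rewrite face_mp ?(face_ob j qm) ?bq // (mp_comp tok).
- move=> j; have := mp_valid (col_ok s) j qm (leqnn m).
  by rewrite (ob_low (col_ok s) sq) // face_ob.
- by move=> j; rewrite (top_dim tok); apply: (mp_valid tok).
Qed.

(** The shift applies at the end too, m+1 going to m+2, because deleting an object does not affect
    [ypart]. *)
Lemma face_ker i u : q < i -> i <= m.+1 ->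
  ker m s q i u = ker m.+1 t q (bump j0 i) u.
Proof.
move=> qi im; have [uq|uq] := ltnP u q; last by rewrite /ker !ltnNge uq.
have qm := proj1 sq; have bq := bump_low (leqnn q).
have [im'|im'] : i <= m \/ i = m.+1 by lia.
  have bi : bump j0 i <= m.+1 by rewrite /bump; lia.
  have qb : q < bump j0 i by rewrite /bump; lia.
  have E j v : v <= q -> mp s j q i v = mp t j q (bump j0 i) v.
    move=> vq; rewrite face_mp ?bq //; first by lia.
    by rewrite (ob_low (col_ok s) sq).
  apply/(kerE uq qi im')/(kerE uq qb bi) => H j; have := H j; rewrite !E //; lia.
have -> : bump j0 i = m.+2 by rewrite /bump; lia.
rewrite im'; have h1 := @ker_endE _ _ m s q u uq qm.
have h2 := @ker_endE _ _ m.+1 t q u uq (proj1 tq).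
by rewrite face_ypart in h1; apply/idP/idP => [/h1/h2|/h2/h1].
Qed.

Lemma face_good i : q < i -> i <= m ->
  good_pos m s q i <-> good_pos m.+1 t q (bump j0 i).
Proof.
move=> qi im; have bq := bump_low (leqnn q).
have E j v : v <= q -> mp s j q i v = mp t j q (bump j0 i) v.
  move=> vq; rewrite face_mp ?bq //; first by lia.
  by rewrite (ob_low (col_ok s) sq).
have K v : v <= q -> rk (ker m s q i) v = rk (ker m.+1 t q (bump j0 i)) v.
  by apply: rk_ext => w wq; rewrite face_ker //; lia.
split=> g j; have [g1 g2] := g j.
  split=> [|u uq]; first by rewrite -face_ob // g1 K.
  by rewrite -E // g2 // K.
split=> [|u uq]; first by rewrite face_ob // g1 K.
by rewrite E // g2 // K.
Qed.

End Face.

(** * The matching *)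

Variable Y0 : ytot Y -> Prop.
Hypothesis Y0_act : forall d f z, Y0 z -> Y0 (uact d f z).

(** Equal kernels at e and e+1 say that object e is the image of [q] in what follows, hence
    recoverable after deletion. Nondegeneracy then makes e the last position of the run of good
    ones. [Y0] marks the top simplices over which the map is already given. *)
Definition matched_at m (t : col Y m) q e : Prop :=
  [/\ ycut m t q, q < e & e <= m] /\
  [/\ (forall i, q < i -> i <= e -> good_pos m t q i),
      (forall u, ker m t q e.+1 u = ker m t q e u),
      ~ Y0 (top t) & @nondeg (collage Y) m t].

Definition matched m (t : col Y m) e : Prop := exists q, matched_at t q e.

Lemma ycut_inj m (r : raw Y) q q' : ycut m r q -> ycut m r q' -> q = q'.
Proof.
move=> [qm h] [qm' h']; apply/anti_leq/andP.
by rewrite -h' // h // leqnn -h // h' // leqnn.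
Qed.

Section Matched.

Variables (m : nat) (t : col Y m.+1) (q e : nat).
Hypothesis te : matched_at t q e.

Let s := colact (face m e) t.
Let tq : ycut m.+1 t q. Proof. by case: te => [[]]. Qed.
Let qe : q < e. Proof. by case: te => [[]]. Qed.
Let em : e <= m.+1. Proof. by case: te => [[]]. Qed.
Let tgood i : q < i -> i <= e -> good_pos m.+1 t q i.
Proof. by case: te => _ [H _ _ _]; exact: H. Qed.
Let tker u : ker m.+1 t q e.+1 u = ker m.+1 t q e u.
Proof. by case: te => _ [_ H _ _]; exact: H. Qed.
Let tnd : @nondeg (collage Y) m.+1 t. Proof. by case: te => _ []. Qed.
Let tnew : ~ Y0 (top t). Proof. by case: te => _ []. Qed.
Let tok : ok m.+1 t := col_ok t.
Let sq : ycut m s q := face_cut tq qe em.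

Lemma matched_ker_neq i : q < i -> i < e ->
  ~ forall u, u < q -> ker m.+1 t q i.+1 u -> ker m.+1 t q i u.
Proof.
move=> qi ie K; apply: (nondeg_step tnd tq qi); first by lia.
by apply: good_step K => //; [lia | apply: tgood; lia | apply: tgood; lia].
Qed.

Lemma matched_face_good i : q < i -> i < e -> good_pos m s q i.
Proof.
move=> qi ie; have im : i <= m by lia.
apply: (proj2 (face_good tq qe em qi im)).
by rewrite /bump leqNgt ie; apply: tgood; lia.
Qed.

Lemma matched_not_good : e <= m -> ~ good_pos m s q e.
Proof.
move=> em' /(proj1 (face_good tq qe em qe em')); rewrite /bump leqnn => g.
apply: (nondeg_step tnd tq qe) => //.
by apply: good_step g _ => //; [exact: tgood | move=> u _; rewrite tker].
Qed.

Lemma matched_face_ker i u : q < i -> i <= m.+1 ->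
  ker m s q i u = if i < e then ker m.+1 t q i u else ker m.+1 t q i.+1 u.
Proof.
by move=> qi im; rewrite (face_ker tq qe em) // /bump; case: ltnP.
Qed.

(** At the last position the map from [q] is the same split surjection in every direction, so its
    section recovers the top simplex from the part in Y. *)
Lemma matched_top_eq : e = m.+1 ->
  uact (fun=> rk (ker m.+1 t q e) q) (fun _ => sec (ker m.+1 t q e) q)
    (ypart m.+1 t q) = top t.
Proof.
move=> eE; have gk j k : k = e -> ob t j k = rk (ker m.+1 t q e) q /\
    forall u, u <= q -> mp t j q k u = rk (ker m.+1 t q e) u.
  by move=> ->; exact: (tgood qe (leqnn e) j).
have ge j := proj1 (gk j _ (esym eE)); have gm j := proj2 (gk j _ (esym eE)).
rewrite uact_comp; last 2 first.
- by move=> j; exact: sec_valid.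
- by move=> j; exact: ypart_valid.
apply: uact_id => [j|j v vr]; first by rewrite (top_dim tok) ge.
by rewrite gm ?rk_sec // sec_le.
Qed.

Lemma matched_top : Y0 (top s) -> False.
Proof.
case: (leqP e m) => em'; first by rewrite /s (face_top_lt tq qe em em').
move=> Ys; apply: tnew; rewrite -matched_top_eq; last by lia.
by apply: (Y0_act); rewrite -(face_ypart tq qe em); exact: Y0_act.
Qed.

Lemma matched_face_nondeg : @nondeg (collage Y) m s.
Proof.
move=> i im sE; case: (degenP sq im sE) => [[iq ki]|[qi st]].
  move: ki; rewrite matched_face_ker //; last by have := proj1 sq; lia.
  case: ltnP => eq; first by move/negP: (nondeg_ker i tnd tq).
  have eE : e = q.+1 by lia.
  by rewrite -eE tker eE; move/negP: (nondeg_ker i tnd tq).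
have fo j k : k <= m -> ob s j k = ob t j (bump e k) by move=> km; apply: face_ob tq _ _ _ _ km.
have fm j : forall v, v <= ob s j i -> mp s j i i.+1 v = mp t j (bump e i) (bump e i.+1) v.
  by move=> v vi; apply: face_mp tq _ _ _ _ _ _ _ _ _ => //.
have [ie|ie] : i.+1 < e \/ e <= i.+1 by lia.
  have E k : k < e -> bump e k = k by rewrite /bump; lia.
  apply: (nondeg_step tnd tq qi); first by lia.
  move=> j; have [o1 o2] := st j; move: o1 o2 (fm j); rewrite !fo ?E //; try lia.
  by move=> o1 o2 f; split=> // v vi; rewrite -f // o2.
have [ie'|ie'] : e <= i \/ e = i.+1 by lia.
  have E k : e <= k -> bump e k = k.+1 by rewrite /bump; lia.
  apply: (@nondeg_step _ _ _ _ _ i.+1 tnd tq); [by lia..|].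
  move=> j; have [o1 o2] := st j; move: o1 o2 (fm j); rewrite !fo ?E //; try lia.
  by move=> o1 o2 f; split=> // v vi; rewrite -f // o2.
have em' : e <= m by lia.
(* What remains is an identity across the gap left by the deletion. As position i is good, position
   e of the face would be good as well. *)
have gi : good_pos m s q i by apply: matched_face_good; lia.
apply: matched_not_good => // j; have [o1 o2] := st j; have [g1 g2] := gi j.
have mE u : u <= q -> mp s j q e u = mp s j q i u.
  move=> uq; have uo : u <= ob s j q by rewrite (ob_low (col_ok s) sq).
  rewrite -(@mp_comp _ _ _ _ (col_ok s) j q i e) //; try lia.
  by rewrite ie' o2 //; apply: (mp_le (col_ok s)); lia.
have K v : v <= q -> rk (ker m s q e) v = rk (ker m s q i) v.
  apply: rk_ext => w wq; apply/(kerE wq qe em')/(kerE wq qi (ltnW im)) => H j'.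
    have [o1' o2'] := st j'.
    have mE' u : u <= q -> mp s j' q e u = mp s j' q i u.
      move=> uq; have uo : u <= ob s j' q by rewrite (ob_low (col_ok s) sq).
      rewrite -(@mp_comp _ _ _ _ (col_ok s) j' q i e) //; try lia.
      by rewrite ie' o2' //; apply: (mp_le (col_ok s)); lia.
    by rewrite -!mE' //; lia.
  have [o1' o2'] := st j'.
  have mE' u : u <= q -> mp s j' q e u = mp s j' q i u.
    move=> uq; have uo : u <= ob s j' q by rewrite (ob_low (col_ok s) sq).
    rewrite -(@mp_comp _ _ _ _ (col_ok s) j' q i e) //; try lia.
    by rewrite ie' o2' //; apply: (mp_le (col_ok s)); lia.
  by rewrite !mE' //; lia.
split=> [|u uq]; first by rewrite ie' -o1 g1 -K // ie'.
by rewrite mE // g2 // K.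
Qed.

End Matched.

(** If e <= e', position e of the face would have to be good. If e' < e, the kernels of [t] at e'
    and e'+1 would agree, although they grow strictly up to e. *)
Lemma matched_face_neq m (t : col Y m.+1) e e' :
  matched t e -> ~ matched (colact (face m e) t) e'.
Proof.
move=> [q te] [q' se]; set s := colact _ _ in se.
have [[tq qe em] _] := te; have [[sq' qe' em'] [gs ks _ _]] := se.
have sq : ycut m s q := face_cut tq qe em.
have qq := ycut_inj sq sq'; subst q'.
have [ee|ee] := leqP e e'.
  by apply: (matched_not_good te); [lia | exact: gs].
apply: (matched_ker_neq te qe' ee) => u uq ku.
have := ks u; rewrite !(matched_face_ker te) //; try lia.
rewrite ee; case: ltnP => [_|ee'].
  by rewrite ku => <-.
have eE : e'.+1 = e by lia.
rewrite eE; have [_ [_ tk _ _]] := te.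
by rewrite tk -eE ku => <-.
Qed.

End Faces.

(** * Insertion of the image of [q] *)

Section Insertion.

Variables (n : nat) (Y : mset n).

Definition lift_pos m (r : raw Y) q i v := if i <= q then v else sec (ker m r q i) q v.

(* Insertion at position [e], after good positions, of the image of the vertices
   of Y in the next object. *)
Definition ins m (r : raw Y) q e : raw Y :=
  let P := ker m r q e in
  Raw (fun i => i <= q)
    (fun j i => if i < e then ob r j i else if i == e then rk P q else ob r j i.-1)
    (fun j i i' v =>
       if i' < e then mp r j i i' v
       else if i' == e then if i < e then rk P (lift_pos m r q i v) else v
       else if i < e then mp r j i i'.-1 v
       else if i == e then mp r j q i'.-1 (sec P q v) else mp r j i.-1 i'.-1 v)
    (if e <= m then top r else uact (fun=> rk P q) (fun=> sec P q) (ypart m r q)).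

Section Ins.

Variables (m : nat) (r : raw Y) (q e : nat).
Hypothesis rok : ok m r.
Hypothesis rq : ycut m r q.
Hypothesis qe : q < e.
Hypothesis em : e <= m.+1.
Hypothesis rgood : forall i, q < i -> i < e -> good_pos m r q i.

Let P := ker m r q e.
Let sc := lift_pos m r q.
Let qm : q <= m. Proof. by case: rq. Qed.

Lemma lift_valid j i : i < e -> valid (ob r j i) q (sc i).
Proof.
move=> ie; rewrite /sc /lift_pos; case: (leqP i q) => iq.
  by rewrite (ob_low rok rq) //; split=> // v; lia.
by case: (rgood iq ie j) => -> _; exact: sec_valid.
Qed.

Lemma lift_le j i v : i < e -> v <= ob r j i -> sc i v <= q.
Proof. by move=> ie; case: (lift_valid j ie) => + _; exact. Qed.

Lemma lift_mp j i i' v : i < e -> i <= i' -> q <= i' -> i' <= m -> v <= ob r j i ->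
  mp r j q i' (sc i v) = mp r j i i' v.
Proof.
move=> ie ii' qi' im; rewrite /sc /lift_pos; case: (leqP i q) => iq vi.
  by rewrite (mp_lowq rok rq j iq) //; rewrite -(ob_low rok rq j iq).
have [o1 m1] := rgood iq ie j; rewrite o1 in vi.
have so : sec (ker m r q i) q v <= ob r j q by rewrite (ob_low rok rq) // sec_le.
rewrite -(@mp_comp _ _ _ _ rok j q i i') //; last by lia.
by rewrite m1 ?sec_le // rk_sec.
Qed.

(** The lifts chosen by [sec] do not commute with the transition maps; they do so after projection
    to the quotient at e, whose kernel contains the earlier ones. *)
Lemma lift_rk j i i' v : i <= i' -> i' < e -> v <= ob r j i ->
  rk P (sc i' (mp r j i i' v)) = rk P (sc i v).
Proof.
move=> ii' i'e vi; have i'm : i' <= m by lia.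
have [i'q|qi'] := leqP i' q.
  have vi' : v <= i by move: vi; rewrite (ob_low rok rq) //; lia.
  by rewrite (mp_low rok rq j ii' i'q vi') /sc /lift_pos i'q (leq_trans ii' i'q).
have [o1 m1] := rgood qi' i'e j.
have sq : sc i v <= q by apply: lift_le vi; lia.
apply: (ker_refine rok rq (ltnW i'e) em) => //.
  by apply: (lift_le (j := j)) => //; apply: (mp_le rok).
rewrite -(m1 (sc i v)) // lift_mp //; try lia.
rewrite {1}/sc /lift_pos leqNgt qi' /= rk_sec // -o1.
exact: (mp_le rok).
Qed.

Lemma sec_mp j i u : e <= i -> i <= m -> u <= q ->
  mp r j q i (sec P q (rk P u)) = mp r j q i u.
Proof.
move=> ei im uq; apply: (@ker_mp _ _ m r q) => //; try lia; first exact: sec_le.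
by apply: (ker_refine rok rq ei) => //; [lia | exact: sec_le | exact: rk_sec_rk].
Qed.

Lemma sec_mp_valid j i : q <= i -> i <= m -> valid (rk P q) (ob r j i)
  (fun v => mp r j q i (sec P q v)).
Proof.
move=> qi im; apply: valid_comp (sec_valid P q) _.
by rewrite -{1}(ob_low rok rq j (leqnn q)); apply: (mp_valid rok).
Qed.

Lemma ins_ypart_eq : e = m.+1 ->
  uact (fun=> q) (fun=> fun v => sec P q (rk P v)) (ypart m r q) = ypart m r q.
Proof.
move=> eE; apply: uact_sec_rk => // u uq; rewrite /P eE => ku.
by apply/(ker_endE uq qm).
Qed.

Lemma ins_ok : ok m.+1 (ins m r q e).
Proof.
have [_ ypE] := rq; split=> /=.
- by move=> i i' ii' _; lia.
- move=> j i im iq; rewrite (leq_ltn_trans iq qe); exact: (ob_low rok rq).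
- move=> j i i' ii' im; case: (ltngtP i' e) => [i'e|i'e|i'E].
  + by rewrite (leq_ltn_trans ii' i'e); apply: (mp_valid rok) => //; lia.
  + case: (ltngtP i e) => [ie|ie|_].
    * by apply: (mp_valid rok); lia.
    * by apply: (mp_valid rok); lia.
    * by apply: sec_mp_valid; lia.
  + case: (ltngtP i e) => [ie|ie|_]; [|lia|exact: valid_id].
    exact: valid_comp (lift_valid j ie) (rk_valid P q).
- move=> j i v im; case: (ltngtP i e) => [ie|ie|_] // vi.
  + by rewrite (mp_id rok) //; lia.
  + by rewrite (mp_id rok) //; lia.
- move=> j i i' i'' v ii' i'i'' im.
  case: (ltngtP i e) => [ie|ie|iE]; case: (ltngtP i' e) => [i'e|i'e|i'E];
    case: (ltngtP i'' e) => [i''e|i''e|i''E] vi //; try lia.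
  + by rewrite (mp_comp rok) //; lia.
  + by rewrite (mp_comp rok) //; lia.
  + by rewrite (lift_rk (j := j)).
  + by rewrite (mp_comp rok) //; lia.
  + have sq := lift_le ie vi.
    by rewrite sec_mp ?(@lift_mp j i i''.-1) //; lia.
  + by rewrite (mp_comp rok) //; lia.
  + by rewrite (mp_comp rok) ?(ob_low rok rq) ?sec_le //; lia.
- move=> j i i' v ii' im i'q vi.
  by rewrite (leq_ltn_trans i'q qe) (mp_low rok rq).
- move=> j; case: (leqP e m) => em'.
    by rewrite ltnNge (leqW em') /= (_ : (m.+1 == e) = false) ?(top_dim rok) //; lia.
  have -> : e = m.+1 by lia.
  by rewrite ltnn eqxx.
Qed.

Lemma ins_face : req m (pull m.+1 m (ins m r q e) (bump e) (fun i => i <= q)) r.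
Proof.
have [_ ypE] := rq.
have bl i : i < e -> bump e i = i by rewrite /bump; lia.
have bh i : e <= i -> bump e i = i.+1 by rewrite /bump; lia.
have blt i : (bump e i < e) = (i < e) by rewrite /bump; lia.
have bne i : (bump e i == e) = false by rewrite /bump; lia.
have lam j i v : i <= m -> v <= pull_ob (ins m r q e) (bump e) (fun i => i <= q) j i ->
    pull_lam (ins m r q e) (bump e) (fun i => i <= q) j i v = v.
  move=> im; rewrite /pull_lam /pull_ob; case: (leqP i q) => // iq vi.
  rewrite /= !bl; try lia.
  by rewrite !(leq_ltn_trans _ qe) ?(ob_low rok rq) ?(mp_low rok rq) //; lia.
have obE j i : pull_ob (ins m r q e) (bump e) (fun i => i <= q) j i = ob r j i.
  rewrite /pull_ob; case: (leqP i q) => iq; first by rewrite (ob_low rok rq).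
  rewrite /= blt bne; case: ltnP => ie; first by rewrite bl.
  by rewrite bh.
have topE j v : v <= ob r j m -> e <= m ->
   mp (ins m r q e) j (bump e m) m.+1 v = v.
  move=> vm em'; rewrite /= bh // ltnNge (leqW em') /=.
  rewrite (_ : (m.+1 == e) = false); last by lia.
  by rewrite (mp_id rok).
split=> [i im|j i im|j i i' v ii' im|].
- by rewrite ypE.
- exact: obE.
- rewrite [ob _ _ _]obE => vi; rewrite [mp _ _ _ _ _]/=; case: (leqP i' q) => i'q.
    rewrite (mp_low rok rq) //; move: vi; rewrite (ob_low rok rq) //; lia.
  rewrite lam ?obE //; last by lia.
  rewrite /= blt bne; case: (ltnP i' e) => i'e.
    by rewrite !bl //; lia.
  rewrite (bh i') // blt bne; case: (ltnP i e) => ie; first by rewrite bl.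
  by rewrite bh.
- rewrite [top _]/=; case: (leqP e m) => em'.
    apply: uact_id => [j|j v]; first by rewrite obE (top_dim rok).
    by rewrite obE => vm; rewrite lam ?obE //; exact: topE.
  have eE : e = m.+1 by lia.
  have bm : bump e m = m by apply: bl; lia.
  have me : m < e by lia.
  (* Insertion at the very end: position m is good or in Y, so lifting its elements to [q] exhibits
     the top simplex as a restriction of [ypart]. *)
  have E1 : uact (ob r ^~ m) (fun _ => sc m) (ypart m r q) = top r.
    rewrite uact_comp.
    + apply: uact_id => [j|j v vm]; first exact: top_dim.
      by rewrite lift_mp // (mp_id rok).
    + by move=> j; exact: lift_valid.
    + exact: (ypart_valid rok rq).
  have mpE j v : v <= ob r j m -> mp (ins m r q e) j (bump e m) m.+1
      (pull_lam (ins m r q e) (bump e) (fun i => i <= q) j m v) = rk P (sc m v).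
    have [h1 h2] : (m.+1 < e) = false /\ (m.+1 == e) = true by lia.
    by move=> vm; rewrite lam ?obE //= bm me h1 h2.
  rewrite uact_comp; last first.
  + by move=> j; exact: sec_valid.
  + move=> j; rewrite obE; apply: valid_ext (valid_comp (lift_valid j me) (rk_valid P q)).
    by move=> v /mpE.
  rewrite -[RHS]E1 -[in RHS](ins_ypart_eq eE) [RHS]uact_comp; last first.
  + by move=> j; exact: valid_comp (rk_valid P q) (sec_valid P q).
  + by move=> j; exact: lift_valid.
  apply: uact_ext => [j|j v|j]; first exact: obE.
    by rewrite obE => /mpE /= ->.
  rewrite obE; apply: valid_ext
    (valid_comp (valid_comp (lift_valid j me) (rk_valid P q)) (sec_valid P q)).
  by move=> v /mpE /= ->.
Qed.

End Ins.

End Insertion.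

(** * The matching covers the new nondegenerate simplices, injectively *)

Section Cover.

Variables (n : nat) (Y : mset n).
Variable Y0 : ytot Y -> Prop.
Hypothesis Y0_act : forall d f z, Y0 z -> Y0 (uact d f z).
Hypothesis n_gt0 : 0 < n.

Lemma ycut_exists m (x : col Y m) : yp x 0 -> exists q, ycut m x q.
Proof.
move=> y0; have [q yq qmax] := @ex_maxnP (yp x) m (ex_intro _ 0 y0) (@yp_dom _ _ _ x).
exists q; split=> [|i im]; first exact: yp_dom yq.
apply/idP/idP => [/qmax //|iq]; apply: (yp_down (col_ok x) iq _ yq).
exact: yp_dom yq.
Qed.

Section InsMatched.

Variables (m : nat) (x : col Y m) (q e : nat).
Hypothesis xq : ycut m x q.
Hypothesis qe : q < e.
Hypothesis em : e <= m.+1.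
Hypothesis xgood : forall i, q < i -> i < e -> good_pos m x q i.
Hypothesis xnd : @nondeg (collage Y) m x.
Hypothesis xbad : e <= m -> ~ good_pos m x q e.
Hypothesis xlow : q.+1 < e -> ~ forall u, ker m x q e u = ker m x q e.-1 u.
Hypothesis xnew : ~ Y0 (top x).

Let tok := ins_ok (col_ok x) xq qe em xgood.
Let t : col Y m.+1 := mk tok.
Let tI : req m.+1 t (ins m x q e) := mkE tok.

Lemma ins_cut : ycut m.+1 t q.
Proof.
by split=> [|i im]; [exact: leqW (proj1 xq) | rewrite (yp_eq tI im)].
Qed.

Lemma ins_faceE : colact (face m e) t = x.
Proof.
apply: col_ext; apply: req_trans (ins_face (col_ok x) xq qe em xgood).
apply: (colactE tI) => i im; first exact: hnat_face.
by move: qe im; clear; rewrite /= /bump; lia.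
Qed.

Let tq := ins_cut.

Lemma ins_ker_lt i u : q < i -> i < e -> ker m.+1 t q i u = ker m x q i u.
Proof.
move=> qi ie; have im : i <= m.+1 by lia.
by have := @face_ker _ _ m t q e tq qe em i u qi im; rewrite ins_faceE /bump (leqNgt e i) ie.
Qed.

Lemma ins_ker_gt i u : e <= i -> i <= m.+1 -> ker m.+1 t q i.+1 u = ker m x q i u.
Proof.
move=> ei im; have := @face_ker _ _ m t q e tq qe em i u (leq_trans qe ei) im.
by rewrite ins_faceE /bump ei.
Qed.

Let P := ker m x q e.

Lemma ins_mp_e j u : u <= q -> mp t j q e u = rk P u.
Proof.
move=> uq; rewrite (mp_eq tI) //; last 2 first.
- exact: ltnW.
- by rewrite (ob_low (col_ok t) tq).
by rewrite /= ltnn eqxx qe /lift_pos leqnn.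
Qed.

(** In any direction, and one exists as n > 0, the map to the inserted object is [rk P], which
    identifies consecutive vertices exactly where [P] holds. *)
Lemma ins_ker_e u : ker m.+1 t q e u = P u.
Proof.
have [uq|uq] := ltnP u q; last by rewrite /P /ker !ltnNge uq.
apply/(kerE uq qe em)/idP => [/(_ (Ordinal n_gt0))|Pu j].
  rewrite !ins_mp_e //; last exact: ltnW.
  by rewrite /=; case: (P u) => //=; lia.
by rewrite !ins_mp_e //= ?Pu ?addn0 // ltnW.
Qed.

Lemma ins_good i : q < i -> i <= e -> good_pos m.+1 t q i.
Proof.
move=> qi; rewrite leq_eqVlt => /orP [/eqP ->|ie]; last first.
  have im : i <= m by lia.
  have := proj1 (@face_good _ _ m t q e tq qe em i qi im).
  by rewrite ins_faceE /bump (leqNgt e i) ie; apply; exact: xgood.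
have K u : u <= q -> rk (ker m.+1 t q e) u = rk P u.
  by apply: rk_ext => w _; exact: ins_ker_e.
move=> j; split=> [|u uq]; first by rewrite (ob_eq tI) //= ltnn eqxx K.
by rewrite ins_mp_e // K.
Qed.

Lemma ins_new : ~ Y0 (top t).
Proof.
move=> Yt; apply: xnew; rewrite -ins_faceE (face_top tq qe em).
exact: Y0_act.
Qed.

Lemma ins_nondeg : @nondeg (collage Y) m.+1 t.
Proof.
move=> i im tE; have qm := proj1 xq; case: (degenP tq im tE) => [[iq ki]|[qi st]].
  move: ki (nondeg_ker i xnd xq); have [qe'|qe'] : q.+1 < e \/ q.+1 = e by lia.
    by rewrite ins_ker_lt // => ->.
  by rewrite qe' ins_ker_e /P => ->.
have oE j k : k <= m.+1 -> ob t j k = ob (ins m x q e) j k by exact: ob_eq.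
have mE j v : v <= ob t j i -> mp t j i i.+1 v = mp (ins m x q e) j i i.+1 v.
  by move=> vi; apply: mp_eq tI _ _ _ _ _ _ vi.
case: (ltngtP i.+1 e) => ie.
- apply: (nondeg_step xnd xq qi); first by lia.
  move=> j; have [o1 o2] := st j; move: o1 o2 (mE j); rewrite !oE //= ?ie; try lia.
  by rewrite (ltnW ie) => o1 o2 m1; split=> // v vi; rewrite -m1 ?o2.
- have [ei|ei] : e < i \/ i = e by lia.
    apply: (@nondeg_step _ _ _ _ _ i.-1 xnd xq); [by lia..|].
    have [k iE] : exists k, i = k.+1 by exists i.-1; lia.
    subst i; move=> j; have [o1 o2] := st j; move: o1 o2 (mE j); rewrite !oE //=; try lia.
    have F a : e < a -> ((a < e) = false) * ((a == e) = false) by move=> ?; split; lia.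
    rewrite !F //; try lia.
    by move=> o1 o2 m1; split=> // v vi; rewrite -m1 ?o2.
  (* An identity from e to e+1 would make the object at position e of [x] equal to the image of [q],
     against [xbad]. *)
  subst i; have em' : e <= m by lia.
  apply: (xbad em') => j; have [o1 o2] := st j; move: o1 o2 (mE j).
  rewrite !oE //= !ltnn !eqxx ltnNge leqnSn /= (_ : (e.+1 == e) = false); last by lia.
  move=> o1 o2 m1; split=> [|u uq]; first by rewrite -/P.
  rewrite -(sec_mp (col_ok x) xq qe em j (leqnn e) em' uq).
  by rewrite -m1 ?o2 // rk_mono.
(* An identity from e-1 to e would give nested kernels of equal rank, hence equal kernels, against
   [xlow]. *)
- have qe' : q.+1 < e by lia.
  have ei : e.-1 = i by lia.
  have ie' : i < e by lia.
  apply: (xlow qe') => u; rewrite ei; apply/idP/idP => ku; last first.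
    by apply: (ker_incl (col_ok x) xq) ku; lia.
  apply: contrapT => /negP nk.
  have [o1 _] := st (Ordinal n_gt0); rewrite !oE //= in o1; last by lia.
  have [h1 h2] : (i.+1 < e) = false /\ (i.+1 == e) = true by lia.
  move: o1; rewrite h1 h2 ie'.
  have [-> _] := xgood qi ie' (Ordinal n_gt0).
  have incl w : w < q -> ker m x q i w -> ker m x q e w.
    by move=> _; apply: (ker_incl (col_ok x) xq); lia.
  by have := rk_lt incl (ker_lt ku) ku nk => lt o1; rewrite o1 ltnn in lt.
Qed.

Lemma ins_matched : matched_at Y0 t q e.
Proof.
split; split=> //.
- exact: ins_good.
- by move=> u; rewrite ins_ker_e ins_ker_gt.
- exact: ins_new.
- exact: ins_nondeg.
Qed.

End InsMatched.

Lemma matched_cover m (x : col Y m) : @nondeg (collage Y) m x -> yp x 0 ->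
  ~ Y0 (top x) -> (exists e, matched Y0 x e) \/
  exists (t : col Y m.+1) e, matched Y0 t e /\ colact (face m e) t = x.
Proof.
move=> xnd /ycut_exists [q xq] xnew.
(* The first position past the run of good ones; m+1 is counted as bad, so that the minimum
   exists. *)
pose B e := (q < e) && ((m < e) || ~~ `[< good_pos m x q e >]).
have [|e /andP [qe Be] emin] := @ex_minnP B.
  by exists m.+1; rewrite /B ltnS (proj1 xq) ltnSn.
have em : e <= m.+1 by apply: emin; rewrite /B ltnS (proj1 xq) ltnSn.
have xgood i : q < i -> i < e -> good_pos m x q i.
  move=> qi ie; apply: contrapT => ng; have : e <= i; last by lia.
  have nb : ~~ `[< good_pos m x q i >] by apply/negP => /asboolP.
  by apply: emin; rewrite /B qi nb orbT.
have xbad : e <= m -> ~ good_pos m x q e.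
  by move=> em' /asboolP g; move: Be; rewrite g ltnNge em'.
(* If the kernel at e already occurs at e-1, the object to insert is present and [x] is an upper
   member; otherwise inserting it gives the partner. *)
have [[qe' K]|low] := pselect (q.+1 < e /\ forall u, ker m x q e u = ker m x q e.-1 u).
  left; exists e.-1, q; have eE : e.-1.+1 = e by lia.
  split; split=> //; try lia.
  - by move=> i qi ie; apply: xgood; lia.
  - by move=> u; rewrite eE K.
right; exists (mk (ins_ok (col_ok x) xq qe em xgood)), e.
split; last exact: (ins_faceE xq qe em xgood).
exists q; apply: ins_matched => // qe' K; exact: low.
Qed.

(** Goodness and the equality of kernels force all data at position e from the face, so deletion is
    undone by insertion. Injectivity of the matching rests on this. *)
Lemma matched_ins m (t : col Y m.+1) q e : matched_at Y0 t q e ->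
  req m.+1 t (ins m (colact (face m e) t) q e).
Proof.
move=> te; have [[tq qe em] [tg tk _ _]] := te; set s := colact _ _.
have sq : ycut m s q := face_cut tq qe em; have qm := proj1 sq.
have tok := col_ok t.
have KP u : ker m s q e u = ker m.+1 t q e u.
  by rewrite (matched_face_ker te) // ltnn tk.
have rkP u : u <= q -> rk (ker m s q e) u = rk (ker m.+1 t q e) u.
  by apply: rk_ext => w _; exact: KP.
have secP v : sec (ker m s q e) q v = sec (ker m.+1 t q e) q v.
  by apply: sec_ext => w _; exact: KP.
have bl i : i < e -> bump e i = i by rewrite /bump; lia.
have bh i : e < i -> bump e i.-1 = i by rewrite /bump; lia.
have oE j i : i <= m -> ob s j i = ob t j (bump e i).
  by move=> im; apply: face_ob tq _ _ _ _ im.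
have mE j i i' v : i <= i' -> i' <= m -> v <= ob s j i ->
    mp s j i i' v = mp t j (bump e i) (bump e i') v.
  by move=> ii' im vi; apply: face_mp tq _ _ _ _ _ _ ii' im vi.
have tge j := tg e qe (leqnn e) j.
have scE i v : i < e -> lift_pos m s q i v = lift_pos m.+1 t q i v.
  move=> ie; rewrite /lift_pos; case: (leqP i q) => // qi.
  by apply: sec_ext => w _; rewrite (matched_face_ker te) ?ie //; lia.
have tg' i : q < i -> i < e -> good_pos m.+1 t q i by move=> qi ie; apply: tg; lia.
have topE em' : top s = top t := face_top_lt tq qe em em'.
have yE : ypart m s q = ypart m.+1 t q := face_ypart tq qe em.
clearbody s; split=> /= [i im|j i im|j i i' v ii' im vi|].
- by rewrite (proj2 tq).
- case: (ltngtP i e) => ie.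
  + by rewrite oE ?bl //; lia.
  + by rewrite oE ?bh //; lia.
  + by subst i; rewrite rkP //; case: (tge j).
- case: (ltngtP i' e) => i'e.
  + have ie : i < e by lia.
    have vi' : v <= ob s j i by rewrite oE ?bl //; lia.
    by rewrite mE // ?bl //; lia.
  + case: (ltngtP i e) => ie.
    * have vi' : v <= ob s j i by rewrite oE ?bl //; lia.
      by rewrite mE ?(bl i) ?(bh i') //; lia.
    * have vi' : v <= ob s j i.-1 by rewrite oE ?bh //; lia.
      by rewrite mE ?(bh i) ?(bh i') //; lia.
    * subst i; have [g1 g2] := tge j; rewrite g1 in vi.
      have so : sec (ker m s q e) q v <= q by exact: sec_le.
      rewrite mE ?(ob_low (col_ok s) sq) //; try lia.
      rewrite (bl q) // (bh i') //.
      rewrite -(@mp_comp _ _ _ _ tok j q e i') ?(ob_low tok tq) //; last by lia.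
      by rewrite g2 // secP rk_sec.
  + subst i'; case: (ltngtP i e) => ie; [|lia|by subst i; rewrite (mp_id tok)].
    rewrite scE // -(lift_mp tok tq qe (leqW em) tg' ie ii' (ltnW qe) em vi).
    have [_ g2] := tge j; have lq : lift_pos m.+1 t q i v <= q.
      exact: lift_le tok tq qe (leqW em) tg' _ _ _ ie vi.
    by rewrite g2 // rkP.
- case: (leqP e m) => em'; first by rewrite topE.
  rewrite -(matched_top_eq te) ?yE; last by lia.
  apply: uact_ext => [j|j v vr|j]; first by rewrite rkP.
    by rewrite secP.
  exact: sec_valid.
Qed.

Lemma matched_inj m (t t' : col Y m.+1) e e' : matched Y0 t e -> matched Y0 t' e' ->
  colact (face m e) t = colact (face m e') t' -> t = t'.
Proof.
move=> [q te] [q' te'] E; have [[tq qe em] _] := te; have [[tq' qe' em'] _] := te'.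
have sq := face_cut tq qe em; have sq' := face_cut tq' qe' em'.
have qq : q = q' by apply: ycut_inj sq _; rewrite E.
subst q'; have [ee|ee|ee] := ltngtP e e'.
- case: (matched_not_good te); first by lia.
  by rewrite E; apply: (matched_face_good te').
- case: (matched_not_good te'); first by lia.
  by rewrite -E; apply: (matched_face_good te).
subst e'; apply: col_ext; apply: req_trans (matched_ins te) _.
by rewrite E; apply: req_sym; exact: matched_ins.
Qed.

End Cover.

(** * Acyclicity of the matching and extension of maps *)

Section Extension.

Variables (n : nat) (Y : mset n).
Variable Y0 : ytot Y -> Prop.
Hypothesis Y0_act : forall d f z, Y0 z -> Y0 (uact d f z).
Hypothesis n_gt0 : 0 < n.

(** This first component of the rank drops whenever a face removes a vertex of Y. Simplices without
    a cut are not matched; 0 is a default for them. *)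
Definition cut_rank m (t : col Y m) (e : nat) : nat :=
  if pselect (exists q, ycut m t q) is left h then sval (cid h) else 0.

(* Orders the pairs by increasing m, then by decreasing e, as e <= m. *)
Definition dim_rank m (t : col Y m) (e : nat) : nat := m * m + (m - e).

Lemma cut_rankE m (t : col Y m) q e : ycut m t q -> cut_rank t e = q.
Proof.
move=> tq; rewrite /cut_rank; case: pselect => [h|[]]; last by exists q.
by case: cid => q' /= tq'; exact: ycut_inj tq' tq.
Qed.

Lemma face_yp m (t : col Y m.+1) j i : i <= m ->
  yp (colact (face m j) t) i = yp t (bump j i).
Proof. by move=> im; rewrite (yp_eq (mkE _)) //= hnat_face. Qed.

Lemma face_cut_le m (t : col Y m.+1) i q : ycut m (colact (face m i.+1) t) q ->
  exists2 q', ycut m.+1 t q' & q <= q'.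
Proof.
move=> cq; have [q' cq'] : exists q', ycut m.+1 t q'.
  by apply: ycut_exists; have := proj2 cq 0 (leq0n _); rewrite face_yp // leq0n.
exists q' => //; have [qm H] := cq; have := H q qm; rewrite leqnn face_yp // (proj2 cq').
  by rewrite /bump; lia.
by rewrite /bump; lia.
Qed.

Section Rank.

Variables (m : nat) (t : col Y m.+1) (q e : nat).
Hypothesis te : matched_at Y0 t q e.
Variable E : forall p, collage Y p -> Prop.
Hypothesis E_act : forall k l (f : hom k l) x, @E l x -> @E k (sact f x).
Hypothesis E_base : forall p (x : col Y p), ~~ yp x 0 \/ Y0 (top x) -> @E p x.
Hypothesis E_rank : forall p (t' : col Y p) e', matched Y0 t' e' ->
  (cut_rank t' e' < cut_rank t e \/
   cut_rank t' e' = cut_rank t e /\ dim_rank t' e' < dim_rank t e) -> @E p t'.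

Let tq : ycut m.+1 t q. Proof. by case: te => [[]]. Qed.

(** The strict bound p < m leaves room for a partner: if [z] is a lower member, its partner has
    dimension p+1, still less than the dimension m+1 of [t]. *)
Lemma rank_nondeg p (z : col Y p) : @nondeg (collage Y) p z ->
  (forall q', ycut p z q' -> q' < q \/ q' = q /\ p < m) -> @E p z.
Proof.
move=> nz zq; have [y0|y0] := boolP (yp z 0); last by apply: E_base; left.
have [Yz|Yz] := pselect (Y0 (top z)); first by apply: E_base; right.
have [[e' [q' ze]]|[t' [e' [[q' te'] tz]]]] := matched_cover Y0_act n_gt0 nz y0 Yz.
  have [[cq _ e'p] _] := ze.
  apply: (E_rank (e' := e')); first by exists q'.
  rewrite (cut_rankE _ cq) (cut_rankE _ tq); have := zq q' cq.
  by rewrite /dim_rank; nia.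
have [[cq qe' e'p] _] := te'.
rewrite -tz; apply: E_act; apply: (E_rank (e' := e')); first by exists q'.
rewrite (cut_rankE _ cq) (cut_rankE _ tq).
have := zq q'; rewrite -tz => /(_ (face_cut cq qe' e'p)).
by rewrite /dim_rank; nia.
Qed.

Lemma rank_small p (z : col Y p) :
  (forall q', ycut p z q' -> q' < q \/ q' = q /\ p < m) -> @E p z.
Proof.
elim: p z => [|p IH] z zq; first by apply: rank_nondeg zq => i.
have [nz|] := pselect (@nondeg (collage Y) p.+1 z); first exact: rank_nondeg nz zq.
move=> /existsNP [i /not_implyP [ip /contrapT zE]].
rewrite zE coll_factor // sact_comp; apply: E_act; apply: IH => q'' cq.
have [q' cq' qq] := face_cut_le cq.
by have := zq q' cq'; lia.
Qed.

Lemma rank_degen p (z : col Y p) : ~ @nondeg (collage Y) p z -> p <= m ->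
  (forall q', ycut p z q' -> q' <= q) -> @E p z.
Proof.
case: p z => [|p] z; first by case=> i.
move=> /existsNP [i /not_implyP [ip /contrapT zE]] pm zq.
rewrite zE coll_factor // sact_comp; apply: E_act; apply: rank_small => q'' cq.
have [q' cq' qq] := face_cut_le cq.
by have := zq q' cq'; lia.
Qed.

Lemma rank_face j : j <= m.+1 -> j <> e -> @E m (colact (face m j) t).
Proof.
move=> jm je; have [[_ qe em] [tg tk tnew tnd]] := te.
have [jq|qj] := leqP j q.
  apply: rank_small => q' cq; left.
  have := proj2 cq q' (proj1 cq); rewrite leqnn face_yp ?(proj1 cq) //.
  rewrite (proj2 tq); first by rewrite /bump; lia.
  by have := proj1 cq; rewrite /bump; lia.
set x := colact _ _; have xq : ycut m x q := face_cut tq qj jm.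
have [nx|dx] := pselect (@nondeg (collage Y) m x); last first.
  by apply: (rank_degen dx) => // q' xq'; rewrite (ycut_inj xq xq').
have [y0|y0] := boolP (yp x 0); last by apply: E_base; left.
have [Yz|Yz] := pselect (Y0 (top x)); first by apply: E_base; right.
have [[e' [q' xe]]|[t' [e' [[q' te'] tx]]]] := matched_cover Y0_act n_gt0 nx y0 Yz.
  have [[cq q'e' e'm] _] := xe; have qq := ycut_inj xq cq.
  apply: (E_rank (e' := e')); first by exists q'.
  by rewrite (cut_rankE _ cq) (cut_rankE _ tq) /dim_rank qq; nia.
have [[cq qe' e'm] [tg' tk' _ _]] := te'.
have qq : q' = q by apply: ycut_inj xq; rewrite -tx; exact: face_cut.
subst q'; rewrite -tx; apply: E_act; apply: (E_rank (e' := e')); first by exists q.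
rewrite (cut_rankE _ cq) (cut_rankE _ tq) /dim_rank.
(* Both upper members have dimension m+1 and the same cut, so the rank decreases exactly when the
   position increases. *)
suff : e < e' by lia.
rewrite ltnNge; apply/negP => ee.
have xbad : e' <= m -> ~ good_pos m x q e'.
  by rewrite -tx; exact: (matched_not_good te').
have xg i : q < i -> i <= m -> bump j i <= e -> good_pos m x q i.
  move=> qi im be; apply: (proj2 (face_good tq qj jm qi im)).
  by apply: tg => //; rewrite /bump; lia.
have [ej|ej] : e < j \/ j < e by lia.
  have em' : e' <= m by lia.
  by apply: (xbad em'); apply: xg => //; rewrite /bump; lia.
have [ee'|ee'] : e' < e \/ e' = e by lia.
  have em' : e' <= m by lia.
  by apply: (xbad em'); apply: xg => //; rewrite /bump; lia.
(* Here j < e: deleting j moves the equal kernels of [t] at e and e+1 to e-1 and e, where those of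
   t' must grow strictly. *)
subst e'; have [k eE] : exists k, e = k.+1 by exists e.-1; lia.
have qk : q < k by lia.
have ke : k < e by lia.
apply: (matched_ker_neq te' qk ke) => u uq; rewrite -eE => ku.
have : ker m x q k u.
  rewrite (face_ker tq qj jm) //; last by lia.
  have -> : bump j k = e by rewrite /bump; lia.
  rewrite -tk; have -> : e.+1 = bump j e by rewrite /bump; lia.
  rewrite -(face_ker tq qj jm) // -/x -tx (matched_face_ker te') //.
  by rewrite ltnn tk'.
by rewrite -tx (matched_face_ker te') ?ke //; lia.
Qed.

End Rank.

Variable K : sset.
Hypothesis kanK : is_kan K.
Variable R0 : forall m, col Y m -> K m -> Prop.
Hypothesis R0_fun : forall m (x : col Y m) y y', R0 x y -> R0 x y' -> y = y'.
Hypothesis R0_act : forall k l (f : hom k l) (x : col Y l) y,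
  R0 x y -> R0 (colact f x) (sact f y).
Hypothesis R0_dom : forall m (x : col Y m),
  (exists y, R0 x y) <-> ~~ yp x 0 \/ Y0 (top x).

Theorem collage_extension :
  exists v : smap (collage Y) K, forall m (x : col Y m) y, R0 x y -> v m x = y.
Proof.
apply: (@matching_extension (collage Y) K kanK R0 R0_fun R0_act (matched Y0)
  cut_rank dim_rank).
- by move=> t e [q [[_ qe em] _]]; lia.
- by move=> m t e [q [[]]].
- by move=> m t e [q [_ []]].
- move=> m t e [q te]; exact: (matched_face_nondeg te).
- move=> m t e y [q te] h.
  have [[tq qe em] _] := te.
  have [|Yt] : ~~ yp (colact (face m e) t) 0 \/ Y0 (top (colact (face m e) t)).
  + by apply/R0_dom; exists y.
  + by rewrite (proj2 (face_cut tq qe em)).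
  + exact: (matched_top Y0_act te Yt).
- by move=> m t t' e e'; exact: matched_inj.
- by move=> m t e e'; exact: matched_face_neq.
- move=> m x nx nR; apply: matched_cover => //.
  + apply: contrapT => /negP y0.
    by have [|y] := proj2 (R0_dom x); [left | exact: nR].
  + by move=> Yx; have [|y] := proj2 (R0_dom x); [right | exact: nR].
- move=> m t e j E [q te] jm je Ea Eb Er; apply: (rank_face te) => // p x h.
  by have [y] := proj2 (R0_dom x) h; exact: Eb.
Qed.

End Extension.

(** * Arrows underlying a multisimplex of the nerve *)

Lemma hnat_hcast k l (e : k = l) i : i <= k -> hnat (hcast e) i = i.
Proof. by move=> ik; rewrite /hnat /= inordK. Qed.

Lemma cell_arrow_idm b b' (h : b ==> b') (x : cell delta b) : ~~ b -> b' ->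
  cell_arrow (idm (cell_cat delta h) x) = Arrow (hid (cell_cod x)).
Proof. by move: b b' h x => [] []. Qed.

Lemma cell_arrow_inj b (x y : cell delta b) : cell_arrow x = cell_arrow y -> x = y.
Proof.
by case: b x y => x y; [case: x y => ? ? ? [] | move/(congr1 adom)].
Qed.

Lemma cell_arrow_obj b (x : cell delta b) : ~~ b -> cell_arrow x = Arrow (hid (cell_cod x)).
Proof. by case: b x. Qed.

Section Arrows.

Variables (n : nat) (Y : mset n) (p : 'I_n -> nat).
Variable F : nerve (grothendieck Y) p.

Definition vob (j : 'I_n) (v : cube (ord_box p) (fun=> false)) : nat :=
  cell_cod (projT1 (F _ v) j).

Lemma segment_ext (e : 'I_n -> bool) a b a' b' ab ab' :
  (forall k, e k -> a k = a' k :> 'I_(p k).+1) -> (forall k, b k = b' k :> 'I_(p k).+1) ->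
  @segment n p e a b ab = @segment n p e a' b' ab'.
Proof.
move=> aa bb; apply: funext_dep => k; rewrite /segment.
by move: (aa k) (bb k); case: (e k) => [/(_ isT)|_] *; [exact: ordmor_ext|].
Qed.

Lemma cosegment_ext (e : 'I_n -> bool) a b a' b' ab ab' :
  (forall k, a k = a' k :> 'I_(p k).+1) -> (forall k, e k -> b k = b' k :> 'I_(p k).+1) ->
  @cosegment n p e a b ab = @cosegment n p e a' b' ab'.
Proof.
move=> aa bb; apply: funext_dep => k; rewrite /cosegment.
by move: (bb k) (aa k); case: (e k) => [/(_ isT)|_] *; [exact: ordmor_ext|].
Qed.

(** Sources and targets in the other directions preserve the j-th arrow, so the other coordinates
    can be moved: the starting points to 0, then the end points to the top, with which everything is
    comparable. *)
Lemma acell_indep j a b ab a' b' ab' : a j = a' j -> b j = b' j ->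
  acell F j (@segment n p (fun=> true) a b ab) =
  acell F j (@segment n p (fun=> true) a' b' ab').
Proof.
move=> aa bb; pose e k := k == j; have ej : e j by exact: eqxx.
pose a0 := dfwith (fun k => @ord0 (p k)) (a j).
pose b0 := dfwith (fun k => @ord_max (p k)) (b j).
have ab0 k : a0 k <= b0 k.
  rewrite /a0 /b0; case: (eqVneq j k) => [jk|jk]; last by rewrite !dfwith_out.
  by subst k; rewrite !dfwith_in.
suff H c d cd : c j = a j -> d j = b j ->
    acell F j (@segment n p (fun=> true) c d cd) =
    acell F j (@segment n p (fun=> true) a0 b0 ab0).
  by rewrite !H.
move=> cj dj; have a0d k : a0 k <= d k.
  rewrite /a0; case: (eqVneq j k) => [jk|jk]; last by rewrite dfwith_out.
  by subst k; rewrite dfwith_in -cj.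
rewrite -(acell_segment F _ ej) (segment_ext (a' := a0) (b' := d) _ a0d) //; last first.
  by move=> k /eqP ->; rewrite /a0 dfwith_in.
rewrite (acell_segment F _ ej) -(acell_cosegment F _ ej).
rewrite (cosegment_ext (a' := a0) (b' := b0) _ ab0) //; last first.
  by move=> k /eqP ->; rewrite /b0 dfwith_in.
by rewrite (acell_cosegment F _ ej).
Qed.

Lemma adom_segment j a b ab :
  adom (acell F j (@segment n p (fun=> true) a b ab)) = vob j a.
Proof.
have ej : j == j by exact: eqxx.
rewrite -(acell_cosegment F _ (e := fun k => k == j) ej) /acell.
set c := cosegment _ ab.
have E := functor_src (nfunctorP F (edge1 j)) c; rewrite src_cosegment in E.
have := congr1 (fun c : gcube Y (fun=> false) => cell_cod (projT1 c j)) E.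
rewrite -[X in X = _ -> _]/(cell_cod (src (cell_cat delta (edge_le (edge1 j) j))
  (projT1 (F _ c) j))).
by rewrite (cod_src_false (edge_le (edge1 j) j)).
Qed.

Lemma acod_segment j a b ab :
  acod (acell F j (@segment n p (fun=> true) a b ab)) = vob j b.
Proof.
have ej : j == j by exact: eqxx.
rewrite -(acell_segment F _ (e := fun k => k == j) ej) /acell.
set c := segment _ ab.
have E := functor_tgt (nfunctorP F (edge1 j)) c; rewrite tgt_segment in E.
have := congr1 (fun c : gcube Y (fun=> false) => cell_cod (projT1 c j)) E.
rewrite -[X in X = _ -> _]/(cell_cod (tgt (cell_cat delta (edge_le (edge1 j) j))
  (projT1 (F _ c) j))).
by rewrite (cell_cod_tgt (edge_le (edge1 j) j)).
Qed.

Lemma acell_segment_id j a aa :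
  acell F j (@segment n p (fun=> true) a a aa) = Arrow (hid (vob j a)).
Proof.
have ej : j == j by exact: eqxx.
rewrite -(acell_segment F _ (e := fun k => k == j) ej).
have -> : @segment n p (fun k => k == j) a a aa = idm (dir (ord_box p) (edge1 j)) a.
  apply: funext_dep => k; rewrite /= /segment; move: (edge_le (edge1 j) k).
  by case: (k == j) => //= _; exact: ordmor_ext.
rewrite /acell (functor_idm (nfunctorP F (edge1 j))).
rewrite -[LHS]/(cell_arrow (idm (cell_cat delta (edge_le (edge1 j) j))
  (projT1 (F (fun=> false) a) j))).
by rewrite cell_arrow_idm.
Qed.

Lemma acell_segment_comp j a b c ab bc ac v : v <= vob j a ->
  hnat (amap (acell F j (@segment n p (fun=> true) b c bc)))
    (hnat (amap (acell F j (@segment n p (fun=> true) a b ab))) v) =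
  hnat (amap (acell F j (@segment n p (fun=> true) a c ac))) v.
Proof.
move=> va; have ej : j == j by exact: eqxx.
pose w (x : forall k, 'I_(p k).+1) := dfwith (fun k => @ord0 (p k)) (x j).
have wle (x y : forall k, 'I_(p k).+1) : x j <= y j -> forall k, w x k <= w y k.
  move=> xy k; rewrite /w; case: (eqVneq j k) => [jk|jk]; last by rewrite !dfwith_out.
  by subst k; rewrite !dfwith_in.
have wj (x : forall k, 'I_(p k).+1) : x j = w x j by rewrite /w dfwith_in.
pose g := @cosegment n p (fun k => k == j) _ _ (wle b c (bc j)).
pose f := @segment n p (fun k => k == j) _ _ (wle a b (ab j)).
have u : src (dir (ord_box p) (edge1 j)) g = tgt (dir (ord_box p) (edge1 j)) f.
  apply: funext_dep => k; rewrite /= /g /f /cosegment /segment.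
  by move: (edge_le (edge1 j) k); case: (k == j).
have D : Defs.comp (dir (ord_box p) (edge1 j)) g f u =
    @cosegment n p (fun k => k == j) _ _ (wle a c (ac j)).
  by apply: comp_cosegment => k kj; rewrite /w !dfwith_out // eq_sym.
have [q Eq] := acell_comp F u.
have gE : acell F j (@segment n p (fun=> true) b c bc) = acell F j g.
  rewrite (acell_indep bc (wle b c (bc j))) //.
  by rewrite -(acell_cosegment F _ (e := fun k => k == j) ej).
have fE : acell F j (@segment n p (fun=> true) a b ab) = acell F j f.
  rewrite (acell_indep ab (wle a b (ab j))) //.
  by rewrite -(acell_segment F _ (e := fun k => k == j) ej).
have cE : acell F j (@segment n p (fun=> true) a c ac) = delta_comp q.
  rewrite -Eq D (acell_indep ac (wle a c (ac j))) //.
  by rewrite -(acell_cosegment F _ (e := fun k => k == j) ej).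
rewrite gE fE cE /= !hnat_comp hnat_hcast //; exact: hnat_le.
Qed.

End Arrows.

(** * Diagonal simplices of the nerve as chains *)

Section Chains.

Variables (n : nat) (Y : mset n).

Section Chain.

Variables (m : nat) (F : nerve (grothendieck Y) (fun=> m)).

Definition clip (i : nat) : 'I_m.+1 := inord (minn i m).

Lemma clipE i : i <= m -> clip i = i :> nat.
Proof. by move=> im; rewrite /clip inordK; lia. Qed.

Lemma clip_le i i' : clip (minn i i') <= clip i'.
Proof. by rewrite /clip !inordK; lia. Qed.

Lemma clip_ord (x : 'I_m.+1) : clip x = x.
Proof. by apply: val_inj; rewrite /= clipE // leq_ord. Qed.

(** The minimum makes the segment defined for all i and i'; only i <= i' matters. *)
Definition chain_arrow (j : 'I_n) i i' : arrow :=
  acell F j (@segment n (fun=> m) (fun=> true) (fun=> clip (minn i i')) (fun=> clip i')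
    (fun=> clip_le i i')).

Definition chain : raw Y :=
  Raw (fun=> false) (fun j i => vob F j (fun=> clip i))
    (fun j i i' => hnat (amap (chain_arrow j i i')))
    (zcell F (e := fun=> false) (fun=> clip m)).

Lemma chain_arrowE j a b ab i i' : i <= i' -> clip i = a j -> clip i' = b j ->
  acell F j (@segment n (fun=> m) (fun=> true) a b ab) = chain_arrow j i i'.
Proof. by move=> /minn_idPl ii' ai bi; apply: acell_indep; rewrite ?ii'. Qed.

Lemma adom_chain j i i' : i <= i' -> adom (chain_arrow j i i') = ob chain j i.
Proof. by move=> /minn_idPl ii'; rewrite adom_segment ii'. Qed.

Lemma acod_chain j i i' : acod (chain_arrow j i i') = ob chain j i'.
Proof. by rewrite acod_segment. Qed.

Lemma chain_valid j i i' : i <= i' -> valid (ob chain j i) (ob chain j i') (mp chain j i i').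
Proof. by move=> ii'; rewrite -(adom_chain j ii') -(acod_chain j i i'); exact: valid_hnat. Qed.

Lemma mp_chain j i i' v : mp chain j i i' v = hnat (amap (chain_arrow j i i')) v.
Proof. by []. Qed.

Lemma chain_ok : ok m chain.
Proof.
split=> // [j i i' ii' im|j i v im vi|j i i' i'' v ii' i'i'' im vi].
- exact: chain_valid.
- have aa (k : 'I_n) : clip i <= clip i by [].
  rewrite mp_chain -(@chain_arrowE j _ _ aa) // acell_segment_id.
  by rewrite hnat_id.
- have c1 (k : 'I_n) : clip i <= clip i' by rewrite !clipE //; lia.
  have c2 (k : 'I_n) : clip i' <= clip i'' by rewrite !clipE //; lia.
  have c3 (k : 'I_n) : clip i <= clip i'' by rewrite !clipE //; lia.
  rewrite !mp_chain -(@chain_arrowE j _ _ c1 i i') // -(@chain_arrowE j _ _ c2 i' i'') //.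
  by rewrite -(@chain_arrowE j _ _ c3 i i'') ?acell_segment_comp //; lia.
Qed.

Lemma vob_chain j (v : 'I_n -> 'I_m.+1) : vob F j v = ob chain j (v j).
Proof.
have vv (k : 'I_n) : v k <= v k by [].
rewrite -(adom_segment F j vv) (@chain_arrowE j _ _ vv (v j) (v j)) ?clip_ord //.
exact: adom_chain.
Qed.

(** Any vertex, also off the diagonal, is the first vertex of a cube ending at the last one; so the
    diagonal chain determines the multisimplices at all vertices. *)
Lemma zcell_vertex (v : 'I_n -> 'I_m.+1) :
  zcell F (e := fun=> false) v =
  uact (fun j => vob F j v) (fun j => mp chain j (v j) m) (top chain).
Proof.
have va (k : 'I_n) : v k <= clip m by rewrite clipE // leq_ord.
have := @zcell_cosegment n Y (fun=> m) F v (fun=> clip m) va (fun=> false).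
rewrite -[X in zcell F X = _]/(v : cube (ord_box (fun=> m)) (fun=> false)) => ->.
set C := F _ _; rewrite tot_mact.
have -> : tot (projT2 C) = top chain.
  have := @zcell_segment n Y (fun=> m) F v (fun=> clip m) va (fun=> false).
  by move=> /esym.
have CE j : (projT1 C j : arrow) = chain_arrow j (v j) m.
  rewrite -(@chain_arrowE j _ _ va) ?clip_ord ?leq_ord //.
  by rewrite /acell arrow_cell.
apply: uact_ext => [j|j x xm|j].
- by rewrite -[LHS]/(adom (projT1 C j)) CE adom_chain ?leq_ord // -vob_chain.
- by rewrite -[LHS]/(hnat (amap (projT1 C j : arrow)) x) CE.
- rewrite -[mask_dom _ _]/(adom (projT1 C j : arrow)) (top_dim chain_ok).
  rewrite -[hnat _]/(hnat (amap (projT1 C j : arrow))) CE.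
  by rewrite -(acod_chain j (v j) m); exact: valid_hnat.
Qed.

End Chain.

End Chains.

(** * The inclusion of the nerve into the collage *)

Section NerveMap.

Variables (n : nat) (Y : mset n).

Definition col_chain m (F : diag (nerve (grothendieck Y)) m) : col Y m := mk (chain_ok F).

Lemma chain_mact k l (f : hom k l) (F : diag (nerve (grothendieck Y)) l) :
  req k (chain (sact f F)) (pull l k (chain F) (hnat f) (fun=> false)).
Proof.
have cf i : i <= k -> f (clip k i) = clip l (hnat f i).
  move=> ik; apply: val_inj => /=; rewrite clipE ?hnat_le // /hnat; congr (nat_of_ord (f _)).
  by apply: val_inj; rewrite /= clipE // inordK.
have obE j i : i <= k -> ob (chain (sact f F)) j i = ob (chain F) j (hnat f i).
  by move=> ik; rewrite /= -cf.
split=> // [j i i' v ii' ik vi|].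
  rewrite -[RHS]/(mp (chain F) j (hnat f i) (hnat f i') v) !mp_chain.
  have le (j' : 'I_n) : f (clip k i) <= f (clip k i').
    by apply: hom_mono; rewrite !clipE //; lia.
  rewrite -(@chain_arrowE _ _ _ F j _ _ le (hnat f i) (hnat f i')).
  - congr (hnat (amap _) _); rewrite /chain_arrow /acell; congr cell_arrow.
    rewrite -[LHS]/(projT1 (F _ (ord_box_functor (fun=> f) _ _)) j).
    congr (projT1 (F _ _) j); apply: funext_dep => j' /=; apply: ordmor_ext => //=.
    by rewrite (minn_idPl ii').
  - exact: hnat_mono.
  - by rewrite cf //; lia.
  - by rewrite cf.
rewrite -[LHS]/(zcell F (e := fun=> false) (fun=> f (clip k k))) zcell_vertex.
apply: uact_ext => [j|j v vk|j].
- by rewrite vob_chain cf // clipE // hnat_le.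
- by rewrite cf // clipE // hnat_le.
- rewrite vob_chain (top_dim (chain_ok F)); apply: chain_valid; exact: leq_ord.
Qed.

Lemma col_chain_nat k l (f : hom k l) (F : diag (nerve (grothendieck Y)) l) :
  col_chain (sact f F) = colact f (col_chain F).
Proof.
apply: col_ext; apply: req_trans (mkE _) _; apply: req_trans (chain_mact f F) _.
by apply: req_sym; apply: (colactE (mkE _)).
Qed.

Lemma last_map_chain m (F : diag (nerve (grothendieck Y)) m) :
  last_map_fun (col_chain F) = diag_map (rho Y) m F.
Proof.
apply: (@existT_inj _ (msimplex Y) (fun=> m)); rewrite -!/(tot _) tot_last_map.
rewrite (rtop_req (s := chain F)); [|exact: col_ok|exact: mkE].
rewrite -[RHS]/(tot (mact (rho_dir F) (projT2 (F _ (@last_vertex n (fun=> m)))))).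
rewrite tot_mact.
have lE : (fun=> clip m m) = @last_vertex n (fun=> m).
  by apply: funext_dep => j; apply: val_inj; rewrite /= clipE.
have -> : tot (projT2 (F _ (@last_vertex n (fun=> m)))) = top (chain F).
  by rewrite -[RHS]/(zcell F (e := fun=> false) (fun=> clip m m)) lE.
apply: uact_ext => // [j i im|j]; last first.
  by rewrite (top_dim (chain_ok F)); apply: rtop_valid; exact: chain_ok.
have mi : clip m i = inord i by apply: val_inj; rewrite /= clipE // inordK.
have sE : acell F j (@to_last n (fun=> m) j (inord i)) = chain_arrow F j i m.
  apply: etrans (acell_segment F _ (e := fun k => k == j) (eqxx j)) _.
  apply: chain_arrowE => //.
    by rewrite dfwith_in.
  by apply: val_inj; rewrite /= clipE.
rewrite mp_chain /hnat -[RHS]/(nat_of_ord (rho_fun F (inord i))) rho_funE.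
apply: amap_eq; first exact: esym sE.
rewrite inordK -(adom_chain F j im) //.
by rewrite -[RHS]/(adom (acell F j (@to_last n (fun=> m) j (inord i)))) sE.
Qed.

(** ** Multisimplices of the nerve as chains *)

(** Every cube is a segment. Its j-th arrow depends only on the j-th coordinates, and its
    multisimplex only on the end vertex, so both are read off the chain. *)
Lemma col_chain_inj m (F F' : diag (nerve (grothendieck Y)) m) :
  col_chain F = col_chain F' -> F = F'.
Proof.
move=> E; have R : req m (chain F) (chain F').
  by apply: req_trans (req_sym (mkE (chain_ok F))) _; rewrite -/(col_chain F) E; exact: mkE.
apply: nfunctor_ext => e c.
pose a k : 'I_m.+1 := match e k as s return cell (ord_cat m) s -> 'I_m.+1 with
  | true => @osrc m | false => id end (c k).
pose b k : 'I_m.+1 := match e k as s return cell (ord_cat m) s -> 'I_m.+1 with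
  | true => @otgt m | false => id end (c k).
have ab k : a k <= b k.
  by rewrite /a /b; move: (c k); case: (e k) => //= x; exact: ordmor_le.
have cE : c = @segment n (fun=> m) e a b ab.
  apply: funext_dep => k; rewrite /segment; move: (ab k); rewrite /a /b; move: (c k).
  by case: (e k) => //= x le; exact: ordmor_ext.
have zE (G : diag (nerve (grothendieck Y)) m) : zcell G c = zcell G (e := fun=> false) b.
  rewrite cE zcell_segment; exact: esym (zcell_segment G ab (fun=> false)).
have arrE j i i' : i <= i' -> i' <= m -> chain_arrow F j i i' = chain_arrow F' j i i'.
  move=> ii' im; apply: arrow_ext => [||x y xy].
  - by rewrite !adom_chain // (ob_eq R) //; lia.
  - by rewrite !acod_chain (ob_eq R).
  - rewrite -!hnatE -!mp_chain xy (mp_eq R) // -(adom_chain F j ii') -xy.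
    exact: leq_ord.
have zz : zcell F c = zcell F' c.
  rewrite !zE !zcell_vertex -(top_eq R); apply: uact_ext => [j|j v|j].
  - by rewrite !vob_chain (ob_eq R) // leq_ord.
  - by rewrite vob_chain => vb; rewrite (mp_eq R) // leq_ord.
  - rewrite vob_chain (top_dim (chain_ok F)); apply: chain_valid; exact: leq_ord.
apply: gcube_ext; last exact: zz.
apply: funext_dep => j; apply: cell_arrow_inj; rewrite -!/(acell _ _ _).
have [ej|ej] := boolP (e j).
  rewrite cE !acell_segment // !(@chain_arrowE _ _ _ _ j _ _ ab (a j) (b j)) ?clip_ord //.
  by apply: arrE => //; exact: leq_ord.
rewrite /acell !cell_arrow_obj //; congr (Arrow (hid _)).
by have := congr1 (fun k : 'I_n -> nat => k j) (projT1_eq zz).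
Qed.

Section Build.

Variables (m : nat) (x : col Y m).
Hypothesis x0 : ~~ yp x 0.

Let xok : ok m x := col_ok x.

Definition build_cell (j : 'I_n) (b : bool) : cell (ord_cat m) b -> cell delta b :=
  match b return cell (ord_cat m) b -> cell delta b with
  | true => fun f =>
      Arrow (uhom (ob x j (osrc f)) (ob x j (otgt f)) (mp x j (osrc f) (otgt f)))
  | false => fun i => ob x j (i : 'I_m.+1)
  end.

Definition end_vertex (b : bool) : cell (ord_cat m) b -> 'I_m.+1 :=
  match b return cell (ord_cat m) b -> 'I_m.+1 with true => @otgt m | false => id end.

Lemma build_cod j b (c : cell (ord_cat m) b) :
  cell_cod (build_cell j c) = ob x j (end_vertex c).
Proof. by case: b c. Qed.

Definition build_cube e (c : cube (ord_box (fun=> m)) e) : gcube Y e :=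
  existT _ (fun j => build_cell j (c j) : cell delta (e j))
    (projT2 (uact (fun j => cell_cod (build_cell j (c j)))
      (fun j => mp x j (end_vertex (c j)) m) (top x))).

Lemma tot_build e (c : cube (ord_box (fun=> m)) e) :
  tot (projT2 (build_cube c)) =
  uact (fun j => ob x j (end_vertex (c j))) (fun j => mp x j (end_vertex (c j)) m) (top x).
Proof.
rewrite -[LHS]/(uact (fun j => cell_cod (build_cell j (c j))) _ _).
apply: uact_ext => // j; first by rewrite build_cod.
by rewrite build_cod (top_dim xok); apply: (mp_valid xok) => //; exact: leq_ord.
Qed.

Let arr_valid j (f : ordmor m) :
  valid (ob x j (osrc f)) (ob x j (otgt f)) (mp x j (osrc f) (otgt f)).
Proof. by apply: (mp_valid xok); [exact: ordmor_le | exact: leq_ord]. Qed.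

Lemma build_src j b b' (h : b ==> b') (c : cell (ord_cat m) b') :
  src (cell_cat delta h) (build_cell j c) = build_cell j (src (cell_cat (ord_cat m) h) c).
Proof. by move: b b' h c => [] []. Qed.

Lemma build_tgt j b b' (h : b ==> b') (c : cell (ord_cat m) b') :
  tgt (cell_cat delta h) (build_cell j c) = build_cell j (tgt (cell_cat (ord_cat m) h) c).
Proof. by move: b b' h c => [] []. Qed.

Lemma build_idm j b b' (h : b ==> b') (c : cell (ord_cat m) b) :
  build_cell j (idm (cell_cat (ord_cat m) h) c) = idm (cell_cat delta h) (build_cell j c).
Proof.
move: b b' h c => [] [] // h c; apply: arrow_ext => // u v uv.
have ul : u <= ob x j (c : 'I_m.+1) by exact: leq_ord.
transitivity (hnat (uhom (ob x j c) (ob x j c) (mp x j c c)) u); first by rewrite hnatE.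
by rewrite (hnat_uhom (arr_valid j (OrdMor (leqnn c)))) // (mp_id xok) ?leq_ord.
Qed.

Lemma build_comp j b b' (h : b ==> b') (g f : cell (ord_cat m) b') u v :
  build_cell j (Defs.comp (cell_cat (ord_cat m) h) g f u) =
  Defs.comp (cell_cat delta h) (build_cell j g) (build_cell j f) v.
Proof.
move: b b' h g f u v => [] [] // h g f u v; apply: arrow_ext => // y z yz.
have u' : osrc g = otgt f := u.
have fg : osrc f <= otgt g by rewrite (leq_trans (ordmor_le f)) // -u' ordmor_le.
have yl : y <= ob x j (osrc f) by exact: leq_ord.
pose U (f : ordmor m) := uhom (ob x j (osrc f)) (ob x j (otgt f)) (mp x j (osrc f) (otgt f)).
transitivity (hnat (U (OrdMor fg)) y).
  by rewrite hnatE; congr (nat_of_ord (_ _)); exact: val_inj.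
rewrite (hnat_uhom (arr_valid j (OrdMor fg))) //.
transitivity (hnat (hcomp (U g) (hcomp (hcast (esym v)) (U f))) z); last by rewrite hnatE.
have fl : mp x j (osrc f) (otgt f) z <= ob x j (osrc g).
  by rewrite u'; case: (arr_valid j f) => + _; apply; rewrite -yz.
have zl : z <= ob x j (osrc f) by exact: leq_ord.
rewrite !hnat_comp hnat_hcast ?hnat_le // (hnat_uhom (arr_valid j f)) //.
rewrite (hnat_uhom (arr_valid j g)) //.
by rewrite -yz u' (mp_comp xok) ?leq_ord ?ordmor_le // -u' ordmor_le.
Qed.

Lemma end_tgt b b' (h : b ==> b') (c : cell (ord_cat m) b') :
  end_vertex (tgt (cell_cat (ord_cat m) h) c) = end_vertex c.
Proof. by move: b b' h c => [] []. Qed.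

Lemma end_idm b b' (h : b ==> b') (c : cell (ord_cat m) b) :
  end_vertex (idm (cell_cat (ord_cat m) h) c) = end_vertex c.
Proof. by move: b b' h c => [] []. Qed.

Lemma end_comp b b' (h : b ==> b') (g f : cell (ord_cat m) b') u :
  end_vertex (Defs.comp (cell_cat (ord_cat m) h) g f u) = end_vertex g.
Proof. by move: b b' h g f u => [] []. Qed.

Lemma end_src j b b' (h : b ==> b') (c : cell (ord_cat m) b') v :
  v <= cell_cod (src (cell_cat delta h) (build_cell j c)) ->
  mp x j (end_vertex c) m (hnat (src_map h (build_cell j c)) v) =
  mp x j (end_vertex (src (cell_cat (ord_cat m) h) c)) m v.
Proof.
move: b b' h c => [] [] //= h c vc; rewrite ?hnat_id //.
by rewrite hnat_uhom // (mp_comp xok) ?ordmor_le ?leq_ord.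
Qed.

Lemma buildP i e e' (h : @edge n i e e') :
  is_functor (dir (ord_box (fun=> m)) h) (dir (grothendieck Y) h)
    (@build_cube e) (@build_cube e').
Proof.
have vz j b (c : cell (ord_cat m) b) :
    valid (ob x j (end_vertex c)) (projT1 (top x) j) (mp x j (end_vertex c) m).
  by rewrite (top_dim xok); apply: (mp_valid xok) => //; exact: leq_ord.
split=> [c|c|c|g f u v].
- apply: gcube_ext; first by apply: funext_dep => j; exact: build_src.
  rewrite tot_build [LHS]tot_mact.
  rewrite -[X in uact _ _ X]/(uact (fun j => cell_cod (build_cell j (c j))) _ _).
  rewrite uact_comp; last 2 first.
  + by move=> j; exact: valid_hnat.
  + by move=> j; rewrite build_cod; exact: vz.
  apply: uact_ext => [j|j w|j].
  + by rewrite /box_cod /= build_src build_cod.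
  + exact: end_src.
  + apply: valid_comp (valid_hnat _) _; rewrite build_cod; exact: vz.
- apply: gcube_ext; first by apply: funext_dep => j; exact: build_tgt.
  rewrite [LHS]tot_mcast !tot_build; apply: uact_ext => [j|j w _|j].
  + by rewrite /= end_tgt.
  + by rewrite /= end_tgt.
  + exact: vz.
- apply: gcube_ext; first by apply: funext_dep => j; exact: build_idm.
  rewrite [RHS]tot_mcast !tot_build; apply: uact_ext => [j|j w _|j].
  + by rewrite /= end_idm.
  + by rewrite /= end_idm.
  + exact: vz.
- apply: gcube_ext; first by apply: funext_dep => j; exact: build_comp.
  rewrite [RHS]tot_mcast !tot_build; apply: uact_ext => [j|j w _|j].
  + by rewrite /= end_comp.
  + by rewrite /= end_comp.
  + exact: vz.
Qed.

Definition build : diag (nerve (grothendieck Y)) m := NFunctor buildP.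

Lemma col_chain_build : col_chain build = x.
Proof.
apply: col_ext; apply: req_trans (mkE _) _; split=> [i im|j i im|j i i' v ii' im|].
- apply/esym/negbTE; apply: contra x0; exact: (yp_down xok (leq0n i) im).
- by rewrite /= /vob /= clipE.
- rewrite mp_chain => vi; rewrite -[LHS]/(hnat (uhom (ob x j (clip m (minn i i')))
    (ob x j (clip m i')) (mp x j (clip m (minn i i')) (clip m i'))) v).
  rewrite hnat_uhom !clipE ?(minn_idPl ii') //; try lia.
  + exact: (mp_valid xok).
  + by move: vi; rewrite /= /vob /= clipE //; lia.
- rewrite -[LHS]/(tot (projT2 (build_cube (e := fun=> false) (fun=> clip m m)))) tot_build.
  apply: uact_id => [j|j v]; rewrite /= clipE //; first exact: top_dim.
  by move=> vm; rewrite (mp_id xok).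
Qed.

End Build.

Lemma col_chain_surj m (x : col Y m) : ~~ yp x 0 -> exists F, col_chain F = x.
Proof. by move=> x0; exists (build x); exact: col_chain_build. Qed.

End NerveMap.

Lemma smap_ext (X K : sset) (f g : smap X K) : (forall k x, f k x = g k x) -> f = g.
Proof.
case: f g => [f Hf] [g Hg] /= H.
have E : f = g by apply: funext_dep => k; apply: funext_dep => x.
by subst g; rewrite (Prop_irrelevance Hf Hg).
Qed.

(** * The homotopy, and the two halves of the weak equivalence *)

Section Homotopy.

Variables (n : nat) (Y : mset n).

Let X := diag (nerve (grothendieck Y)).

Definition below k (h : hom k 1) i : bool := hnat h i == 0.

Lemma below_down k (h : hom k 1) i i' : i <= i' -> i' <= k -> below h i' -> below h i.
Proof. by rewrite /below => ii' i'k; have := hnat_mono h ii' i'k; lia. Qed.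

Lemma homotopy_ok k (F : X k) (h : hom k 1) :
  ok k (pull k k (chain F) (fun i => i) (below h)).
Proof.
apply: pull_ok; [exact: chain_ok | exact: valid_id | exact: below_down].
Qed.

(** Vertices over 0 are moved into Y by the last vertex map, those over 1 stay in the nerve. *)
Definition homotopy_fun k (Fh : X k * hom k 1) : col Y k := mk (homotopy_ok Fh.1 Fh.2).

Lemma homotopy_nat k l (f : hom k l) (Fh : X l * hom l 1) :
  homotopy_fun (sact f Fh.1, hcomp Fh.2 f) = colact f (homotopy_fun Fh).
Proof.
case: Fh => F h; apply: col_ext; apply: req_trans (mkE _) _.
have bE i : i <= k -> below h (hnat f i) = below (hcomp h f) i.
  by rewrite /below hnat_comp.
apply: (@req_trans _ _ _ _ (pull l k (chain F) (hnat f) (below (hcomp h f)))).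
  have E := pull_ext (th' := fun i => i) (p' := below (hcomp h f)) (chain_ok (sact f F))
    (@valid_id k) (@below_down k (hcomp h f)) (chain_mact f F) (fun _ _ => erefl)
    (fun _ _ => erefl).
  apply: req_trans E _.
  by apply: pull_pull => //; [exact: chain_ok | exact: valid_hnat | exact: below_down].
have E : req k (colact f (homotopy_fun (F, h)))
    (pull l k (pull l l (chain F) (fun i => i) (below h)) (hnat f) (below (hcomp h f))).
  exact: colactE (mkE (homotopy_ok F h)) (fun _ _ => erefl) bE.
apply: req_sym; apply: req_trans E _.
apply: pull_pull => //; first exact: chain_ok.
- exact: valid_hnat.
- exact: below_down.
- exact: below_down.
- by move=> i ik; rewrite bE.
Qed.

Definition chain_homotopy : smap (sprod X (std_simplex 1)) (collage Y) :=
  @SMap (sprod X (std_simplex 1)) (collage Y) homotopy_fun homotopy_nat.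

Lemma chain_homotopy0 k (F : X k) :
  chain_homotopy k (F, hconst k ord0) = emb (diag_map (rho Y) k F).
Proof.
rewrite -last_map_chain; apply: col_ext; apply: req_trans (mkE _) _.
apply: req_trans (pull_full _); apply: pull_ext => //; [exact: chain_ok|].
by apply: req_sym; exact: mkE.
Qed.

Lemma chain_homotopy1 k (F : X k) :
  chain_homotopy k (F, hconst k ord_max) = col_chain F.
Proof.
apply: col_ext; apply: req_trans (mkE _) _; apply: req_sym; apply: req_trans (mkE _) _.
by apply: req_sym; apply: (pull_self (chain_ok F)).
Qed.

Definition extends_chain (K : sset) (w : smap X K) (f : smap (collage Y) K) :=
  forall m (F : X m), f m (col_chain F) = w m F.

Hypothesis n_gt0 : 0 < n.
Variable K : sset.
Hypothesis kanK : is_kan K.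

Lemma chain_extension (w : smap X K) : exists f, extends_chain w f.
Proof.
have [||||f fP] := @collage_extension n Y (fun=> False) _ n_gt0 K kanK
  (fun m x y => exists2 F : X m, col_chain F = x & w m F = y).
- by [].
- by move=> m x y y' [F <- <-] [F' /col_chain_inj -> <-].
- move=> k l f x y [F <- <-]; exists (sact f F); [exact: col_chain_nat | exact: sfun_nat].
- move=> m x; split=> [[y [F <- _]]|[|//]]; first by left.
  by move=> /col_chain_surj [F <-]; exists (w m F), F.
by exists f => m F; apply: fP; exists F.
Qed.

(** An extension of [w] to the collage, restricted to Y, is the required map; composing the
    extension with [chain_homotopy] compares it with [w]. *)
Lemma rho_surj (w : smap X K) : exists u : smap (diag Y) K,
  homotopic (scomp u (diag_map (rho Y))) w.
Proof.
have [f fw] := chain_extension w.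
exists (scomp f (diag_emb Y)); apply: rst_step; exists (scomp f chain_homotopy).
split=> k F; last by rewrite -fw; congr (f k _); exact: chain_homotopy1.
by congr (f k _); exact: chain_homotopy0.
Qed.

(** ** The cylinder *)

Let j0 : 'I_n := Ordinal n_gt0.

(** Delta^1 is placed in the single direction [j0], which needs n > 0. The result is
    multisimplicial, so it has a collage, and its diagonal is the product of the diagonal of Y with
    Delta^1. *)
Definition cyl : mset n.
Proof.
apply: (@MSet n (fun k => Y k * hom (k j0) 1)%type
  (fun k l f yh => (mact f yh.1, hcomp yh.2 (f j0)))).
- by move=> k [y h]; rewrite mact_id; congr pair; exact: hom_ext.
- by move=> k l m g f [y h]; rewrite mact_comp; congr pair; exact: hom_ext.
Defined.

Definition cyl_proj : mmap cyl Y :=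
  @MMap n cyl Y (fun k yh => yh.1) (fun _ _ _ _ => erefl).

Definition cyl_end (b : 'I_2) (z : ytot cyl) : Prop := forall i, (projT2 z).2 i = b.

Lemma cyl_end_act b d f z : cyl_end b z -> cyl_end b (uact d f z).
Proof. by move=> zb i; exact: zb. Qed.

Lemma last_map_end b m (x : col cyl m) : cyl_end b (top x) ->
  (last_map_fun x).2 = hconst m b.
Proof. by move=> xb; apply: hom_ext => i; rewrite [RHS]/= -[in RHS](xb
  (uhom m (projT1 (top x) j0) (fun i => mp x j0 i m (ob x j0 i)) i)). Qed.

(** A chain over the cylinder gives a chain over Y and, through last vertices, a simplex of Delta^1,
    to which [H] applies. Over an end that simplex is constant, so [H] agrees there with [f] or
    [f']. *)
Lemma homotopic_extension (w w' : smap X K) (f f' : smap (collage Y) K) :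
  elem_homotopy w w' -> extends_chain w f -> extends_chain w' f' ->
  elem_homotopy (scomp f (diag_emb Y)) (scomp f' (diag_emb Y)).
Proof.
move=> [H [H0 H1]] fw fw'; pose p m (x : col cyl m) := col_map cyl_proj x.
have [||||v vP] := @collage_extension n cyl
  (fun z => cyl_end ord0 z \/ cyl_end ord_max z) _ n_gt0 K kanK (fun m x y =>
    [\/ exists2 F : X m, col_chain F = p m x & y = H m (F, (last_map_fun x).2),
        cyl_end ord0 (top x) /\ y = f m (p m x)
      | cyl_end ord_max (top x) /\ y = f' m (p m x)]).
- by move=> d g z [] h; [left|right]; exact: cyl_end_act.
- have chain0 m (x : col cyl m) F : col_chain F = p m x -> cyl_end ord0 (top x) ->
      H m (F, (last_map_fun x).2) = f m (p m x).
    by move=> <- /last_map_end ->; rewrite H0 fw.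
  have chain1 m (x : col cyl m) F : col_chain F = p m x -> cyl_end ord_max (top x) ->
      H m (F, (last_map_fun x).2) = f' m (p m x).
    by move=> <- /last_map_end ->; rewrite H1 fw'.
  have ends m (x : col cyl m) : cyl_end ord0 (top x) -> ~ cyl_end ord_max (top x).
    by move=> z0 z1; have := z0 ord0; rewrite (z1 ord0).
  move=> m x y y' [[F Fx ->]|[x0 ->]|[x1 ->]] [[F' Fx' ->]|[x0' ->]|[x1' ->]] //.
  + by congr (H m (_, _)); apply: col_chain_inj; rewrite Fx.
  + exact: chain0.
  + exact: chain1.
  + by symmetry; exact: chain0.
  + by case: (ends _ _ x0 x1').
  + by symmetry; exact: chain1.
  + by case: (ends _ _ x0' x1).
- move=> k l g x y [[F Fx ->]|[xb ->]|[xb ->]].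
  + apply: Or31; exists (sact g F).
      by rewrite col_chain_nat Fx /p col_map_nat.
    by rewrite -sfun_nat last_map_nat.
  + by apply: Or32; split; [exact: (cyl_end_act xb) | rewrite /p col_map_nat sfun_nat].
  + by apply: Or33; split; [exact: (cyl_end_act xb) | rewrite /p col_map_nat sfun_nat].
- move=> m x; split=> [[y [[F Fx _]|[xb _]|[xb _]]]|[x0|[xb|xb]]].
  + left; have /yp_eq /(_ 0 (leq0n m)) := mkE (raw_map_ok cyl_proj (col_ok x)).
    by rewrite -/(col_map cyl_proj x) -/(p m x) -Fx => <-.
  + by right; left.
  + by right; right.
  + have [|F Fx] := @col_chain_surj n Y m (p m x).
      have /yp_eq /(_ 0 (leq0n m)) := mkE (raw_map_ok cyl_proj (col_ok x)).
      by rewrite -/(col_map cyl_proj x) -/(p m x) => ->.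
    by exists (H m (F, (last_map_fun x).2)); apply: Or31; exists F.
  + by exists (f m (p m x)); apply: Or32.
  + by exists (f' m (p m x)); apply: Or33.
pose Q : smap (sprod (diag Y) (std_simplex 1)) (diag cyl) :=
  @SMap (sprod (diag Y) (std_simplex 1)) (diag cyl) (fun _ yh => yh) (fun _ _ _ _ => erefl).
have pE m (y : diag Y m) (h : hom m 1) : p m (@emb n cyl m (y, h)) = emb y.
  apply: col_ext; apply: req_trans (mkE _) _.
  apply: req_trans (raw_map_req cyl_proj (mkE _)) _.
  by apply: req_sym; exact: mkE.
exists (scomp v (scomp (diag_emb cyl) Q)); split=> m y /=.
  by apply: vP; apply: Or32; rewrite pE; split.
by apply: vP; apply: Or33; rewrite pE; split.
Qed.

(** Homotopies are zigzags, so each intermediate map is extended to the collage first. Reflexivity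
    has content: two extensions of one map are compared, by means of the constant homotopy. *)
Lemma rho_inj_extension (w w' : smap X K) : homotopic w w' ->
  forall f f', extends_chain w f -> extends_chain w' f' ->
  homotopic (scomp f (diag_emb Y)) (scomp f' (diag_emb Y)).
Proof.
elim=> {w w'} [w w' ww'|w|w w' _ IH|w1 w2 w3 _ IH12 _ IH23] f f' fw fw'.
- by apply: rst_step; apply: homotopic_extension ww' fw fw'.
- apply: rst_step; apply: homotopic_extension fw fw'.
  exists (@SMap (sprod X (std_simplex 1)) K (fun k Fh => w k Fh.1)
    (fun k l g Fh => sfun_nat w g Fh.1)).
  by split.
- by apply: rst_sym; exact: IH.
- have [g gw] := chain_extension w2.
  by apply: rst_trans (IH12 _ _ fw gw) (IH23 _ _ gw fw').
Qed.

(** Composing with the retraction turns [u] and [v] into extensions of their composites with [rho],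
    and restriction to Y gives [u] and [v] back. *)
Lemma rho_inj (u v : smap (diag Y) K) :
  homotopic (scomp u (diag_map (rho Y))) (scomp v (diag_map (rho Y))) -> homotopic u v.
Proof.
move=> uv.
have E (g : smap (diag Y) K) : g = scomp (scomp g (collage_retr Y)) (diag_emb Y).
  by apply: smap_ext => k y /=; rewrite last_map_emb.
rewrite (E u) (E v); apply: (rho_inj_extension uv) => m F /=; congr (_ m _).
  exact: last_map_chain.
exact: last_map_chain.
Qed.

End Homotopy.

Theorem theorem9p21 (n : nat) (hn : (0 < n)%N) (Y : mset n) :
  mset_weak_equiv (rho Y).
Proof. by move=> K kanK; split; [exact: rho_inj | exact: rho_surj]. Qed.
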